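(* Let $A$ be a positive self-adjoint operator with discrete spectrum in $H$ (as in the context). Let $h>0$, $k>0$, and assume the following. (1) $F:D(A^{1/2})\to H$ is locally Lipschitz: for every $R>0$ there is $L_{F,R}>0$ such that $\|F(u^1)-F(u^2)\|\le L_{F,R}\|A^{1/2}(u^1-u^2)\|$ whenever $\|A^{1/2}u^i\|\le R$, $i=1,2$. (2) $F(u)=\Pi'(u)+F^*(u)$, where $\Pi'$ is the Fréchet derivative of a $C^1$-functional $\Pi:D(A^{1/2})\to\mathbb R$, and $F^*:D(A^{1/2})\to H$ satisfies $\|F^*(u^1)-F^*(u^2)\|^2\le c_0\|A^{1/2}(u^1-u^2)\|^2$ for all $u^1,u^2\in D(A^{1/2})$ and some constant $c_0$. Moreover $\Pi=\Pi_0+\Pi_1$, where $\Pi_0\ge 0$, $\Pi_0$ is bounded on bounded sets of $D(A^{1/2})$, and for every $\eta>0$ there is $C_\eta>0$ with $|\Pi_1(u)|\le \eta(\|A^{1/2}u\|^2+\Pi_0(u))+C_\eta$ for all $u\in D(A^{1/2})$. (3) $M:W\to H$ is locally Lipschitz: for every $\varrho>0$ there is $C_\varrho$ such that $\|M(\varphi^1)-M(\varphi^2)\|\le C_\varrho|\varphi^1-\varphi^2|_W$ whenever $|\varphi^j|_W\le\varrho$, $j=1,2$. (4) There are $M_0,M_1\ge 0$ with $\|M(\varphi)\|\le M_0+M_1\{\max_{\theta\in[-h,0]}\|A^{1/2}\varphi(\theta)\|+\max_{\theta\in[-h,0]}\|\dot\varphi(\theta)\|\}$ for all $\varphi\in W$.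 Then for any $\varphi\in W$ there exists a unique global mild solution $U(t)=(u(t);\dot u(t))$ on $[0,+\infty)$ of $$\ddot u(t)+k\dot u(t)+Au(t)+F(u(t))+M(u_t)=0,\ t>0,\qquad u(\theta)=\varphi(\theta),\ \theta\in[-h,0].$$ Solutions satisfy, for all $t\ge0$, the energy equality $$\mathcal E(u(t),\dot u(t))+k\int_0^t\|\dot u(s)\|^2ds=\mathcal E(u(0),\dot u(0))-\int_0^t(F^*(u(s)),\dot u(s))\,ds-\int_0^t(M(u_s),\dot u(s))\,ds,$$ where $\mathcal E(u,v)=\frac12(\|v\|^2+\|A^{1/2}u\|^2)+\Pi_0(u)+\Pi_1(u)$. Moreover, for any $\varrho>0$ and $T>0$ there exists $C_{\varrho,T}$ such that $$\|A^{1/2}(u^1(t)-u^2(t))\|+\|\dot u^1(t)-\dot u^2(t)\|\le C_{\varrho,T}|\varphi^1-\varphi^2|_W,\qquad t\in[0,T],$$ for any two mild solutions $u^1,u^2$ with initial data $\varphi^1,\varphi^2\in W$ such that $|\varphi^j|_W\le\varrho$, $j=1,2$.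
   Context: $H$ is a real separable Hilbert space with inner product $(\cdot,\cdot)$ and norm $\|\cdot\|$. $A$ is a positive operator with discrete spectrum: there is an orthonormal basis $\{e_k\}$ of $H$ with $Ae_k=\mu_ke_k$, $0<\mu_1\le\mu_2\le\dots$, $\mu_k\to\infty$. Powers $A^\alpha$ are defined spectrally and $D(A^\alpha)$ is normed by $\|A^\alpha\cdot\|$. The phase space is $W=C([-h,0];D(A^{1/2}))\cap C^1([-h,0];H)$ with norm $|\varphi|_W=\max_{\theta\in[-h,0]}\|A^{1/2}\varphi(\theta)\|+\max_{\theta\in[-h,0]}\|\dot\varphi(\theta)\|$. For a function $u$ of time, $u_t(\theta)=u(t+\theta)$, $\theta\in[-h,0]$. The Fréchet derivative $\Pi'(u)\in D(A^{1/2})'$ satisfies $|\Pi(u+v)-\Pi(u)-\langle\Pi'(u),v\rangle|=o(\|A^{1/2}v\|)$ for $v\in D(A^{1/2})$; $H$ is embedded in $D(A^{1/2})'$ in the usual way. Let $Y=D(A^{1/2})\times H$ and let $e^{-t\mathcal A}$ be the $C_0$-semigroup on $Y$ generated by $-\mathcal A$, where $\mathcal A(u;v)=(-v;Au+kv)$, $D(\mathcal A)=D(A)\times D(A^{1/2})$. A mild solution on $[0,T]$ is a function $u\in C([-h,T];D(A^{1/2}))\cap C^1([-h,T];H)$ with $u=\varphi$ on $[-h,0]$ such that $U(t)=(u(t);\dot u(t))$ satisfies $$U(t)=e^{-t\mathcal A}U(0)+\int_0^te^{-(t-s)\mathcal A}\big(0;-F(u(s))-M(u_s)\big)ds,\quad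 t\in[0,T].$$ A mild solution on a semi-interval ($[0,T)$ or $[0,\infty)$) is defined similarly. $U(t)$ is also called a mild solution. *)

(* Defs.v *)
From Stdlib Require Import Reals Lra Lia ProofIrrelevance.
From Coquelicot Require Import Coquelicot.
Open Scope R_scope.

(** * Real Hilbert spaces *)

Record Hilbert := {
  hilbert_space :> CompleteNormedModule R_AbsRing;
  inner : hilbert_space -> hilbert_space -> R;
  inner_sym : forall x y, inner x y = inner y x;
  inner_plus_l : forall x y z, inner (plus x y) z = inner x z + inner y z;
  inner_scal_l : forall (a : R) x y, inner (scal a x) y = a * inner x y;
  inner_ge_0 : forall x, 0 <= inner x x;
  norm_inner : forall x, norm x = sqrt (inner x x)
}.

Arguments inner {_} _ _.

(** * Self-adjoint operators with discrete spectrum *)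

(** An unbounded operator is a domain [dom] together with a function [T];
    the values of [T] outside [dom] are irrelevant.  The equivalence says that
    the graph of [T] is the graph of its adjoint. *)
Definition self_adjoint {H : Hilbert} (dom : H -> Prop) (T : H -> H) : Prop :=
  (forall (x : H) (eps : posreal), exists y, dom y /\ norm (minus y x) < eps) /\
  (forall x y : H,
     (dom x /\ T x = y) <-> (forall z, dom z -> inner x (T z) = inner y z)).

(** The eigenpairs [(mu_k, e_k)], [k = 1, 2, ...], are indexed from [0].  The
    countable orthonormal basis makes [H] separable, and positivity of the
    operator is positivity of its eigenvalues. *)
Record DiscreteOperator (H : Hilbert) := {
  op_dom : H -> Prop;
  op_fun : H -> H;
  op_self_adjoint : self_adjoint op_dom op_fun;
  eigval : nat -> R;
  eigvec : nat -> H;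
  eigvec_orthonormal :
    forall i j, inner (eigvec i) (eigvec j) = if Nat.eqb i j then 1 else 0;
  eigvec_basis :
    forall x : H, is_series (fun i => scal (inner x (eigvec i)) (eigvec i)) x;
  eigvec_dom : forall i, op_dom (eigvec i);
  eigvec_eq : forall i, op_fun (eigvec i) = scal (eigval i) (eigvec i);
  eigval_pos : 0 < eigval 0%nat;
  eigval_incr : forall i, eigval i <= eigval (S i);
  eigval_infty : is_lim_seq eigval p_infty
}.

Arguments op_dom {_} _ _.
Arguments op_fun {_} _ _.
Arguments op_self_adjoint {_} _.
Arguments eigval {_} _ _.
Arguments eigvec {_} _ _.
Arguments eigvec_orthonormal {_} _ _ _.
Arguments eigvec_basis {_} _ _.
Arguments eigvec_dom {_} _ _.
Arguments eigvec_eq {_} _ _.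
Arguments eigval_pos {_} _.
Arguments eigval_incr {_} _ _.
Arguments eigval_infty {_} _.

(** * Fractional powers and their domains *)

Section Powers.

Context {H : Hilbert} (A : DiscreteOperator H) (alpha : R).

Definition pow_term (x : H) (i : nat) : H :=
  scal (Rpower (eigval A i) alpha * inner x (eigvec A i)) (eigvec A i).

(** By orthonormality of the eigenvectors, this series converges in [H] iff
    [sum_i eigval_i ^ (2 alpha) (x, e_i)^2] is finite. *)
Definition pow_dom (x : H) : Prop := ex_series (pow_term x).

(** Meaningful for [x] in [pow_dom]. *)
Definition pow_fun (x : H) : H := iota (is_series (pow_term x)).

Lemma pow_fun_unique (x y : H) : is_series (pow_term x) y -> pow_fun x = y.
Proof.
intros Hy. apply iota_unique; [|exact Hy].
intros z Hz. exact (filterlim_locally_unique _ _ _ Hz Hy).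
Qed.

Lemma pow_fun_correct (x : H) : pow_dom x -> is_series (pow_term x) (pow_fun x).
Proof. intros [y Hy]. now rewrite (pow_fun_unique x y Hy). Qed.

Lemma pow_series_plus (x y a b : H) :
  is_series (pow_term x) a -> is_series (pow_term y) b ->
  is_series (pow_term (plus x y)) (plus a b).
Proof.
intros Ha Hb.
apply is_series_ext with (2 := is_series_plus _ _ _ _ Ha Hb).
intros i; unfold pow_term. rewrite inner_plus_l, Rmult_plus_distr_l.
symmetry; exact (scal_distr_r (V := H) _ _ _).
Qed.

Lemma pow_series_scal (c : R) (x a : H) :
  is_series (pow_term x) a -> is_series (pow_term (scal c x)) (scal c a).
Proof.
intros Ha.
apply is_series_ext with (2 := is_series_scal c _ _ Ha).
intros i; unfold pow_term. rewrite inner_scal_l, scal_assoc.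
f_equal. unfold mult; simpl; ring.
Qed.

Lemma inner_zero_l (y : H) : inner zero y = 0.
Proof. assert (E := inner_plus_l H zero zero y). rewrite plus_zero_l in E. lra. Qed.

Lemma pow_series_zero : is_series (pow_term zero) zero.
Proof.
assert (E : forall n, sum_n (pow_term (zero : H)) n = zero).
{ intros n. induction n as [|n IH].
  - rewrite sum_O. unfold pow_term. rewrite inner_zero_l, Rmult_0_r.
    exact (scal_zero_l (V := H) _).
  - rewrite sum_Sn, IH, plus_zero_l. unfold pow_term.
    rewrite inner_zero_l, Rmult_0_r. exact (scal_zero_l (V := H) _). }
apply filterlim_ext with (f := fun _ : nat => (zero : H)).
- intros n. now rewrite E.
- apply filterlim_const.
Qed.

Definition Dpow : Type := { x : H | pow_dom x }.
Definition emb (u : Dpow) : H := proj1_sig u.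

Lemma pow_dom_emb (u : Dpow) : pow_dom (emb u).
Proof. exact (proj2_sig u). Qed.

Lemma emb_inj (u v : Dpow) : emb u = emb v -> u = v.
Proof.
destruct u as [x Hx], v as [y Hy]; simpl; intros ->.
f_equal; apply proof_irrelevance.
Qed.

Definition Dpow_plus (u v : Dpow) : Dpow.
Proof.
exists (plus (emb u) (emb v)).
exists (plus (pow_fun (emb u)) (pow_fun (emb v))).
apply pow_series_plus; apply pow_fun_correct, pow_dom_emb.
Defined.

Definition Dpow_scal (c : R) (u : Dpow) : Dpow.
Proof.
exists (scal c (emb u)).
exists (scal c (pow_fun (emb u))).
apply pow_series_scal, pow_fun_correct, pow_dom_emb.
Defined.

Definition Dpow_opp (u : Dpow) : Dpow.
Proof.
exists (opp (emb u)).
exact (eq_ind _ pow_dom (pow_dom_emb (Dpow_scal (opp one) u)) _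
         (scal_opp_one (V := H) (emb u))).
Defined.

Definition Dpow_zero : Dpow := exist _ zero (ex_intro _ zero pow_series_zero).

Definition Dpow_AbelianMonoid_mixin : AbelianMonoid.mixin_of Dpow.
Proof.
apply (AbelianMonoid.Mixin Dpow Dpow_plus Dpow_zero);
  intros; apply emb_inj; simpl.
- exact (plus_comm (G := H) _ _).
- exact (plus_assoc (G := H) _ _ _).
- exact (plus_zero_r (G := H) _).
Defined.

Canonical Dpow_AbelianMonoid :=
  AbelianMonoid.Pack Dpow Dpow_AbelianMonoid_mixin Dpow.

Definition Dpow_AbelianGroup_mixin : AbelianGroup.mixin_of Dpow_AbelianMonoid.
Proof.
apply (AbelianGroup.Mixin Dpow_AbelianMonoid Dpow_opp).
intros; apply emb_inj; simpl. exact (plus_opp_r (G := H) _).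
Defined.

Canonical Dpow_AbelianGroup :=
  AbelianGroup.Pack Dpow
    (AbelianGroup.Class _ Dpow_AbelianMonoid_mixin Dpow_AbelianGroup_mixin) Dpow.

Definition Dpow_ModuleSpace_mixin :
  ModuleSpace.mixin_of R_Ring Dpow_AbelianGroup.
Proof.
apply (ModuleSpace.Mixin R_Ring Dpow_AbelianGroup Dpow_scal);
  intros; apply emb_inj; simpl.
- exact (scal_assoc (V := H) _ _ _).
- exact (scal_one (V := H) _).
- exact (scal_distr_l (V := H) _ _ _).
- exact (scal_distr_r (V := H) _ _ _).
Defined.

Canonical Dpow_ModuleSpace :=
  ModuleSpace.Pack R_Ring Dpow
    (ModuleSpace.Class R_Ring _ (AbelianGroup.class Dpow_AbelianGroup)
       Dpow_ModuleSpace_mixin) Dpow.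

Definition Dpow_norm (u : Dpow) : R := norm (pow_fun (emb u)).

Lemma pow_fun_plus (u v : Dpow) :
  pow_fun (emb (plus u v)) = plus (pow_fun (emb u)) (pow_fun (emb v)).
Proof.
apply pow_fun_unique, pow_series_plus; apply pow_fun_correct, pow_dom_emb.
Qed.

Lemma pow_fun_scal (c : R) (u : Dpow) :
  pow_fun (emb (scal c u)) = scal c (pow_fun (emb u)).
Proof.
apply pow_fun_unique, pow_series_scal, pow_fun_correct, pow_dom_emb.
Qed.

Lemma Dpow_norm_triangle (u v : Dpow) :
  Dpow_norm (plus u v) <= Dpow_norm u + Dpow_norm v.
Proof. unfold Dpow_norm. rewrite pow_fun_plus. exact (norm_triangle (V := H) _ _). Qed.

Lemma Dpow_norm_scal (c : R) (u : Dpow) :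
  Dpow_norm (scal c u) <= Rabs c * Dpow_norm u.
Proof. unfold Dpow_norm. rewrite pow_fun_scal. exact (norm_scal (V := H) _ _). Qed.

Lemma Dpow_norm_opp (u : Dpow) : Dpow_norm (opp u) = Dpow_norm u.
Proof.
assert (E := scal_opp_one (V := Dpow_ModuleSpace) u).
transitivity (Dpow_norm (scal (opp one) u)); [now rewrite E|].
unfold Dpow_norm. rewrite pow_fun_scal.
transitivity (norm (opp (pow_fun (emb u)))).
- f_equal. exact (scal_opp_one (V := H) _).
- exact (norm_opp (V := H) _).
Qed.

Lemma inner_eigvec_le (x : H) (i : nat) : Rabs (inner x (eigvec A i)) <= norm x.
Proof.
set (e := eigvec A i). set (a := inner x e).
assert (He : inner e e = 1).
{ unfold e. now rewrite eigvec_orthonormal, Nat.eqb_refl. }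
assert (Hp := inner_ge_0 H (plus x (scal (- a) e))).
rewrite inner_plus_l, inner_scal_l in Hp.
rewrite (inner_sym H x), (inner_sym H e), !inner_plus_l, !inner_scal_l in Hp.
rewrite (inner_sym H e x), He in Hp. fold a in Hp.
rewrite norm_inner, <- (sqrt_Rsqr_abs a).
apply sqrt_le_1_alt. unfold Rsqr. lra.
Qed.

Lemma inner_sum_n (x : H) (i n : nat) :
  (i <= n)%nat ->
  inner (sum_n (pow_term x) n) (eigvec A i)
  = Rpower (eigval A i) alpha * inner x (eigvec A i).
Proof.
assert (E : forall m, inner (pow_term x m) (eigvec A i)
   = if Nat.eqb m i then Rpower (eigval A i) alpha * inner x (eigvec A i) else 0).
{ intros m. unfold pow_term. rewrite inner_scal_l, eigvec_orthonormal.
  destruct (Nat.eqb_spec m i) as [->|_]; ring. }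
assert (Z : forall m, (m < i)%nat ->
   inner (sum_n (pow_term x) m) (eigvec A i) = 0).
{ intros m. induction m as [|m IH]; intros Hm.
  - rewrite sum_O, E. now destruct (Nat.eqb_spec 0 i); [lia|].
  - rewrite sum_Sn, inner_plus_l, IH, E by lia.
    destruct (Nat.eqb_spec (S m) i); [lia|ring]. }
induction n as [|n IH]; intros Hn.
- rewrite sum_O, E. now destruct (Nat.eqb_spec 0 i); [|lia].
- rewrite sum_Sn, inner_plus_l, E.
  destruct (Nat.eqb_spec (S n) i) as [<-|Hi].
  + rewrite Z by lia. ring.
  + rewrite IH by lia. ring.
Qed.

Lemma pow_fun_inj_0 (x : H) : pow_dom x -> pow_fun x = zero -> x = zero.
Proof.
intros Hd H0. assert (Hs := pow_fun_correct x Hd). rewrite H0 in Hs.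
assert (C : forall i, inner x (eigvec A i) = 0).
{ intros i.
  assert (Hc : Rpower (eigval A i) alpha * inner x (eigvec A i) = 0).
  { apply cond_eq. intros eps Heps. rewrite Rminus_0_r.
    assert (L : locally (zero : H) (fun y => norm y < eps)).
    { apply (locally_le_locally_norm (V := H) zero (fun y => norm y < eps)).
      exists (mkposreal eps Heps).
      intros y Hy.
      exact (eq_ind _ (fun z => norm z < eps) Hy _ (minus_zero_r (G := H) y)). }
    destruct (Hs _ L) as [N HN].
    rewrite <- (inner_sum_n x i (Nat.max N i)) by lia.
    eapply Rle_lt_trans; [apply inner_eigvec_le|].
    apply HN. lia. }
  apply Rmult_integral in Hc. destruct Hc as [Hc|Hc]; [|exact Hc].
  exfalso. unfold Rpower in Hc. assert (P := exp_pos (alpha * ln (eigval A i))).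
  lra. }
apply filterlim_locally_unique with (1 := eigvec_basis A x).
apply filterlim_ext with (f := fun _ : nat => (zero : H)).
- intros n. induction n as [|n IH].
  + rewrite sum_O, C. symmetry; exact (scal_zero_l (V := H) _).
  + rewrite sum_Sn, <- IH, C, plus_zero_l. symmetry; exact (scal_zero_l (V := H) _).
- apply filterlim_const.
Qed.

Definition Dpow_ball (u : Dpow) (eps : R) (v : Dpow) : Prop :=
  Dpow_norm (minus v u) < eps.

Definition Dpow_UniformSpace_mixin : UniformSpace.mixin_of Dpow.
Proof.
apply (UniformSpace.Mixin Dpow Dpow_zero Dpow_ball); unfold Dpow_ball.
- intros u eps.
  refine (eq_ind_r (fun w => Dpow_norm w < eps) _ (minus_eq_zero u)).
  unfold Dpow_norm. simpl.
  rewrite (pow_fun_unique _ _ pow_series_zero).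
  exact (eq_ind_r (fun r => r < eps) (cond_pos eps) (norm_zero (V := H))).
- intros u v eps Hu. rewrite <- Dpow_norm_opp.
  exact (eq_ind_r (fun w => Dpow_norm w < eps) Hu (opp_minus u v)).
- intros u v w e1 e2 H1 H2.
  refine (eq_ind_r (fun z => Dpow_norm z < e1 + e2) _ (minus_trans v w u)).
  eapply Rle_lt_trans; [apply Dpow_norm_triangle|]. lra.
Defined.

Canonical Dpow_UniformSpace :=
  UniformSpace.Pack Dpow Dpow_UniformSpace_mixin Dpow.

Canonical Dpow_NormedModuleAux :=
  NormedModuleAux.Pack R_AbsRing Dpow
    (NormedModuleAux.Class R_AbsRing _ (ModuleSpace.class _ Dpow_ModuleSpace)
       Dpow_UniformSpace_mixin) Dpow.

Definition Dpow_NormedModule_mixin :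
  NormedModule.mixin_of R_AbsRing Dpow_NormedModuleAux.
Proof.
apply (NormedModule.Mixin R_AbsRing Dpow_NormedModuleAux Dpow_norm 1).
- exact Dpow_norm_triangle.
- exact Dpow_norm_scal.
- intros u v eps Huv. exact Huv.
- intros u v eps Huv. rewrite Rmult_1_l. exact Huv.
- intros u Hu. apply emb_inj; simpl. apply pow_fun_inj_0; [apply pow_dom_emb|].
  exact (norm_eq_zero (V := H) _ Hu).
Defined.

Canonical Dpow_NormedModule :=
  NormedModule.Pack R_AbsRing Dpow
    (NormedModule.Class R_AbsRing _ (NormedModuleAux.class _ Dpow_NormedModuleAux)
       Dpow_NormedModule_mixin) Dpow.

End Powers.

Arguments emb {H A alpha} _.

(** [D(A^{1/2})], whose [norm] is [u |-> ||A^{1/2} u||]. *)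
Definition Dhalf {H : Hilbert} (A : DiscreteOperator H) :
  NormedModule R_AbsRing := Dpow_NormedModule A (/ 2).

(** [Y = D(A^{1/2}) x H]. *)
Definition Yspace {H : Hilbert} (A : DiscreteOperator H) :
  NormedModule R_AbsRing := prod_NormedModule R_AbsRing (Dhalf A) H.

(** * Calculus on a set of times *)

(** Relative to [D], hence one-sided at the endpoints of an interval [D]. *)
Definition is_derive_on {V : NormedModule R_AbsRing} (D : R -> Prop)
  (f : R -> V) (t : R) (l : V) : Prop :=
  filterdiff f (within D (locally t)) (fun s : R => scal s l).

Definition derive_on {V : CompleteNormedModule R_AbsRing} (D : R -> Prop)
  (f : R -> V) (t : R) : V := iota (is_derive_on D f t).

Definition C1_on {V : CompleteNormedModule R_AbsRing} (D : R -> Prop)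
  (f : R -> V) : Prop :=
  (forall t, D t -> is_derive_on D f t (derive_on D f t)) /\
  continuous_on D (derive_on D f).

(** Supremum; it is the maximum for [f] continuous on [[a, b]]. *)
Definition max_on (a b : R) (f : R -> R) : R :=
  real (Lub_Rbar (fun y => exists x, a <= x <= b /\ y = f x)).

(** * The phase space [W] *)

(** An element of [W] is represented by a function on the whole line, of which
    only the restriction to [[-h, 0]] matters.  A map [M] defined on [W] is
    represented by a map on all functions [R -> D(A^{1/2})]; a Lipschitz bound
    in [Wnorm] forces it to depend on that restriction only. *)
Section Wspace.

Context {H : Hilbert} {A : DiscreteOperator H} (h : R).

Definition delay_interval (theta : R) : Prop := - h <= theta <= 0.

Definition in_W (phi : R -> Dhalf A) : Prop :=
  continuous_on delay_interval phi /\
  C1_on delay_interval (fun theta => emb (phi theta)).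

Definition Wnorm (phi : R -> Dhalf A) : R :=
  max_on (- h) 0 (fun theta => norm (phi theta)) +
  max_on (- h) 0
    (fun theta => norm (derive_on delay_interval (fun s => emb (phi s)) theta)).

Definition Wdist (phi psi : R -> Dhalf A) : R :=
  Wnorm (fun theta => minus (phi theta) (psi theta)).

End Wspace.

(** The segment [u_t]. *)
Definition segment {V : Type} (u : R -> V) (t : R) : R -> V :=
  fun theta => u (t + theta).

(** * Semigroups *)

Definition C0_semigroup {Y : NormedModule R_AbsRing} (S : R -> Y -> Y) : Prop :=
  (forall t, 0 <= t -> is_linear (S t)) /\
  (forall x, S 0 x = x) /\
  (forall t s x, 0 <= t -> 0 <= s -> S (t + s) x = S t (S s x)) /\
  (forall x, filterlim (fun t => S t x) (at_right 0) (locally x)).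

(** Graph of the infinitesimal generator. *)
Definition generator {Y : NormedModule R_AbsRing} (S : R -> Y -> Y) (x y : Y) :
  Prop :=
  filterlim (fun t : R => scal (/ t) (minus (S t x) x)) (at_right 0) (locally y).

(** Graph of the operator [(u; v) |-> (-v; A u + k v)] with domain
    [D(A) x D(A^{1/2})]. *)
Definition wave_operator {H : Hilbert} (A : DiscreteOperator H) (k : R)
  (x y : Yspace A) : Prop :=
  op_dom A (emb (fst x)) /\
  exists v : Dhalf A,
    emb v = snd x /\
    y = (opp v, plus (op_fun A (emb (fst x))) (scal k (emb v))).

Definition wave_semigroup {H : Hilbert} (A : DiscreteOperator H) (k : R)
  (S : R -> Yspace A -> Yspace A) : Prop :=
  C0_semigroup S /\
  (forall x y : Yspace A, generator S x y <-> wave_operator A k x (opp y)).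

(** * Mild solutions *)

(** [[-h, T]], and [[-h, +oo)] for [T = p_infty]. *)
Definition time_domain (h : R) (T : Rbar) (t : R) : Prop :=
  - h <= t /\ Rbar_le t T.

Section Mild.

Context {H : Hilbert} {A : DiscreteOperator H} (h : R) (T : Rbar).

(** The time derivative of [u], taken in [H]. *)
Definition udot (u : R -> Dhalf A) : R -> H :=
  derive_on (time_domain h T) (fun s => emb (u s)).

(** Mild solution on [[0, T]], or on [[0, +oo)] for [T = p_infty]. *)
Definition mild_solution (S : R -> Yspace A -> Yspace A)
  (F : Dhalf A -> H) (M : (R -> Dhalf A) -> H)
  (phi u : R -> Dhalf A) : Prop :=
  continuous_on (time_domain h T) u /\
  C1_on (time_domain h T) (fun s => emb (u s)) /\
  (forall theta, - h <= theta <= 0 -> u theta = phi theta) /\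
  (forall t : R, 0 <= t -> Rbar_le t T ->
   exists I : Yspace A,
     is_RInt (fun s => S (t - s) (zero, minus (opp (F (u s))) (M (segment u s)))
                : Yspace A) 0 t I /\
     (u t, udot u t) = plus (S t (u 0, udot u 0)) I).

End Mild.

(** * Functionals on [D(A^{1/2})] *)

(** [dP] is the Frechet derivative of [P], and it is continuous for the norm of
    the dual space. *)
Definition C1_functional {V : NormedModule R_AbsRing} (P : V -> R)
  (dP : V -> V -> R) : Prop :=
  (forall u : V, filterdiff P (locally u) (dP u)) /\
  (forall (u : V) (eps : posreal), exists delta : posreal,
   forall w : V, norm (minus w u) < delta ->
   forall v : V, Rabs (dP w v - dP u v) <= eps * norm v).

Definition energy {H : Hilbert} {A : DiscreteOperator H}
  (Pi0 Pi1 : Dhalf A -> R) (u : Dhalf A) (v : H) : R :=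
  / 2 * (norm v ^ 2 + norm u ^ 2) + Pi0 u + Pi1 u.

(* Main.v *)
Require Import Defs.
From Stdlib Require Import Reals Lra Lia Psatz Classical ClassicalEpsilon
  FunctionalExtensionality.
From Coquelicot Require Import Coquelicot.
Open Scope R_scope.

(** The unknown [U = (u; v)] is studied through its modes, the coefficients
    [p_i = (u, e_i)] and [q_i = (v, e_i)].

    For an orbit of the semigroup that starts in the domain of the generator,
    [p_i' = q_i] and [q_i' = - mu_i p_i - k q_i], as right derivatives.  Both
    equations are bounded functionals of the state, hence they extend to all orbits
    by density ([weak_generator]); this uses a bound of the semigroup near time [0],
    which comes from the uniform boundedness principle ([semigroup_local_bound]).
    Duhamel's formula adds the coefficient of the forcing to the second equation
    ([mild_rderiv]).  So each mode of a mild solution is a damped oscillator, and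
    the sum of the energy balances of all oscillators is the linear energy balance
    ([linear_energy]).  Without forcing it says that the semigroup is a contraction
    ([wave_contraction]).

    In the nonlinear equation, the part [Pi'] of the force is integrated by the chain
    rule.  The solution is not differentiable in [D(A^{1/2})], but its spectral
    projections are, and the formula for them has a limit since
    [Pi' = F - Fstar] takes its values in [H] ([potential_chain]).  This gives the
    energy equality.

    The energy bounds the norm of [U] from both sides, and [Fstar] and [M] grow at
    most linearly.  As [M] depends on the past, the resulting inequality is closed by
    an exponential barrier instead of Gronwall's lemma ([quadratic_barrier]): the
    outcome is a bound of solutions by [K exp (b t)], where [K] and [b] depend on
    the size of the data only ([a_priori_bound]).  Below this bound [F] and [M] are
    Lipschitz, and the linear energy balance of the difference of two solutions, with
    a second barrier, gives the Lipschitz dependence on the data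
    ([continuous_dependence]) and thereby uniqueness.

    For existence, the nonlinearity is composed with the radial retraction of [W] onto
    a ball whose radius grows in time like twice the a priori bound.  The result is
    globally Lipschitz on bounded time intervals, so that Picard iteration converges
    ([picard_solution]), and the a priori bound shows that the solution never feels
    the retraction ([global_solution]). *)

(** * Linear identities in modules over the reals *)

(** Syntax of linear combinations: an identity between two of them over the
    same vectors follows from the equality of their real coefficients. *)
Inductive lin_expr : Type :=
| LVar (i : nat)
| LZero
| LPlus (a b : lin_expr)
| LMinus (a b : lin_expr)
| LOpp (a : lin_expr)
| LScal (r : R) (a : lin_expr).

Fixpoint lin_eval {V : ModuleSpace R_Ring} (l : list V) (e : lin_expr) : V :=
  match e with
  | LVar i => List.nth i l zero
  | LZero => zero
  | LPlus a b => plus (lin_eval l a) (lin_eval l b)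
  | LMinus a b => minus (lin_eval l a) (lin_eval l b)
  | LOpp a => opp (lin_eval l a)
  | LScal r a => scal (r : R_Ring) (lin_eval l a)
  end.

Fixpoint lin_coef (e : lin_expr) (j : nat) : R :=
  match e with
  | LVar i => if Nat.eqb i j then 1 else 0
  | LZero => 0
  | LPlus a b => lin_coef a j + lin_coef b j
  | LMinus a b => lin_coef a j - lin_coef b j
  | LOpp a => - lin_coef a j
  | LScal r a => r * lin_coef a j
  end.

Fixpoint lin_comb {V : ModuleSpace R_Ring} (c : nat -> R) (l : list V) : V :=
  match l with
  | nil => zero
  | (x :: l')%list => plus (scal (c O : R_Ring) x) (lin_comb (fun i => c (S i)) l')
  end.

Section LinComb.
Context {V : ModuleSpace R_Ring}.

Lemma lin_comb_ext (l : list V) c d :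
  (forall i, c i = d i) -> lin_comb c l = lin_comb d l.
Proof.
revert c d; induction l as [|x l IH]; intros c d E; [reflexivity|].
simpl. rewrite E. f_equal. apply IH. intros i; apply E.
Qed.

Lemma lin_comb_zero (l : list V) : lin_comb (fun _ => 0) l = zero.
Proof.
induction l as [|x l IH]; [reflexivity|].
simpl. rewrite IH, plus_zero_r. exact (scal_zero_l x).
Qed.

Lemma plus_4_swap (a b c d : V) :
  plus (plus a b) (plus c d) = plus (plus a c) (plus b d).
Proof.
rewrite <- !plus_assoc. f_equal. rewrite !plus_assoc. f_equal. apply plus_comm.
Qed.

Lemma lin_comb_plus (l : list V) c d :
  plus (lin_comb c l) (lin_comb d l) = lin_comb (fun i => c i + d i) l.
Proof.
revert c d; induction l as [|x l IH]; intros c d; [apply plus_zero_l|].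
simpl. rewrite plus_4_swap, IH. f_equal.
symmetry; exact (scal_distr_r (c O : R_Ring) (d O) x).
Qed.

Lemma lin_comb_scal (l : list V) (r : R) c :
  scal (r : R_Ring) (lin_comb c l) = lin_comb (fun i => r * c i) l.
Proof.
revert c; induction l as [|x l IH]; intros c; [exact (scal_zero_r (r : R_Ring))|].
simpl. rewrite scal_distr_l, IH. f_equal. exact (scal_assoc (r : R_Ring) _ x).
Qed.

Lemma lin_comb_opp (l : list V) c :
  opp (lin_comb c l) = lin_comb (fun i => - c i) l.
Proof.
rewrite <- scal_opp_one.
transitivity (lin_comb (fun i => (-1) * c i) l).
- exact (lin_comb_scal l (-1) c).
- apply lin_comb_ext; intros i; ring.
Qed.

Lemma lin_comb_var (l : list V) i :
  lin_comb (fun j => if Nat.eqb i j then 1 else 0) l = List.nth i l zero.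
Proof.
revert i; induction l as [|x l IH]; intros [|i]; try reflexivity; simpl.
- rewrite lin_comb_zero, plus_zero_r. exact (scal_one x).
- rewrite IH. transitivity (plus zero (List.nth i l (zero : V))).
  + f_equal. exact (scal_zero_l x).
  + apply plus_zero_l.
Qed.

Lemma lin_eval_comb (l : list V) e : lin_eval l e = lin_comb (lin_coef e) l.
Proof.
induction e as [i| |a IHa b IHb|a IHa b IHb|a IHa|r a IHa]; simpl.
- symmetry; apply lin_comb_var.
- symmetry; apply lin_comb_zero.
- rewrite IHa, IHb. apply lin_comb_plus.
- unfold minus. rewrite IHa, IHb, lin_comb_opp. apply lin_comb_plus.
- rewrite IHa. apply lin_comb_opp.
- rewrite IHa. apply lin_comb_scal.
Qed.

Lemma lin_eval_eq (l : list V) e f :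
  lin_comb (lin_coef e) l = lin_comb (lin_coef f) l -> lin_eval l e = lin_eval l f.
Proof. now rewrite !lin_eval_comb. Qed.

End LinComb.

Ltac atom_index x l :=
  lazymatch l with
  | (?y :: ?l')%list =>
      match constr:(tt) with
      | _ => let _ := match constr:(tt) with _ => unify x y end in constr:(O)
      | _ => let n := atom_index x l' in constr:(S n)
      end
  end.

Ltac in_atoms x l :=
  lazymatch l with
  | nil => constr:(false)
  | (?y :: ?l')%list =>
      match constr:(tt) with
      | _ => let _ := match constr:(tt) with _ => unify x y end in constr:(true)
      | _ => in_atoms x l'
      end
  end.

Ltac collect_atoms V e l :=
  lazymatch e with
  | @plus _ ?a ?b => let l := collect_atoms V a l in collect_atoms V b l
  | @minus _ ?a ?b => let l := collect_atoms V a l in collect_atoms V b l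
  | @opp _ ?a => collect_atoms V a l
  | @scal _ _ ?r ?a => collect_atoms V a l
  | @zero _ => l
  | ?x => lazymatch in_atoms x l with
          | true => l
          | false => constr:(@cons (ModuleSpace.sort R_Ring V) x l)
          end
  end.

Ltac reify_lin e l :=
  lazymatch e with
  | @plus _ ?a ?b =>
      let a := reify_lin a l in let b := reify_lin b l in constr:(LPlus a b)
  | @minus _ ?a ?b =>
      let a := reify_lin a l in let b := reify_lin b l in constr:(LMinus a b)
  | @opp _ ?a => let a := reify_lin a l in constr:(LOpp a)
  | @scal _ _ ?r ?a => let a := reify_lin a l in constr:(LScal r a)
  | @zero _ => constr:(LZero)
  | ?x => let n := atom_index x l in constr:(LVar n)
  end.

Ltac real_coef_eq :=
  lazymatch goal with |- ?a = ?b => change (@eq R a b) end;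
  first [ring | field; solve [auto | lra] | lra].

Ltac module_eq_in V :=
  lazymatch goal with
  | |- ?a = ?b =>
      let l := collect_atoms V a (@nil (ModuleSpace.sort R_Ring V)) in
      let l := collect_atoms V b l in
      let ea := reify_lin a l in
      let eb := reify_lin b l in
      refine (@lin_eval_eq V l ea eb _);
      cbn [lin_comb lin_coef Nat.eqb];
      repeat first
        [ reflexivity
        | apply f_equal2; [apply f_equal2; [real_coef_eq | reflexivity]|] ]
  end.

Ltac module_eq V := module_eq_in (NormedModule.ModuleSpace R_AbsRing V).

(** The group structure of a normed module is reached along several convertible
    paths; equal norms are recognized as such when only one of them occurs. *)
Ltac one_path_from V :=
  change (NormedModule.AbelianMonoid R_AbsRing (CompleteNormedModule.NormedModule R_AbsRing V))
    with (CompleteNormedModule.AbelianMonoid R_AbsRing V) in *;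
  change (NormedModule.AbelianGroup R_AbsRing (CompleteNormedModule.NormedModule R_AbsRing V))
    with (CompleteNormedModule.AbelianGroup R_AbsRing V) in *;
  change (NormedModule.ModuleSpace R_AbsRing (CompleteNormedModule.NormedModule R_AbsRing V))
    with (CompleteNormedModule.ModuleSpace R_AbsRing V) in *;
  change (ModuleSpace.AbelianGroup R_Ring (CompleteNormedModule.ModuleSpace R_AbsRing V))
    with (CompleteNormedModule.AbelianGroup R_AbsRing V) in *.

Ltac one_path :=
  repeat match goal with
  | |- context [NormedModule.AbelianGroup _ (CompleteNormedModule.NormedModule _ ?V)] =>
      one_path_from V
  | |- context [NormedModule.ModuleSpace _ (CompleteNormedModule.NormedModule _ ?V)] =>
      one_path_from V
  | |- context [ModuleSpace.AbelianGroup _ (CompleteNormedModule.ModuleSpace _ ?V)] =>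
      one_path_from V
  | |- context [ModuleSpace.AbelianGroup _ (NormedModule.ModuleSpace _ ?V)] =>
      change (ModuleSpace.AbelianGroup R_Ring (NormedModule.ModuleSpace R_AbsRing V))
        with (NormedModule.AbelianGroup R_AbsRing V) in *
  | h : ?P |- _ => match P with
    | context [NormedModule.AbelianGroup _ (CompleteNormedModule.NormedModule _ ?V)] =>
        one_path_from V
    | context [NormedModule.ModuleSpace _ (CompleteNormedModule.NormedModule _ ?V)] =>
        one_path_from V
    | context [ModuleSpace.AbelianGroup _ (CompleteNormedModule.ModuleSpace _ ?V)] =>
        one_path_from V
    | context [ModuleSpace.AbelianGroup _ (NormedModule.ModuleSpace _ ?V)] =>
        change (ModuleSpace.AbelianGroup R_Ring (NormedModule.ModuleSpace R_AbsRing V))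
          with (NormedModule.AbelianGroup R_AbsRing V) in *
    end
  end.

(** * Limits, continuity and derivatives in terms of norms *)

Lemma near_and (t : R) (P Q : R -> Prop) :
  (exists d, 0 < d /\ forall s, Rabs (s - t) < d -> P s) ->
  (exists d, 0 < d /\ forall s, Rabs (s - t) < d -> Q s) ->
  exists d, 0 < d /\ forall s, Rabs (s - t) < d -> P s /\ Q s.
Proof.
intros [d1 [Hd1 H1]] [d2 [Hd2 H2]]. exists (Rmin d1 d2).
split; [now apply Rmin_glb_lt|]. intros s Hs. split.
- apply H1. eapply Rlt_le_trans; [exact Hs|apply Rmin_l].
- apply H2. eapply Rlt_le_trans; [exact Hs|apply Rmin_r].
Qed.

Section Norms.
Context {V : NormedModule R_AbsRing}.

Lemma norm_minus_sym (x y : V) : norm (minus x y) = norm (minus y x).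
Proof. rewrite <- norm_opp. f_equal. module_eq V. Qed.

Lemma norm_minus_triangle (y x z : V) :
  norm (minus x z) <= norm (minus x y) + norm (minus y z).
Proof.
eapply Rle_trans; [|apply norm_triangle]. right; f_equal. module_eq V.
Qed.

Lemma norm_plus_minus (x y : V) : norm x <= norm (minus x y) + norm y.
Proof.
eapply Rle_trans; [|apply norm_triangle]. right; f_equal. module_eq V.
Qed.

Lemma norm_minus_le (x y : V) : norm (minus x y) <= norm x + norm y.
Proof. rewrite <- (norm_opp y). apply norm_triangle. Qed.

Lemma norm_scal_R (r : R) (x : V) : norm (scal r x) = Rabs r * norm x.
Proof.
apply Rle_antisym; [exact (norm_scal (r : R_AbsRing) x)|].
destruct (Req_dec r 0) as [->|Hr].
- rewrite Rabs_R0, Rmult_0_l. apply norm_ge_0.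
- assert (P := Rabs_pos_lt r Hr).
  apply Rmult_le_reg_l with (/ Rabs r); [now apply Rinv_0_lt_compat|].
  rewrite <- Rmult_assoc, Rinv_l, Rmult_1_l, <- Rabs_inv by lra.
  replace x with (scal (/ r) (scal r x)) at 1 by module_eq V.
  exact (norm_scal (/ r : R_AbsRing) (scal r x)).
Qed.

Lemma norm_minus_self (x : V) : norm (minus x x) = 0.
Proof. assert (E : minus x x = zero) by module_eq V. rewrite E. exact norm_zero. Qed.

Lemma minus_zero_eq (x y : V) : minus x y = zero -> x = y.
Proof.
intros E. transitivity (plus (minus x y) y); [module_eq V|].
rewrite E. apply plus_zero_l.
Qed.

Lemma eq_of_small (x y : V) (C : R) :
  (forall eps, 0 < eps -> norm (minus x y) <= C * eps) -> x = y.
Proof.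
intros E. apply minus_zero_eq, norm_eq_zero.
assert (P := norm_ge_0 (minus x y)).
destruct (Rle_lt_dec (norm (minus x y)) 0) as [L|L]; [lra|].
set (n := norm (minus x y)) in *.
destruct (Rle_lt_dec C 0) as [LC|LC].
- specialize (E 1). lra.
- assert (Q : 0 < n / (2 * C)).
  { apply Rdiv_lt_0_compat; lra. }
  specialize (E _ Q). replace (C * (n / (2 * C))) with (n / 2) in E by (field; lra).
  lra.
Qed.

Lemma within_locally_iff (D : R -> Prop) (t : R) (P : R -> Prop) :
  within D (locally t) P <->
  exists d, 0 < d /\ forall s, D s -> Rabs (s - t) < d -> P s.
Proof.
split.
- intros [d Hd]. exists d. split; [apply cond_pos|]. intros s Ds Hs. now apply Hd.
- intros [d [Hd Hs]]. exists (mkposreal d Hd). intros s Bs Ds. now apply Hs.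
Qed.

Lemma filterlim_norm_iff {T : Type} (F : (T -> Prop) -> Prop) {FF : Filter F}
  (f : T -> V) (l : V) :
  filterlim f F (locally l) <->
  forall eps, 0 < eps -> F (fun x => norm (minus (f x) l) < eps).
Proof.
split.
- intros E eps He.
  exact (proj1 (filterlim_locally_ball_norm (F := F) f l) E (mkposreal eps He)).
- intros E. apply (proj2 (filterlim_locally_ball_norm (F := F) f l)).
  intros [eps He]. exact (E eps He).
Qed.

Lemma continuous_on_iff (D : R -> Prop) (f : R -> V) :
  continuous_on D f <->
  forall t, D t -> forall eps, 0 < eps ->
  exists d, 0 < d /\ forall s, D s -> Rabs (s - t) < d -> norm (minus (f s) (f t)) < eps.
Proof.
split.
- intros C t Dt eps He.
  assert (E := proj1 (filterlim_norm_iff (within D (locally t)) f (f t)) (C t Dt) eps He).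
  now apply within_locally_iff in E.
- intros C t Dt. apply (proj2 (filterlim_norm_iff (within D (locally t)) f (f t))). intros eps He.
  apply within_locally_iff. now apply C.
Qed.

Lemma continuous_iff (f : R -> V) (t : R) :
  continuous f t <->
  forall eps, 0 < eps ->
  exists d, 0 < d /\ forall s, Rabs (s - t) < d -> norm (minus (f s) (f t)) < eps.
Proof.
split.
- intros E eps He.
  destruct (proj1 (filterlim_norm_iff (locally t) f (f t)) E eps He) as [d Hd].
  exists d; split; [apply cond_pos|]. exact Hd.
- intros E. apply (proj2 (filterlim_norm_iff (locally t) f (f t))). intros eps He. destruct (E eps He) as [d [Hd Hs]].
  exists (mkposreal d Hd). exact Hs.
Qed.

Lemma continuous_near (f : R -> V) (t eps : R) : continuous f t -> 0 < eps ->
  exists d, 0 < d /\ forall s, Rabs (s - t) < d -> norm (minus (f s) (f t)) < eps.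
Proof. intros C. exact (proj1 (continuous_iff f t) C eps). Qed.

Lemma is_linear_scal (l : V) : is_linear (fun s : R => scal s l).
Proof. exact (is_linear_scal_l (K := R_AbsRing) l). Qed.

Lemma is_derive_on_iff (D : R -> Prop) (f : R -> V) (t : R) (l : V) :
  is_derive_on D f t l <->
  forall eps, 0 < eps -> exists d, 0 < d /\
    forall s, D s -> Rabs (s - t) < d ->
    norm (minus (minus (f s) (f t)) (scal (s - t) l)) <= eps * Rabs (s - t).
Proof.
unfold is_derive_on, filterdiff, is_domin. split.
- intros [_ E] eps He.
  assert (L : is_filter_lim (within D (locally t)) t).
  { intros P [d Hd]. exists d. intros s Bs _. now apply Hd. }
  assert (Q := E t L (mkposreal eps He)).
  now apply within_locally_iff in Q.
- intros E. split; [apply is_linear_scal|].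
  intros x Lx [eps He].
  destruct (Req_dec x t) as [->|Hx].
  + apply within_locally_iff. now apply E.
  + (* a limit of the filter other than [t] only exists when the filter is
       degenerate *)
    assert (Hp : 0 < Rabs (x - t) / 2).
    { assert (0 < Rabs (x - t)) by (apply Rabs_pos_lt; lra). lra. }
    assert (Q := Lx _ (locally_ball x (mkposreal _ Hp))).
    apply within_locally_iff in Q. destruct Q as [d [Hd Q]].
    apply within_locally_iff. exists (Rmin d (Rabs (x - t) / 2)).
    split; [now apply Rmin_glb_lt|].
    intros s Ds Hs. exfalso.
    assert (B := Q s Ds (Rlt_le_trans _ _ _ Hs (Rmin_l _ _))).
    assert (B' : Rabs (s - x) < Rabs (x - t) / 2) by exact B.
    assert (Hs' := Rlt_le_trans _ _ _ Hs (Rmin_r _ _)).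
    replace (x - t) with ((s - t) - (s - x)) in B', Hs' by ring.
    assert (T := Rabs_triang (s - t) (- (s - x))). rewrite Rabs_Ropp in T.
    unfold Rminus in T, B', Hs' at 1. unfold Rminus in *. lra.
Qed.

End Norms.

Lemma is_derive_on_unique {V : NormedModule R_AbsRing} (D : R -> Prop) (f : R -> V) (t : R) (l1 l2 : V) :
  (forall d, 0 < d -> exists s, D s /\ 0 < Rabs (s - t) < d) ->
  is_derive_on D f t l1 -> is_derive_on D f t l2 -> l1 = l2.
Proof.
intros Acc H1 H2. apply (eq_of_small l1 l2 2). intros eps He.
destruct (proj1 (is_derive_on_iff _ _ _ _) H1 eps He) as [d1 [Hd1 E1]].
destruct (proj1 (is_derive_on_iff _ _ _ _) H2 eps He) as [d2 [Hd2 E2]].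
destruct (Acc (Rmin d1 d2)) as [s [Ds [Hs0 Hs]]]; [now apply Rmin_glb_lt|].
specialize (E1 s Ds (Rlt_le_trans _ _ _ Hs (Rmin_l _ _))).
specialize (E2 s Ds (Rlt_le_trans _ _ _ Hs (Rmin_r _ _))).
apply Rmult_le_reg_l with (1 := Hs0).
rewrite <- norm_scal_R.
replace (scal (s - t) (minus l1 l2)) with
  (minus (minus (minus (f s) (f t)) (scal (s - t) l2))
         (minus (minus (f s) (f t)) (scal (s - t) l1))) by module_eq V.
eapply Rle_trans; [apply norm_minus_le|]. lra.
Qed.

(** * Induction along an interval *)

(** Compactness of an interval in the form of an induction: the supremum of the
    points up to which [P] holds is reached, and it can be passed. *)
Lemma real_induction (P : R -> Prop) (a b : R) :
  P a ->
  (forall t, a <= t < b -> (forall s, a <= s <= t -> P s) ->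
     exists d, 0 < d /\ forall s, t < s < t + d -> s <= b -> P s) ->
  (forall t, a < t <= b -> (forall s, a <= s < t -> P s) -> P t) ->
  forall t, a <= t <= b -> P t.
Proof.
intros Pa Right Left.
set (E := fun x => a <= x <= b /\ forall s, a <= s <= x -> P s).
intros t0 Ht0.
assert (Ea : E a).
{ split; [lra|]. intros s Hs. now replace s with a by lra. }
destruct (completeness E) as [m [Hub Hlub]].
{ exists b. intros x [Hx _]. lra. }
{ now exists a. }
assert (Ham : a <= m) by now apply Hub.
assert (Hmb : m <= b) by (apply Hlub; intros x [Hx _]; lra).
assert (Below : forall s, a <= s < m -> P s).
{ intros s Hs. apply NNPP; intros N.
  assert (m <= s); [|lra].
  apply Hlub. intros x [Hx Px]. destruct (Rle_lt_dec x s) as [L|L]; [exact L|].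
  exfalso; apply N, Px; lra. }
assert (Pm : P m).
{ destruct (Rle_lt_or_eq_dec a m Ham) as [L|<-]; [|exact Pa].
  apply Left; [lra|exact Below]. }
assert (All : forall s, a <= s <= m -> P s).
{ intros s Hs. destruct (Rle_lt_or_eq_dec s m (proj2 Hs)) as [L|L].
  - apply Below; lra.
  - now subst s. }
destruct (Rle_lt_or_eq_dec m b Hmb) as [L|L]; [|apply All; lra].
destruct (Right m (conj Ham L) All) as [d [Hd Pd]].
assert (Q : E (Rmin b (m + d / 2))).
{ split.
  - split; [apply Rmin_glb; lra|apply Rmin_l].
  - intros s Hs. destruct (Rle_lt_dec s m) as [K|K]; [apply All; lra|].
    assert (K1 := Rmin_l b (m + d / 2)). assert (K2 := Rmin_r b (m + d / 2)).
    apply Pd; lra. }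
apply Hub in Q. exfalso. revert Q. apply Rlt_not_le, Rmin_glb_lt; lra.
Qed.

(** At the first time of contact the bound on the past would be improved to a
    strict one.  This does the work of Gronwall's inequality; since a bound is
    assumed on the whole past, terms with a memory are harmless. *)
Lemma barrier_principle (y m : R -> R) (T : R) :
  (forall t, continuous y t) -> (forall t, continuous m t) ->
  y 0 < m 0 ->
  (forall t, 0 < t <= T -> (forall s, 0 <= s <= t -> y s <= m s) -> y t < m t) ->
  forall t, 0 <= t <= T -> y t < m t.
Proof.
intros Cy Cm H0 Step.
assert (Near : forall t eps, 0 < eps -> exists d, 0 < d /\
  forall s, Rabs (s - t) < d -> Rabs ((m s - y s) - (m t - y t)) < eps).
{ intros t eps He.
  assert (C : continuous (fun s => minus (m s) (y s)) t).
  { exact (continuous_minus (V := R_NormedModule) m y t (Cm t) (Cy t)). }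
  exact (proj1 (continuous_iff (V := R_NormedModule) _ _) C eps He). }
apply (real_induction (fun t => y t < m t)).
- exact H0.
- intros t Ht P. destruct (Near t (m t - y t)) as [d [Hd N]].
  { assert (Pt : y t < m t) by (apply P; lra). lra. }
  exists d. split; [exact Hd|]. intros s Hs _.
  assert (Q : Rabs (s - t) < d) by (rewrite Rabs_pos_eq; lra).
  apply N in Q. apply Rabs_def2 in Q. lra.
- intros t Ht P. apply Step; [exact Ht|]. intros s Hs.
  destruct (Rle_lt_or_eq_dec s t (proj2 Hs)) as [L|L]; [left; apply P; lra|].
  subst s. destruct (Rle_lt_dec (y t) (m t)) as [K|K]; [exact K|].
  destruct (Near t (y t - m t)) as [d [Hd N]]; [lra|].
  set (s := Rmax 0 (t - d / 2)).
  assert (S1 : 0 <= s) by apply Rmax_l.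
  assert (S2 : t - d / 2 <= s) by apply Rmax_r.
  assert (S3 : s < t) by (apply Rmax_lub_lt; lra).
  assert (Q : Rabs (s - t) < d) by (rewrite Rabs_left1; lra).
  apply N in Q. apply Rabs_def2 in Q. specialize (P s (conj S1 S3)). lra.
Qed.

(** * Projection onto an interval *)

(** Composition with this projection extends a function on [[a, b]] by constants,
    and turns continuity on [[a, b]] into continuity on the line. *)
Definition clamp (a b x : R) : R := Rmax a (Rmin b x).

Lemma clamp_in a b x : a <= b -> a <= clamp a b x <= b.
Proof.
intros Hab. unfold clamp. split; [apply Rmax_l|].
apply Rmax_lub; [exact Hab|apply Rmin_l].
Qed.

Lemma clamp_id a b x : a <= x <= b -> clamp a b x = x.
Proof. intros Hx. unfold clamp. rewrite Rmin_right, Rmax_right; lra. Qed.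

Lemma clamp_lipschitz a b x y : Rabs (clamp a b x - clamp a b y) <= Rabs (x - y).
Proof.
unfold clamp, Rmax, Rmin.
repeat destruct (Rle_dec _ _); unfold Rabs; repeat destruct (Rcase_abs _); lra.
Qed.

Lemma continuous_clamp {V : NormedModule R_AbsRing} (D : R -> Prop) (a b : R) (f : R -> V) :
  a <= b -> (forall t, a <= t <= b -> D t) -> continuous_on D f ->
  forall t, continuous (fun x => f (clamp a b x)) t.
Proof.
intros Hab HD C t. apply continuous_iff. intros eps He.
assert (C' := proj1 (continuous_on_iff D f) C).
destruct (C' _ (HD _ (clamp_in a b t Hab)) eps He) as [d [Hd Hs]].
exists d. split; [exact Hd|]. intros s Bs. apply Hs.
- apply HD, clamp_in, Hab.
- eapply Rle_lt_trans; [apply clamp_lipschitz|exact Bs].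
Qed.

Lemma cont_bounded {V : NormedModule R_AbsRing} (f : R -> V) (T : R) :
  (forall t, continuous f t) ->
  exists B, 0 < B /\ forall t, 0 <= t <= T -> norm (f t) <= B.
Proof.
intros C. destruct (bounded_continuity f 0 T (fun x _ => C x)) as [B HB].
exists (Rmax 1 B). split; [eapply Rlt_le_trans; [apply Rlt_0_1|apply Rmax_l]|].
intros t Ht. left. eapply Rlt_le_trans; [now apply HB|apply Rmax_r].
Qed.

(** * Integrals *)

Lemma is_linear_zero {U V : NormedModule R_AbsRing} (l : U -> V) :
  is_linear l -> l zero = zero.
Proof.
intros L. assert (E := linear_scal l L (0 : R) zero).
transitivity (l (scal (0 : R) zero)); [f_equal; module_eq U|].
refine (eq_trans E _). module_eq V.
Qed.

Lemma is_linear_opp {U V : NormedModule R_AbsRing} (l : U -> V) (x : U) :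
  is_linear l -> l (opp x) = opp (l x).
Proof.
intros L. assert (E := linear_scal l L (-1 : R) x).
transitivity (l (scal (-1 : R) x)); [f_equal; module_eq U|].
refine (eq_trans E _). module_eq V.
Qed.

Lemma is_linear_minus {U V : NormedModule R_AbsRing} (l : U -> V) (x y : U) :
  is_linear l -> l (minus x y) = minus (l x) (l y).
Proof.
intros L. unfold minus. rewrite (linear_plus l L). f_equal. now apply is_linear_opp.
Qed.

Lemma is_linear_continuous {U V : NormedModule R_AbsRing} (l : U -> V) (x : U) :
  is_linear l -> filterlim l (locally x) (locally (l x)).
Proof.
intros L. destruct (linear_norm l L) as [M [HM B]].
apply (proj2 (filterlim_norm_iff (locally x) l (l x))). intros eps He.
assert (Id := proj1 (filterlim_norm_iff (locally x) (fun y => y) x)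
  (fun P H => H) (eps / M) (Rdiv_lt_0_compat _ _ He HM)).
apply (filter_imp (F := locally x)) with (2 := Id). intros y Hy.
rewrite <- is_linear_minus by exact L.
eapply Rle_lt_trans; [apply B|].
replace eps with (M * (eps / M)) by (field; lra). now apply Rmult_lt_compat_l.
Qed.

Lemma cont_linear {V W : NormedModule R_AbsRing} (l : V -> W) (f : R -> V) t :
  is_linear l -> continuous f t -> continuous (fun s => l (f s)) t.
Proof.
intros L C. apply (continuous_comp f l); [exact C|]. now apply is_linear_continuous.
Qed.

Lemma Riemann_sum_linear {U V : NormedModule R_AbsRing} (l : U -> V) (f : R -> U) ptd :
  is_linear l -> Riemann_sum (fun x => l (f x)) ptd = l (Riemann_sum f ptd).
Proof.
intros L. apply SF_cons_ind with (s := ptd).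
- intros x0. unfold Riemann_sum; simpl. symmetry; now apply is_linear_zero.
- intros h s IH. rewrite !Riemann_sum_cons, IH, (linear_plus l L). f_equal.
  symmetry; exact (linear_scal l L _ _).
Qed.

Lemma is_RInt_linear {U V : NormedModule R_AbsRing} (l : U -> V) (f : R -> U) a b (I : U) :
  is_linear l -> is_RInt f a b I -> is_RInt (fun x => l (f x)) a b (l I).
Proof.
intros L HI. unfold is_RInt in *.
apply filterlim_ext with
  (f := fun ptd => l (scal (sign (b - a)) (Riemann_sum f ptd))).
- intros ptd. rewrite (Riemann_sum_linear l f ptd L). exact (linear_scal l L _ _).
- eapply filterlim_comp; [exact HI|]. now apply is_linear_continuous.
Qed.

Section Integrals.
Context {V : NormedModule R_AbsRing}.

Lemma is_RInt_close (f g : R -> V) a b I J eps :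
  a <= b -> is_RInt f a b I -> is_RInt g a b J ->
  (forall x, a <= x <= b -> norm (minus (f x) (g x)) <= eps) ->
  norm (minus I J) <= (b - a) * eps.
Proof.
intros Hab HI HJ B.
apply (norm_RInt_le_const (fun x => minus (f x) (g x)) a b); auto.
exact (is_RInt_minus f g a b I J HI HJ).
Qed.

(** The existence of the integral is known from continuity; its value is found by
    approximating the integrand uniformly. *)
Lemma is_RInt_limit (f : R -> V) a b I C :
  a <= b -> ex_RInt f a b ->
  (forall eps, 0 < eps -> exists g J, is_RInt g a b J /\
     norm (minus J I) <= C * eps /\
     forall x, a <= x <= b -> norm (minus (f x) (g x)) <= eps) ->
  is_RInt f a b I.
Proof.
intros Hab [K HK] App.
replace I with K; [exact HK|].
apply (eq_of_small _ _ (b - a + C)). intros eps He.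
destruct (App eps He) as [g [J [HJ [B1 B2]]]].
assert (Q := is_RInt_close f g a b K J eps Hab HK HJ B2).
eapply Rle_trans; [apply (norm_minus_triangle J)|]. lra.
Qed.

Lemma is_RInt_ext_le (f g : R -> V) a b I :
  a <= b -> (forall x, a <= x <= b -> f x = g x) -> is_RInt f a b I -> is_RInt g a b I.
Proof.
intros Hab E. apply is_RInt_ext. rewrite Rmin_left, Rmax_right by lra.
intros x Hx; apply E; lra.
Qed.

Lemma is_RInt_eq (f : R -> V) a b I J : is_RInt f a b I -> is_RInt f a b J -> I = J.
Proof.
intros HI HJ. exact (filterlim_locally_unique (V := V) _ _ _ HI HJ).
Qed.

End Integrals.

Lemma ex_RInt_cont {V : CompleteNormedModule R_AbsRing} (f : R -> V) a b :
  (forall x, continuous f x) -> ex_RInt f a b.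
Proof. intros C. apply (ex_RInt_continuous (V := V)). auto. Qed.

Lemma RInt_cont {V : CompleteNormedModule R_AbsRing} (f : R -> V) a b :
  (forall x, continuous f x) -> is_RInt f a b (RInt f a b).
Proof. intros C. apply (RInt_correct (V := V)). now apply ex_RInt_cont. Qed.

Lemma is_derive_RInt_cont {V : CompleteNormedModule R_AbsRing} (f : R -> V) a t :
  (forall x, continuous f x) -> is_derive (RInt f a) t (f t).
Proof.
intros C. apply (is_derive_RInt f (RInt f a) a t); [|apply C].
apply filter_forall. intros x. now apply RInt_cont.
Qed.

(** * Right derivatives *)

(** A semigroup is directly differentiable from the right only. *)
Definition is_rderiv (f : R -> R) (t l : R) : Prop :=
  forall eps, 0 < eps -> exists d, 0 < d /\
  forall s, t < s < t + d -> Rabs (f s - f t - (s - t) * l) <= eps * (s - t).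

Lemma is_rderiv_of_derive (f : R -> R) t l : is_derive f t l -> is_rderiv f t l.
Proof.
intros [_ E] eps He.
destruct (E t (fun P H => H) (mkposreal eps He)) as [d Hd].
exists d. split; [apply cond_pos|]. intros s Hs.
assert (B : ball t d s).
{ change (Rabs (s - t) < d). rewrite Rabs_pos_eq; lra. }
specialize (Hd s B).
change (Rabs (f s - f t - (s - t) * l) <= eps * Rabs (s - t)) in Hd.
now rewrite (Rabs_pos_eq (s - t)) in Hd by lra.
Qed.

Lemma is_rderiv_minus (f g : R -> R) t l m :
  is_rderiv f t l -> is_rderiv g t m -> is_rderiv (fun x => f x - g x) t (l - m).
Proof.
intros Hf Hg eps He.
destruct (Hf (eps / 2)) as [d1 [Hd1 E1]]; [lra|].
destruct (Hg (eps / 2)) as [d2 [Hd2 E2]]; [lra|].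
exists (Rmin d1 d2). split; [now apply Rmin_glb_lt|]. intros s Hs.
assert (K1 := Rmin_l d1 d2). assert (K2 := Rmin_r d1 d2).
specialize (E1 s ltac:(lra)). specialize (E2 s ltac:(lra)).
replace (f s - g s - (f t - g t) - (s - t) * (l - m)) with
  ((f s - f t - (s - t) * l) + - (g s - g t - (s - t) * m)) by ring.
eapply Rle_trans; [apply Rabs_triang|]. rewrite Rabs_Ropp. lra.
Qed.

(** For each [eps], the increments stay below [eps] times the length of the
    interval: this extends to the right by the derivative, and to limits by
    continuity. *)
Lemma rderiv_zero_const (f : R -> R) a b :
  (forall t, continuous f t) -> (forall t, a <= t < b -> is_rderiv f t 0) ->
  a <= b -> f b = f a.
Proof.
intros C Dz Hab.
apply (eq_of_small (V := R_NormedModule) _ _ (b - a)). intros eps He.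
change (Rabs (f b - f a) <= (b - a) * eps).
assert (Q : forall t, a <= t <= b -> Rabs (f t - f a) <= eps * (t - a)).
{ apply real_induction.
  - rewrite !Rminus_diag, Rabs_R0. lra.
  - intros t Ht P. destruct (Dz t Ht eps He) as [d [Hd E]].
    exists d. split; [exact Hd|]. intros s Hs _. specialize (E s Hs).
    specialize (P t ltac:(lra)). rewrite Rmult_0_r, Rminus_0_r in E.
    replace (f s - f a) with ((f s - f t) + (f t - f a)) by ring.
    eapply Rle_trans; [apply Rabs_triang|]. lra.
  - intros t Ht P. apply Rnot_lt_le. intros N.
    set (gap := Rabs (f t - f a) - eps * (t - a)) in *.
    assert (Hg : 0 < gap) by (unfold gap; lra).
    destruct (proj1 (continuous_iff (V := R_NormedModule) f t) (C t) gap Hg)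
      as [d [Hd E]].
    set (s := Rmax a (t - d / 2)).
    assert (S1 : a <= s) by apply Rmax_l.
    assert (S2 : t - d / 2 <= s) by apply Rmax_r.
    assert (S3 : s < t) by (apply Rmax_lub_lt; lra).
    assert (Q : Rabs (s - t) < d) by (rewrite Rabs_left1; lra).
    specialize (E s Q). change (Rabs (f s - f t) < gap) in E.
    specialize (P s (conj S1 S3)).
    assert (T := Rabs_triang (f s - f a) (- (f s - f t))).
    rewrite Rabs_Ropp in T.
    replace (f s - f a + - (f s - f t)) with (f t - f a) in T by ring.
    assert (eps * (s - a) <= eps * (t - a)) by (apply Rmult_le_compat_l; lra).
    unfold gap in E. lra. }
specialize (Q b ltac:(lra)). lra.
Qed.

(** The difference of [f] and of the primitive of [df] has the right derivative
    zero. *)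
Lemma is_RInt_rderiv (f df : R -> R) a b :
  (forall t, continuous f t) -> (forall t, continuous df t) ->
  (forall t, a <= t < b -> is_rderiv f t (df t)) ->
  a <= b -> is_RInt df a b (f b - f a).
Proof.
intros Cf Cd Hd Hab.
assert (HG : forall t, is_derive (RInt df a) t (df t)).
{ intros t. exact (is_derive_RInt_cont (V := R_CompleteNormedModule) df a t Cd). }
assert (E : f b - RInt df a b = f a - RInt df a a).
{ apply (rderiv_zero_const (fun t => f t - RInt df a t)); [| |exact Hab].
  - intros t. apply (continuous_minus (V := R_NormedModule)); [apply Cf|].
    apply (ex_derive_continuous (K := R_AbsRing) (V := R_NormedModule)).
    now exists (df t).
  - intros t Ht. replace 0 with (df t - df t) by ring.
    apply is_rderiv_minus; [now apply Hd|]. now apply is_rderiv_of_derive. }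
rewrite (RInt_point (V := R_CompleteNormedModule)) in E.
replace (f b - f a) with (RInt df a b).
- exact (RInt_cont (V := R_CompleteNormedModule) df a b Cd).
- change (zero : R) with 0 in E. lra.
Qed.

Lemma is_RInt_exp (C l t : R) :
  l <> 0 -> is_RInt (fun s => C * exp (l * s)) 0 t (C / l * (exp (l * t) - 1)).
Proof.
intros Hl.
replace (C / l * (exp (l * t) - 1)) with
  (minus (C / l * exp (l * t)) (C / l * exp (l * 0))).
2:{ unfold minus, plus, opp; simpl. rewrite Rmult_0_r, exp_0. ring. }
apply (is_RInt_derive (V := R_CompleteNormedModule) (fun s => C / l * exp (l * s))).
- intros x _. auto_derive; [exact I|]. field; exact Hl.
- intros x _. apply (ex_derive_continuous (K := R_AbsRing) (V := R_NormedModule)).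
  auto_derive. exact I.
Qed.

(** * Exponential barriers *)

Lemma exp_sq a b t : (a * exp (b * t)) ^ 2 = a ^ 2 * exp (2 * b * t).
Proof.
replace (2 * b * t) with (b * t + b * t) by ring. rewrite exp_plus. ring.
Qed.

Lemma exp_ge_1 b t : 0 <= b -> 0 <= t -> 1 <= exp (b * t).
Proof.
intros Hb Ht. rewrite <- exp_0. 
assert (P : 0 <= b * t) by now apply Rmult_le_pos.
destruct P as [P|P]; [left; now apply exp_increasing|rewrite <- P; lra].
Qed.

Lemma exp_mono b s t : 0 <= b -> s <= t -> exp (b * s) <= exp (b * t).
Proof.
intros Hb Hst. assert (P : b * s <= b * t) by now apply Rmult_le_compat_l.
destruct P as [P|P]; [left; now apply exp_increasing|rewrite P; lra].
Qed.

Lemma continuous_Cexp a b t : continuous (fun s => a * exp (b * s)) t.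
Proof.
apply (ex_derive_continuous (V := R_NormedModule)). auto_derive. exact I.
Qed.

Lemma Rmax_0_lipschitz s t : Rabs (Rmax 0 s - Rmax 0 t) <= Rabs (s - t).
Proof.
unfold Rmax; repeat destruct (Rle_dec _ _); unfold Rabs; repeat destruct (Rcase_abs _); lra.
Qed.

(** The barrier for energy estimates: a power bounded by [c (K exp (b s))^2]
    contributes [c / (2 b) * K^2 (exp (2 b t) - 1)] to the energy, which is below
    the square of the barrier when [c <= 2 b] and [a < K^2]. *)
Lemma quadratic_barrier (y : R -> R) (T a c K b : R) :
  (forall t, continuous y t) -> (forall t, 0 <= t <= T -> 0 <= y t) ->
  0 < K -> 0 < b -> c <= 2 * b -> a < K ^ 2 -> y 0 < K ->
  (forall t, 0 < t <= T -> (forall s, 0 <= s <= t -> y s <= K * exp (b * s)) ->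
     exists f I, is_RInt f 0 t I /\ y t ^ 2 <= a + I /\
     forall s, 0 < s < t -> f s <= c * (K * exp (b * s)) ^ 2) ->
  forall t, 0 <= t <= T -> y t < K * exp (b * t).
Proof.
intros Cy Py PK Pb Hc Ha H0 Step.
apply (barrier_principle y (fun t => K * exp (b * t)) T Cy (continuous_Cexp K b)).
{ now rewrite Rmult_0_r, exp_0, Rmult_1_r. }
intros t Ht Past. destruct (Step t Ht Past) as [f [I [HI [Hy Hf]]]].
assert (Le := is_RInt_le _ _ 0 t _ _ ltac:(lra) HI (is_RInt_exp (c * K ^ 2) (2 * b) t ltac:(lra))).
assert (Hf' : forall s, 0 < s < t -> f s <= c * K ^ 2 * exp (2 * b * s)).
{ intros s Hs. rewrite Rmult_assoc, <- exp_sq. now apply Hf. }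
specialize (Le Hf').
assert (PE : 1 <= exp (2 * b * t)) by (apply exp_ge_1; lra).
assert (Q : c * K ^ 2 / (2 * b) * (exp (2 * b * t) - 1) <= K ^ 2 * (exp (2 * b * t) - 1)).
{ apply Rmult_le_compat_r; [lra|].
  apply (Rmult_le_reg_r (2 * b)); [lra|]. unfold Rdiv. rewrite Rmult_assoc, Rinv_l by lra.
  assert (P := pow2_ge_0 K). nra. }
apply Rsqr_incrst_0; [|apply Py; lra|apply Rmult_le_pos; [lra|left; apply exp_pos]].
rewrite !Rsqr_pow2, exp_sq. lra.
Qed.

(** With [P] instead of [p], no one-sided derivatives occur at the ends of the
    interval. *)
Lemma C1_extension (p q : R -> R) (T : R) :
  (forall t, continuous p t) -> (forall t, continuous q t) ->
  (forall t, 0 <= t < T -> is_rderiv p t (q t)) ->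
  exists P : R -> R, (forall t, is_derive P t (q t)) /\
  forall t, 0 <= t <= T -> P t = p t.
Proof.
intros Cp Cq D. exists (fun t => p 0 + RInt q 0 t). split.
- intros t. rewrite <- (Rplus_0_l (q t)).
  apply (is_derive_plus (V := R_NormedModule)).
  + apply (is_derive_const (K := R_AbsRing) (V := R_NormedModule)).
  + now apply (is_derive_RInt_cont (V := R_CompleteNormedModule)).
- intros t Ht.
  rewrite (is_RInt_unique (V := R_CompleteNormedModule) q 0 t (p t - p 0)); [ring|].
  apply is_RInt_rderiv; auto; [|lra]. intros s Hs; apply D; lra.
Qed.

(** * Spectral coefficients and projections *)

Lemma sum_n_m_additive {G G' : AbelianMonoid} (l : G -> G') (a : nat -> G) n m :
  l zero = zero -> (forall x y, l (plus x y) = plus (l x) (l y)) ->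
  l (sum_n_m a n m) = sum_n_m (fun i => l (a i)) n m.
Proof.
intros L0 L. induction m as [|m IH].
- destruct n as [|n]; [now rewrite !sum_n_n|].
  rewrite !sum_n_m_zero by lia. exact L0.
- destruct (Nat.le_gt_cases n (S m)) as [K|K].
  + rewrite !sum_n_Sm by exact K. now rewrite L, IH.
  + rewrite !sum_n_m_zero by lia. exact L0.
Qed.

Lemma sum_n_additive {G G' : AbelianMonoid} (l : G -> G') (a : nat -> G) n :
  l zero = zero -> (forall x y, l (plus x y) = plus (l x) (l y)) ->
  l (sum_n a n) = sum_n (fun i => l (a i)) n.
Proof. apply sum_n_m_additive. Qed.

(** Sums in the additive group of the reals are sums in [R] by conversion. *)
Ltac as_R := lazymatch goal with |- ?a = ?b => change (@eq R a b) end.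

Lemma sum_n_m_Rmult (c : R) (a : nat -> R) n m :
  c * sum_n_m a n m = sum_n_m (fun i => c * a i) n m.
Proof.
apply (sum_n_m_additive (Rmult c)).
- apply Rmult_0_r.
- intros x y. apply Rmult_plus_distr_l.
Qed.

Lemma sum_n_delta (a : nat -> R) i n :
  sum_n (fun j => a j * (if Nat.eqb j i then 1 else 0)) n
  = if Nat.leb i n then a i else 0.
Proof.
induction n as [|n IH].
- rewrite sum_O. destruct (Nat.eqb_spec 0 i) as [<-|N]; simpl; [as_R; ring|].
  destruct (Nat.leb_spec i 0); [lia|as_R; ring].
- rewrite sum_Sn, IH. change plus with Rplus.
  destruct (Nat.leb_spec i n), (Nat.leb_spec i (S n)), (Nat.eqb_spec (S n) i);
    try lia; subst; as_R; ring.
Qed.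

Section Hilbert_space.
Context {H : Hilbert}.
Implicit Types x y z : H.

Lemma inner_scal_r (a : R) x y : inner x (scal a y) = a * inner x y.
Proof. rewrite inner_sym, inner_scal_l, (inner_sym H y). reflexivity. Qed.

Lemma inner_opp_l x y : inner (opp x) y = - inner x y.
Proof.
replace (opp x) with (scal (-1 : R) x) by module_eq H.
rewrite inner_scal_l. ring.
Qed.

Lemma inner_minus_l x y z : inner (minus x y) z = inner x z - inner y z.
Proof. unfold minus. rewrite inner_plus_l, inner_opp_l. ring. Qed.

Lemma inner_minus_r x y z : inner x (minus y z) = inner x y - inner x z.
Proof.
rewrite inner_sym, inner_minus_l, (inner_sym H y), (inner_sym H z). reflexivity.
Qed.

Lemma norm_sq x : norm x ^ 2 = inner x x.
Proof. rewrite norm_inner. apply pow2_sqrt, inner_ge_0. Qed.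

Lemma cauchy_schwarz x y : Rabs (inner x y) <= norm x * norm y.
Proof.
assert (Px := norm_ge_0 x). assert (Py := norm_ge_0 y).
destruct (Req_dec (norm y) 0) as [Zy|Ny].
- assert (E : y = zero) by exact (norm_eq_zero y Zy).
  rewrite E, inner_sym, inner_zero_l, Rabs_R0.
  apply Rmult_le_pos; [exact Px|]. apply norm_ge_0.
- set (c := inner x y / norm y ^ 2).
  assert (Hp := inner_ge_0 H (minus x (scal c y))).
  rewrite inner_minus_l, !inner_minus_r, !inner_scal_l, !inner_scal_r in Hp.
  rewrite (inner_sym H y x), <- !norm_sq in Hp.
  assert (Q : inner x y ^ 2 <= (norm x * norm y) ^ 2).
  { apply Rmult_le_reg_l with (/ norm y ^ 2).
    { apply Rinv_0_lt_compat. apply pow_lt. lra. }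
    unfold c in Hp. 
    replace (/ norm y ^ 2 * (norm x * norm y) ^ 2) with (norm x ^ 2) by (field; lra).
    replace (/ norm y ^ 2 * inner x y ^ 2) with
      (norm x ^ 2 - (norm x ^ 2 - inner x y / norm y ^ 2 * inner x y
        - (inner x y / norm y ^ 2 * inner x y
           - inner x y / norm y ^ 2 * (inner x y / norm y ^ 2 * norm y ^ 2))))
      by (field; lra).
    lra. }
  apply Rsqr_le_abs_0 in Q || rewrite <- !Rsqr_pow2 in Q.
  apply Rsqr_le_abs_0 in Q. rewrite (Rabs_pos_eq (norm x * norm y)) in Q; [exact Q|].
  now apply Rmult_le_pos.
Qed.

Lemma is_linear_inner y : is_linear (fun x : H => (inner x y : R_NormedModule)).
Proof.
apply Build_is_linear.
- intros x z. exact (inner_plus_l H x z y).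
- intros c x. exact (inner_scal_l H c x y).
- exists (norm y + 1). assert (Py := norm_ge_0 y). split; [lra|]. intros x.
  change (Rabs (inner x y) <= (norm y + 1) * norm x).
  assert (Px := norm_ge_0 x). assert (C := cauchy_schwarz x y). lra.
Qed.

Lemma cont_inner (f1 f2 : R -> H) t :
  continuous f1 t -> continuous f2 t -> continuous (fun s => inner (f1 s) (f2 s)) t.
Proof.
intros C1 C2.
(* polarization *)
assert (Sq : forall f : R -> H, continuous f t -> continuous (fun s => norm (f s) * norm (f s)) t).
{ intros f Cf.
  assert (C : continuous (fun s => norm (f s)) t)
    by (apply (continuous_comp f (fun x : H => norm x)); [exact Cf|apply (filterlim_norm (V := H))]).
  exact (continuous_mult (K := R_AbsRing) _ _ t C C). }
apply (continuous_ext (fun s => / 4 * (norm (plus (f1 s) (f2 s)) * norm (plus (f1 s) (f2 s))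
  - norm (minus (f1 s) (f2 s)) * norm (minus (f1 s) (f2 s))))).
{ intros s. assert (E : forall x : H, norm x * norm x = inner x x)
    by (intros x; rewrite <- norm_sq; ring).
  one_path. rewrite !E, inner_plus_l, inner_minus_l, !(inner_sym H _ (plus _ _)),
    !(inner_sym H _ (minus _ _)), !inner_plus_l, !inner_minus_l, (inner_sym H (f2 s) (f1 s)).
  as_R. field. }
apply (continuous_scal_r (V := R_NormedModule) (/ 4)).
apply (continuous_minus (V := R_NormedModule)); apply Sq.
- now apply (continuous_plus (V := H)).
- now apply (continuous_minus (V := H)).
Qed.

End Hilbert_space.

Section Spectral.
Context {H : Hilbert} (A : DiscreteOperator H).

Definition coef (i : nat) (x : H) : R := inner x (eigvec A i).

Definition proj (n : nat) (x : H) : H :=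
  sum_n (fun i => scal (coef i x) (eigvec A i)) n.

Lemma coef_le i x : Rabs (coef i x) <= norm x.
Proof. apply inner_eigvec_le. Qed.

Lemma coef_scal i (a : R) x : coef i (scal a x) = a * coef i x.
Proof. apply inner_scal_l. Qed.

Lemma coef_minus i x y : coef i (minus x y) = coef i x - coef i y.
Proof. apply inner_minus_l. Qed.

Lemma coef_eigvec i j : coef i (eigvec A j) = if Nat.eqb j i then 1 else 0.
Proof. apply eigvec_orthonormal. Qed.

Lemma inner_sum_n_m_l (a : nat -> H) n m y :
  inner (sum_n_m a n m) y = sum_n_m (fun i => inner (a i) y) n m.
Proof.
apply (sum_n_m_additive (fun x : H => inner x y)).
- exact (inner_zero_l y).
- intros; apply inner_plus_l.
Qed.

Lemma inner_proj n x y : inner (proj n x) y = sum_n (fun i => coef i x * coef i y) n.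
Proof.
unfold proj, sum_n. rewrite inner_sum_n_m_l. apply sum_n_m_ext. intros i.
rewrite inner_scal_l. unfold coef. now rewrite (inner_sym H y).
Qed.

Lemma coef_proj i n x : coef i (proj n x) = if Nat.leb i n then coef i x else 0.
Proof.
unfold coef at 1. rewrite inner_proj.
rewrite <- (sum_n_delta (fun j => coef j x)). apply sum_n_ext. intros j.
now rewrite coef_eigvec, Nat.eqb_sym.
Qed.

Lemma norm_proj_sq n x : norm (proj n x) ^ 2 = sum_n (fun i => coef i x ^ 2) n.
Proof.
rewrite norm_sq, inner_proj. apply sum_n_ext_loc. intros i Hi.
rewrite coef_proj. destruct (Nat.leb_spec i n); [as_R; ring|lia].
Qed.

Lemma norm_proj_inner n x : norm (proj n x) ^ 2 = inner x (proj n x).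
Proof.
rewrite norm_proj_sq, inner_sym, inner_proj. apply sum_n_ext. intros; as_R; ring.
Qed.

Lemma norm_proj_le n x : norm (proj n x) <= norm x.
Proof.
assert (P := norm_ge_0 (proj n x)). assert (Px := norm_ge_0 x).
destruct (Rle_lt_dec (norm (proj n x)) 0) as [L|L]; [lra|].
assert (C := cauchy_schwarz x (proj n x)). rewrite <- norm_proj_inner in C.
rewrite Rabs_pos_eq in C by apply pow2_ge_0.
apply Rmult_le_reg_r with (1 := L). simpl in C. lra.
Qed.

Lemma proj_minus n x y : proj n (minus x y) = minus (proj n x) (proj n y).
Proof.
unfold proj. induction n as [|n IH].
- rewrite !sum_O, coef_minus. module_eq H.
- rewrite !sum_Sn, IH, coef_minus. module_eq H.
Qed.

Lemma proj_lim x eps : 0 < eps ->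
  exists N, forall n, (N <= n)%nat -> norm (minus (proj n x) x) < eps.
Proof.
intros He.
exact (proj1 (filterlim_norm_iff (V := H) eventually (fun n => proj n x) x)
  (eigvec_basis A x) eps He).
Qed.

Lemma norm_le_of_proj x C : (forall n, norm (proj n x) <= C) -> norm x <= C.
Proof.
intros B. apply le_epsilon. intros eps He.
destruct (proj_lim x eps He) as [N HN]. specialize (HN N (Nat.le_refl N)).
rewrite (norm_minus_sym (V := H)) in HN. assert (T := norm_plus_minus x (proj N x)).
specialize (B N). one_path. lra.
Qed.

Lemma coef_inj x y : (forall i, coef i x = coef i y) -> x = y.
Proof.
intros E. apply (eq_of_small _ _ 1). intros eps He.
rewrite Rmult_1_l. apply norm_le_of_proj. intros n.
assert (Z : proj n (minus x y) = zero).
{ unfold proj. induction n as [|n IH].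
  - rewrite sum_O, coef_minus, E. module_eq H.
  - rewrite sum_Sn, IH, coef_minus, E. module_eq H. }
one_path. rewrite Z. apply Rle_trans with 0; [right; exact (norm_zero (V := H))|lra].
Qed.

(** The projections are nonexpansive, so that their convergence at [f t] settles it
    near [t]; the interval is compact. *)
Lemma proj_lim_unif (f : R -> H) (T eps : R) :
  (forall t, continuous f t) -> 0 < eps -> 0 <= T ->
  exists N, forall n, (N <= n)%nat -> forall t, 0 <= t <= T ->
  norm (minus (proj n (f t)) (f t)) <= eps.
Proof.
intros C He HT.
assert (Loc : forall t, exists d N, 0 < d /\ forall n, (N <= n)%nat ->
  forall s, Rabs (s - t) < d -> norm (minus (proj n (f s)) (f s)) <= eps).
{ intros t.
  destruct (proj1 (continuous_iff f t) (C t) (eps / 3)) as [d [Hd B]]; [lra|].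
  destruct (proj_lim (f t) (eps / 3)) as [N HN]; [lra|].
  exists d, N. split; [exact Hd|]. intros n Hn s Hs.
  specialize (B s Hs). specialize (HN n Hn).
  assert (Z : minus (proj n (f s)) (f s) =
    plus (proj n (minus (f s) (f t)))
       (minus (minus (proj n (f t)) (f t)) (minus (f s) (f t))))
    by (rewrite proj_minus; module_eq H).
  rewrite Z.
  eapply Rle_trans; [apply (norm_triangle (V := H))|].
  assert (B1 := norm_proj_le n (minus (f s) (f t))).
  assert (B2 := norm_minus_le (minus (proj n (f t)) (f t)) (minus (f s) (f t))).
  one_path. lra. }
apply (real_induction (fun t => exists N, forall n, (N <= n)%nat ->
  forall s, 0 <= s <= t -> norm (minus (proj n (f s)) (f s)) <= eps) 0 T).
- destruct (Loc 0) as [d [N [Hd B]]]. exists N. intros n Hn s Hs.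
  apply B; [exact Hn|]. replace (s - 0) with 0 by lra. now rewrite Rabs_R0.
- intros t Ht P. destruct (P t) as [N1 HN1]; [lra|].
  destruct (Loc t) as [d [N2 [Hd B]]]. exists d. split; [exact Hd|].
  intros s Hs _. exists (Nat.max N1 N2). intros n Hn r Hr.
  destruct (Rle_lt_dec r t) as [L|L]; [apply HN1; [lia|lra]|].
  apply B; [lia|]. rewrite Rabs_pos_eq; lra.
- intros t Ht P. destruct (Loc t) as [d [N2 [Hd B]]].
  set (s := Rmax 0 (t - d / 2)).
  assert (S1 : 0 <= s) by apply Rmax_l.
  assert (S2 : t - d / 2 <= s) by apply Rmax_r.
  assert (S3 : s < t) by (apply Rmax_lub_lt; lra).
  destruct (P s (conj S1 S3)) as [N1 HN1].
  exists (Nat.max N1 N2). intros n Hn r Hr.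
  destruct (Rle_lt_dec r s) as [L|L]; [apply HN1; [lia|lra]|].
  apply B; [lia|]. apply Rabs_def1; lra.
- lra.
Qed.

(** * The space [D(A^{1/2})] *)

Definition sqrt_eigval (i : nat) : R := Rpower (eigval A i) (/ 2).

Lemma eigval_gt_0 i : 0 < eigval A i.
Proof.
induction i as [|i IH]; [apply eigval_pos|].
eapply Rlt_le_trans; [exact IH|apply eigval_incr].
Qed.

Lemma sqrt_eigval_gt_0 i : 0 < sqrt_eigval i.
Proof. apply exp_pos. Qed.

Lemma sqrt_eigval_sq i : sqrt_eigval i * sqrt_eigval i = eigval A i.
Proof.
unfold sqrt_eigval. rewrite <- Rpower_plus.
replace (/ 2 + / 2) with 1 by lra. apply Rpower_1, eigval_gt_0.
Qed.

Lemma sqrt_eigval_ge i : sqrt_eigval 0 <= sqrt_eigval i.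
Proof.
induction i as [|i IH]; [apply Rle_refl|].
eapply Rle_trans; [exact IH|]. unfold sqrt_eigval.
apply Rle_Rpower_l; [lra|]. split; [apply eigval_gt_0|apply eigval_incr].
Qed.

(** The isometry [A^{1/2}] from [D(A^{1/2})] onto [H]. *)
Definition root (u : Dhalf A) : H := pow_fun A (/ 2) (emb u).

Lemma norm_root u : norm (root u) = norm u.
Proof. reflexivity. Qed.

Lemma coef_root i u : coef i (root u) = sqrt_eigval i * coef i (emb u).
Proof.
assert (Hs := pow_fun_correct A (/ 2) (emb u) (pow_dom_emb A (/ 2) u)).
apply (eq_of_small (V := R_NormedModule) _ _ 1). intros eps He.
destruct (proj1 (filterlim_norm_iff (V := H) eventually _ _) Hs eps He) as [N HN].
specialize (HN (Nat.max N i) (Nat.le_max_l _ _)).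
unfold sqrt_eigval, coef at 2.
rewrite <- (inner_sum_n A (/ 2) (emb u) i (Nat.max N i)) by lia.
fold (coef i (sum_n (pow_term A (/ 2) (emb u)) (Nat.max N i))).
change (Rabs (coef i (root u) - coef i (sum_n (pow_term A (/ 2) (emb u)) (Nat.max N i)))
  <= 1 * eps).
rewrite <- coef_minus. eapply Rle_trans; [apply coef_le|].
rewrite (norm_minus_sym (V := H)), Rmult_1_l. left; exact HN.
Qed.

Lemma is_linear_root : is_linear (U := Dhalf A) (V := H) root.
Proof.
apply Build_is_linear.
- exact (pow_fun_plus A (/ 2)).
- exact (pow_fun_scal A (/ 2)).
- exists 1. split; [lra|]. intros u. rewrite Rmult_1_l. apply Rle_refl.
Qed.

Lemma root_minus (u v : Dhalf A) : root (minus u v) = minus (root u) (root v).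
Proof. apply (is_linear_minus root u v is_linear_root). Qed.

(** The factors [sqrt_eigval i] are bounded below by the first one. *)
Lemma emb_norm_le (u : Dhalf A) : norm (emb u) <= / sqrt_eigval 0 * norm u.
Proof.
assert (P0 := sqrt_eigval_gt_0 0). assert (Pu := norm_ge_0 u).
assert (Pi0 : 0 < / sqrt_eigval 0) by now apply Rinv_0_lt_compat.
apply norm_le_of_proj. intros n.
apply Rmult_le_reg_l with (1 := P0).
rewrite <- Rmult_assoc, Rinv_r, Rmult_1_l by lra.
apply Rle_trans with (norm (proj n (root u))); [|apply norm_proj_le].
apply Rsqr_incr_0_var; [|apply (norm_ge_0 (V := H))].
rewrite Rsqr_mult, !Rsqr_pow2, !norm_proj_sq.
unfold sum_n. rewrite sum_n_m_Rmult. apply sum_n_m_le. intros i.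
rewrite coef_root, Rpow_mult_distr. apply Rmult_le_compat_r; [apply pow2_ge_0|].
apply pow_incr. split; [lra|apply sqrt_eigval_ge].
Qed.

Lemma is_linear_emb : is_linear (U := Dhalf A) (V := H) emb.
Proof.
apply Build_is_linear; [reflexivity|reflexivity|].
exists (/ sqrt_eigval 0). split; [|exact emb_norm_le].
apply Rinv_0_lt_compat, sqrt_eigval_gt_0.
Qed.

Lemma emb_minus (u v : Dhalf A) : emb (minus u v) = minus (emb u) (emb v).
Proof. reflexivity. Qed.

Lemma norm_sq_eigvec_sum (a : nat -> R) n m :
  norm (sum_n_m (fun i => scal (a i) (eigvec A i)) n m) ^ 2
  = sum_n_m (fun i => a i ^ 2) n m.
Proof.
rewrite norm_sq.
assert (E : forall m y, inner (sum_n_m (fun i => scal (a i) (eigvec A i)) n m) y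
  = sum_n_m (fun i => a i * coef i y) n m).
{ intros m' y. rewrite inner_sum_n_m_l. apply sum_n_m_ext. intros i.
  rewrite inner_scal_l. unfold coef. now rewrite (inner_sym H y). }
rewrite E. apply sum_n_m_ext_loc. intros i Hi. unfold coef. rewrite E.
induction m as [|m IH].
- assert (n = 0%nat) by lia. assert (i = 0%nat) by lia. subst.
  rewrite sum_n_n, coef_eigvec. simpl. as_R. ring.
- assert (Z : forall j, (j <= m)%nat -> (n <= j)%nat -> coef j (eigvec A (S m)) = 0).
  { intros j Hj _. rewrite coef_eigvec. destruct (Nat.eqb_spec (S m) j); [lia|reflexivity]. }
  rewrite sum_n_Sm by lia. change plus with Rplus.
  destruct (Nat.eq_dec i (S m)) as [->|Ni].
  + rewrite (sum_n_m_ext_loc _ (fun _ => zero)).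
    * rewrite sum_n_m_const_zero, coef_eigvec, Nat.eqb_refl.
      change (zero : R) with 0. as_R. ring.
    * intros j Hj. rewrite Z by lia. change (zero : R) with 0. as_R. ring.
  + rewrite coef_eigvec. destruct (Nat.eqb_spec i (S m)); [lia|].
    rewrite Rmult_plus_distr_l, IH by lia. as_R. ring.
Qed.

(** The coefficients of the preimage are those of [y] divided by [sqrt_eigval i].
    These divisors are bounded below, so that the new series is Cauchy when that
    of [y] is. *)
Lemma root_surj (y : H) : exists u : Dhalf A, root u = y.
Proof.
set (a := fun i => coef i y / sqrt_eigval i).
assert (P0 := sqrt_eigval_gt_0 0).
assert (X : ex_series (fun i => scal (a i) (eigvec A i))).
{ apply (ex_series_Cauchy (V := H)). intros eps.
  assert (He : 0 < sqrt_eigval 0 * eps) by (apply Rmult_lt_0_compat; [lra|apply cond_pos]).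
  destruct (Cauchy_ex_series (V := H) _ (ex_intro _ y (eigvec_basis A y))
    (mkposreal _ He)) as [N HN].
  exists N. intros n m Hn Hm. specialize (HN n m Hn Hm). simpl in HN.
  apply Rmult_lt_reg_l with (1 := P0).
  eapply Rle_lt_trans; [|exact HN].
  apply Rsqr_incr_0_var; [|apply (norm_ge_0 (V := H))].
  rewrite Rsqr_mult, !Rsqr_pow2.
  rewrite (norm_sq_eigvec_sum a), (norm_sq_eigvec_sum (fun i => inner y (eigvec A i))).
  rewrite sum_n_m_Rmult. apply sum_n_m_le. intros i.
  change (sqrt_eigval 0 ^ 2 * a i ^ 2 <= coef i y ^ 2).
  replace (coef i y) with (sqrt_eigval i * a i)
    by (unfold a; field; apply Rgt_not_eq, sqrt_eigval_gt_0).
  rewrite Rpow_mult_distr. apply Rmult_le_compat_r; [apply pow2_ge_0|].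
  apply pow_incr. split; [lra|apply sqrt_eigval_ge]. }
destruct X as [x Hx].
assert (Cx : forall i, coef i x = a i).
{ intros i. apply (eq_of_small (V := R_NormedModule) _ _ 1). intros eps He.
  destruct (proj1 (filterlim_norm_iff (V := H) eventually _ _) Hx eps He) as [N HN].
  specialize (HN (Nat.max N i) (Nat.le_max_l _ _)).
  assert (E : coef i (sum_n (fun i => scal (a i) (eigvec A i)) (Nat.max N i)) = a i).
  { unfold coef, sum_n. rewrite inner_sum_n_m_l.
    rewrite (sum_n_m_ext _ (fun j => a j * (if Nat.eqb j i then 1 else 0))).
    - fold (sum_n (fun j => a j * (if Nat.eqb j i then 1 else 0)) (Nat.max N i)).
      rewrite sum_n_delta. destruct (Nat.leb_spec i (Nat.max N i)); [reflexivity|lia].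
    - intros j. now rewrite inner_scal_l, eigvec_orthonormal. }
  change (Rabs (coef i x - a i) <= 1 * eps). rewrite <- E, <- coef_minus.
  eapply Rle_trans; [apply coef_le|]. rewrite (norm_minus_sym (V := H)), Rmult_1_l. left; exact HN. }
assert (S : is_series (pow_term A (/ 2) x) y).
{ apply (is_series_ext (fun i => scal (coef i y) (eigvec A i))); [|apply eigvec_basis].
  intros i. unfold pow_term. f_equal.
  fold (coef i x) (sqrt_eigval i). rewrite Cx. unfold a. field.
  apply Rgt_not_eq, sqrt_eigval_gt_0. }
exists (exist _ x (ex_intro _ y S)).
exact (pow_fun_unique A (/ 2) x y S).
Qed.

Definition unroot (y : H) : Dhalf A :=
  proj1_sig (constructive_indefinite_description _ (root_surj y)).

Lemma root_unroot y : root (unroot y) = y.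
Proof. exact (proj2_sig (constructive_indefinite_description _ (root_surj y))). Qed.

Lemma coef_emb_unroot i y : coef i (emb (unroot y)) = coef i y / sqrt_eigval i.
Proof.
assert (P := sqrt_eigval_gt_0 i).
apply Rmult_eq_reg_l with (sqrt_eigval i); [|lra].
rewrite <- coef_root, root_unroot. field. lra.
Qed.

(** [root] multiplies the [i]-th coefficient by [sqrt_eigval i], so that this is
    the [i]-th eigenvector as an element of [D(A^{1/2})]. *)
Definition eigvec_half (i : nat) : Dhalf A := unroot (scal (sqrt_eigval i) (eigvec A i)).

Lemma emb_eigvec_half i : emb (eigvec_half i) = eigvec A i.
Proof.
apply coef_inj. intros j. unfold eigvec_half.
rewrite coef_emb_unroot, coef_scal, coef_eigvec. assert (P := sqrt_eigval_gt_0 j).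
destruct (Nat.eqb_spec i j) as [->|N]; field; lra.
Qed.

Definition proj_half (n : nat) (x : H) : Dhalf A :=
  sum_n (fun i => scal (coef i x) (eigvec_half i)) n.

Lemma emb_proj_half n x : emb (proj_half n x) = proj n x.
Proof.
unfold proj_half.
rewrite (sum_n_additive (G := Dhalf A) (G' := H) emb) by reflexivity.
apply sum_n_ext. intros i. rewrite <- emb_eigvec_half. reflexivity.
Qed.

Lemma root_proj_half n u : root (proj_half n (emb u)) = proj n (root u).
Proof.
apply coef_inj. intros i. rewrite coef_root, emb_proj_half, !coef_proj, coef_root.
destruct (Nat.leb i n); ring.
Qed.

End Spectral.

(** * Completeness and uniform boundedness *)

Lemma seq_lim {V : CompleteNormedModule R_AbsRing} (x : nat -> V) (r : nat -> R) :
  (forall n m, (n <= m)%nat -> norm (minus (x m) (x n)) <= r n) ->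
  (forall eps, 0 < eps -> exists n, r n < eps) ->
  exists l, forall n, norm (minus l (x n)) <= r n.
Proof.
intros B Z.
assert (E : exists l : V, filterlim x eventually (locally l)).
{ apply (filterlim_locally_cauchy (U := V)). intros [eps He].
  destruct (Z (eps / 2)) as [n Hn]; [lra|].
  exists (fun m => (n <= m)%nat). split; [now exists n|].
  intros p q Hp Hq. apply (norm_compat1 (V := V)). simpl.
  assert (T := norm_minus_triangle (V := V) (x n) (x q) (x p)).
  assert (B1 := B n q Hq). assert (B2 := B n p Hp).
  rewrite (norm_minus_sym (V := V)) in B2. one_path. lra. }
destruct E as [l Hl]. exists l. intros n. apply le_epsilon. intros eps He.
destruct (proj1 (filterlim_norm_iff (V := V) eventually x l) Hl eps He) as [N HN].
specialize (HN (Nat.max N n) (Nat.le_max_l _ _)).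
rewrite (norm_minus_sym (V := V)) in HN.
assert (T := norm_minus_triangle (V := V) (x (Nat.max N n)) l (x n)).
specialize (B n (Nat.max N n) (Nat.le_max_r _ _)). one_path. lra.
Qed.

(** If the norms of the operators are unbounded, then in each ball there is a
    smaller one on which some operator of the family exceeds a given number.  At
    the common point of a nested sequence of such balls the family is unbounded. *)
Lemma uniform_boundedness {V : CompleteNormedModule R_AbsRing} {W : NormedModule R_AbsRing}
  (T : nat -> V -> W) :
  (forall n, is_linear (T n)) ->
  (forall x, exists M, forall n, norm (T n x) <= M) ->
  exists C, forall n x, norm (T n x) <= C * norm x.
Proof.
intros L Bd. apply NNPP; intros N.
assert (Step : forall (j : nat) (b : V * R), 0 < snd b ->
  exists c : V * R, 0 < snd c <= snd b / 2 /\
    norm (minus (fst c) (fst b)) <= snd b / 2 /\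
    exists n, forall y, norm (minus y (fst c)) <= snd c -> INR j <= norm (T n y)).
{ intros j [x0 r] Hr; simpl in Hr |- *.
  assert (Pj := pos_INR j).
  (* a bound by [K] at the center leaves a bound by [j] on a small ball *)
  set (K := INR j + 1).
  destruct (not_all_ex_not _ _ (fun h => N (ex_intro _ (2 * K / r) h))) as [n Hn].
  apply not_all_ex_not in Hn. destruct Hn as [xi Hxi].
  apply Rnot_le_lt in Hxi.
  assert (Pxi : 0 < norm xi).
  { destruct (norm_ge_0 xi) as [P|P]; [exact P|]. exfalso.
    rewrite (norm_eq_zero xi (eq_sym P)) in Hxi.
    rewrite (is_linear_zero (T n) (L n)) in Hxi.
    rewrite (norm_zero (V := W)) in Hxi.
    assert (Q := norm_zero (V := V)). one_path. rewrite Q in Hxi. lra. }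
  set (c := r / 2 / norm xi).
  assert (Pc : 0 < c) by (unfold c; apply Rdiv_lt_0_compat; lra).
  set (z := scal c xi).
  assert (Nz : norm z = r / 2).
  { unfold z. rewrite (norm_scal_R (V := V)), Rabs_pos_eq by lra. unfold c. field. lra. }
  assert (Tz : K < norm (T n z)).
  { unfold z. assert (E : T n (scal c xi) = scal c (T n xi)) by exact (linear_scal (T n) (L n) c xi).
    rewrite E, norm_scal_R, Rabs_pos_eq by lra.
    apply Rmult_lt_compat_l with (1 := Pc) in Hxi.
    replace (c * (2 * K / r * norm xi)) with K in Hxi by (unfold c; field; lra).
    exact Hxi. }
  destruct (linear_norm (T n) (L n)) as [M [PM BM]].
  assert (Pick : exists x1, norm (minus x1 x0) <= r / 2 /\ K <= norm (T n x1)).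
  { (* the images of [x0 + z] and [x0 - z] differ by twice that of [z] *)
    destruct (Rle_lt_dec K (norm (T n (plus x0 z)))) as [L1|L1].
    - exists (plus x0 z). split; [|exact L1]. right. rewrite <- Nz. f_equal. module_eq V.
    - exists (minus x0 z). split.
      + right. rewrite <- Nz, <- (norm_opp (V := V) z). f_equal. module_eq V.
      + assert (E : scal (2 : R) (T n z) = minus (T n (plus x0 z)) (T n (minus x0 z))).
        { assert (E3 : T n (minus x0 z) = minus (T n x0) (T n z))
            by exact (is_linear_minus (T n) x0 z (L n)).
          rewrite E3.
          assert (E2 : T n (plus x0 z) = plus (T n x0) (T n z)) by exact (linear_plus (T n) (L n) x0 z).
          rewrite E2. module_eq W. }
        assert (Q := norm_minus_le (T n (plus x0 z)) (T n (minus x0 z))).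
        rewrite <- E, norm_scal_R, Rabs_pos_eq in Q by lra. lra. }
  destruct Pick as [x1 [B1 B2]].
  exists (x1, Rmin (r / 2) (/ M)). simpl.
  assert (PM' : 0 < / M) by now apply Rinv_0_lt_compat.
  split; [split; [apply Rmin_glb_lt; lra|apply Rmin_l]|].
  split; [exact B1|]. exists n. intros y Hy.
  assert (Hy' : norm (minus y x1) <= / M) by (eapply Rle_trans; [exact Hy|apply Rmin_r]).
  assert (Q := norm_plus_minus (T n x1) (T n y)).
  rewrite norm_minus_sym, <- (is_linear_minus (T n) y x1 (L n)) in Q.
  assert (BQ : norm (T n (minus y x1)) <= 1).
  { eapply Rle_trans; [apply BM|]. replace 1 with (M * / M) by (field; lra).
    apply Rmult_le_compat_l; [lra|exact Hy']. }
  one_path. unfold K in B2. lra. }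
set (next := fun (j : nat) (b : {b : V * R | 0 < snd b}) =>
  let c := constructive_indefinite_description _ (Step j (proj1_sig b) (proj2_sig b)) in
  exist (fun b : V * R => 0 < snd b) (proj1_sig c) (proj1 (proj1 (proj2_sig c)))).
set (b0 := exist (fun b : V * R => 0 < snd b) (zero, 1) Rlt_0_1).
set (b := nat_rect (fun _ => {b : V * R | 0 < snd b}) b0 next).
set (x := fun j => fst (proj1_sig (b j))). set (r := fun j => snd (proj1_sig (b j))).
assert (Spec : forall j, 0 < r (S j) <= r j / 2 /\
    norm (minus (x (S j)) (x j)) <= r j / 2 /\
    exists n, forall y, norm (minus y (x (S j))) <= r (S j) -> INR j <= norm (T n y)).
{ intros j.
  exact (proj2_sig (constructive_indefinite_description _
    (Step j (proj1_sig (b j)) (proj2_sig (b j))))). }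
assert (Nest : forall n m, (n <= m)%nat -> norm (minus (x m) (x n)) <= r n - r m).
{ intros n m Hnm. induction Hnm as [|m Hnm IH].
  - assert (E : minus (x n) (x n) = zero) by module_eq V. rewrite E.
    rewrite Rminus_diag. right; exact (norm_zero (V := V)).
  - destruct (Spec m) as [S1 [S2 _]].
    assert (Q := norm_minus_triangle (V := V) (x m) (x (S m)) (x n)). one_path. lra. }
assert (Pr : forall j, 0 < r j) by (intros j; exact (proj2_sig (b j))).
assert (Sm : forall j, r j * (INR j + 1) <= 1).
{ induction j as [|j IH]; [unfold r; simpl; lra|].
  destruct (Spec j) as [S1 _]. rewrite S_INR. assert (Pj := pos_INR j).
  specialize (Pr j). nra. }
destruct (seq_lim x r) as [l Hl].
{ intros n m Hnm. specialize (Nest n m Hnm). specialize (Pr m). lra. }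
{ intros eps He. destruct (archimed_cor1 eps He) as [n [Hn Pn]]. exists n.
  eapply Rle_lt_trans; [|exact Hn]. specialize (Sm n).
  assert (Pn' : 0 < INR n) by now apply lt_0_INR.
  apply Rmult_le_reg_r with (1 := Pn'). rewrite Rinv_l by lra. specialize (Pr n). lra. }
destruct (Bd l) as [M HM].
destruct (INR_unbounded M) as [j Hj].
destruct (Spec j) as [_ [_ [n Hn]]].
specialize (Hn l (Hl (S j))). specialize (HM n). lra.
Qed.

(** * The state space as a Banach space *)

Section Phase_space.
Context {H : Hilbert} (A : DiscreteOperator H).

Lemma norm_pair_sq (x : Yspace A) : norm x ^ 2 = norm (fst x) ^ 2 + norm (snd x) ^ 2.
Proof.
change (norm x) with (sqrt (norm (fst x) ^ 2 + norm (snd x) ^ 2)).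
apply pow2_sqrt. assert (Q1 := pow2_ge_0 (norm (fst x))).
assert (Q2 := pow2_ge_0 (norm (snd x))). lra.
Qed.

Lemma norm_fst_le (x : Yspace A) : norm (fst x) <= norm x.
Proof.
apply Rsqr_incr_0_var; [|apply norm_ge_0]. rewrite !Rsqr_pow2, norm_pair_sq.
assert (Q2 := pow2_ge_0 (norm (snd x))). lra.
Qed.

Lemma norm_snd_le (x : Yspace A) : norm (snd x) <= norm x.
Proof.
apply Rsqr_incr_0_var; [|apply norm_ge_0]. rewrite !Rsqr_pow2, norm_pair_sq.
assert (Q2 := pow2_ge_0 (norm (fst x))). lra.
Qed.

Lemma norm_pair_le (x : Yspace A) : norm x <= norm (fst x) + norm (snd x).
Proof.
assert (P1 := norm_ge_0 (fst x)). assert (P2 := norm_ge_0 (snd x)).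
apply Rsqr_incr_0_var; [|lra]. rewrite !Rsqr_pow2, norm_pair_sq.
nra.
Qed.

Lemma is_linear_fst : is_linear (U := Yspace A) (V := Dhalf A) fst.
Proof. exact (is_linear_fst (K := R_AbsRing) (U := Dhalf A) (V := H)). Qed.

Lemma is_linear_snd : is_linear (U := Yspace A) (V := H) snd.
Proof. exact (is_linear_snd (K := R_AbsRing) (U := Dhalf A) (V := H)). Qed.

(** The first component is transported to [H] by the isometry [root], where the
    limit exists. *)
Definition Yspace_lim (F : (Yspace A -> Prop) -> Prop) : Yspace A :=
  (unroot A (lim (T := CompleteNormedModule.CompleteSpace R_AbsRing H) (fun P => F (fun x => P (root A (fst x))))),
   lim (T := CompleteNormedModule.CompleteSpace R_AbsRing H) (fun P => F (fun x => P (snd x)))).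

Lemma Yspace_complete_mixin : CompleteSpace.mixin_of (Yspace A).
Proof.
apply (CompleteSpace.Mixin (Yspace A) Yspace_lim).
- intros F FF CF eps.
  set (F1 := fun P : H -> Prop => F (fun x => P (root A (fst x)))).
  set (F2 := fun P : H -> Prop => F (fun x => P (snd x))).
  assert (PF1 : ProperFilter F1) by exact (filtermap_proper_filter _ _ (fun x : Yspace A => root A (fst x)) F FF).
  assert (PF2 : ProperFilter F2) by exact (filtermap_proper_filter _ _ (fun x : Yspace A => snd x) F FF).
  assert (C1 : cauchy F1).
  { intros e. destruct (CF e) as [x Hx]. exists (root A (fst x)).
    apply (filter_imp (F := F)) with (2 := Hx). intros y [By _].
    apply (norm_compat1 (V := H)).
    assert (Q : norm (minus (fst y) (fst x)) < e) by exact By.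
    rewrite <- norm_root, root_minus in Q. exact Q. }
  assert (C2 : cauchy F2).
  { intros e. destruct (CF e) as [x Hx]. exists (snd x).
    apply (filter_imp (F := F)) with (2 := Hx). intros y [_ By]. exact By. }
  assert (Pf := norm_factor_gt_0 (V := H)).
  assert (He : 0 < eps / @norm_factor R_AbsRing H)
    by (apply Rdiv_lt_0_compat; [apply cond_pos|exact Pf]).
  assert (E1 := complete_cauchy F1 PF1 C1 (mkposreal _ He)).
  assert (E2 := complete_cauchy F2 PF2 C2 eps).
  apply (filter_imp (F := F)) with (2 := filter_and (F := F)
    (fun x => ball (lim F1) (eps / @norm_factor R_AbsRing H) (root A (fst x)))
    (fun x => ball (lim F2) eps (snd x)) E1 E2).
  intros y [B1 B2]. split; [|exact B2].
  change (norm (minus (fst y) (unroot A (lim F1))) < eps).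
  rewrite <- norm_root, root_minus, root_unroot.
  assert (Q := norm_compat2 (V := H) (lim F1) (root A (fst y)) (mkposreal _ He) B1). simpl in Q.
  replace (@norm_factor R_AbsRing H * (eps / @norm_factor R_AbsRing H)) with (eps : R) in Q
    by (field; lra). exact Q.
- intros F1 F2 H12 H21.
  assert (E : forall (f : Yspace A -> H),
     lim (T := CompleteNormedModule.CompleteSpace R_AbsRing H) (fun P => F1 (fun x => P (f x))) = lim (T := CompleteNormedModule.CompleteSpace R_AbsRing H) (fun P => F2 (fun x => P (f x)))).
  { intros f. apply (eq_close (V := H)).
    apply (close_lim (T := CompleteNormedModule.CompleteSpace R_AbsRing H)).
    - intros P. apply H12.
    - intros P. apply H21. }
  unfold Yspace_lim. rewrite !E. intros e. apply ball_center.
Qed.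

(** The underlying normed module is [Yspace A] itself, so that integrals with
    values in the two spaces are the same. *)
Definition Ycomplete : CompleteNormedModule R_AbsRing :=
  CompleteNormedModule.Pack R_AbsRing (Yspace A)
    (CompleteNormedModule.Class R_AbsRing _ (NormedModule.class _ (Yspace A))
       Yspace_complete_mixin) (Yspace A).

End Phase_space.

(** * Strongly continuous semigroups *)

Section Semigroup.
Context {Y : NormedModule R_AbsRing} (S : R -> Y -> Y) (HS : C0_semigroup S).

Lemma semigroup_linear t : 0 <= t -> is_linear (S t).
Proof. apply HS. Qed.

Lemma semigroup_0 x : S 0 x = x.
Proof. apply HS. Qed.

Lemma semigroup_add t s x : 0 <= t -> 0 <= s -> S (t + s) x = S t (S s x).
Proof. apply HS. Qed.

Lemma semigroup_right_cont x eps : 0 < eps ->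
  exists d, 0 < d /\ forall t, 0 <= t < d -> norm (minus (S t x) x) < eps.
Proof.
intros He. destruct HS as [_ [_ [_ C]]].
assert (Q := proj1 (filterlim_norm_iff (at_right 0) (fun t => S t x) x) (C x) eps He).
apply within_locally_iff in Q. destruct Q as [d [Hd Q]].
exists d. split; [exact Hd|]. intros t [Ht Ht'].
destruct (Rle_lt_or_eq_dec 0 t Ht) as [L|<-].
- apply Q; [exact L|]. rewrite Rminus_0_r, Rabs_pos_eq; lra.
- rewrite semigroup_0. rewrite norm_minus_self. exact He.
Qed.

Lemma generator_iff x y : generator S x y <->
  forall eps, 0 < eps -> exists d, 0 < d /\
  forall s, 0 < s < d -> norm (minus (minus (S s x) x) (scal s y)) <= eps * s.
Proof.
assert (E : forall s, 0 < s -> norm (minus (minus (S s x) x) (scal s y))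
   = s * norm (minus (scal (/ s) (minus (S s x) x)) y)).
{ intros s Hs.
  transitivity (norm (scal s (minus (scal (/ s) (minus (S s x) x)) y))).
  - f_equal. module_eq Y.
  - rewrite norm_scal_R, Rabs_pos_eq by lra. reflexivity. }
unfold generator. split.
- intros G eps He.
  assert (Q := proj1 (filterlim_norm_iff (at_right 0) _ y) G eps He).
  apply within_locally_iff in Q. destruct Q as [d [Hd Q]].
  exists d. split; [exact Hd|]. intros s Hs. rewrite E by lra.
  rewrite Rmult_comm. apply Rmult_le_compat_r; [lra|]. left. apply Q; [lra|].
  rewrite Rminus_0_r, Rabs_pos_eq; lra.
- intros G. apply (proj2 (filterlim_norm_iff (at_right 0) _ y)). intros eps He.
  destruct (G (eps / 2)) as [d [Hd Q]]; [lra|].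
  apply within_locally_iff. exists d. split; [exact Hd|]. intros s Hs Hs'.
  rewrite Rminus_0_r, Rabs_pos_eq in Hs' by lra.
  specialize (Q s (conj Hs Hs')). rewrite E in Q by exact Hs.
  rewrite (Rmult_comm _ s) in Q. apply Rmult_le_reg_l in Q; [|exact Hs].
  eapply Rle_lt_trans; [exact Q|lra].
Qed.

(** [S t] is bounded and commutes with the difference quotients at [0]. *)
Lemma generator_orbit t x y : 0 <= t -> generator S x y -> generator S (S t x) (S t y).
Proof.
intros Ht G. apply generator_iff. intros eps He.
assert (L := semigroup_linear t Ht).
destruct (linear_norm _ L) as [M [HM B]].
destruct (proj1 (generator_iff x y) G (eps / M)) as [d [Hd Q]].
{ now apply Rdiv_lt_0_compat. }
exists d. split; [exact Hd|]. intros s Hs. specialize (Q s Hs).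
assert (E : minus (minus (S s (S t x)) (S t x)) (scal s (S t y))
  = S t (minus (minus (S s x) x) (scal s y))).
{ rewrite !(is_linear_minus (S t)) by exact L.
  assert (E1 : S t (scal s y) = scal s (S t y)) by exact (linear_scal _ L s y).
  rewrite E1, <- !semigroup_add by lra. now rewrite Rplus_comm. }
rewrite E. eapply Rle_trans; [apply B|].
apply Rmult_le_compat_l with (1 := Rlt_le _ _ HM) in Q.
replace (M * (eps / M * s)) with (eps * s) in Q by (field; lra). exact Q.
Qed.

(** A bound near [0] is what propagates strong continuity from [0] to all times. *)
Context (d0 C0 : R) (Hd0 : 0 < d0) (HC0 : 0 < C0)
  (Bound : forall t x, 0 <= t <= d0 -> norm (S t x) <= C0 * norm x).

(** An orbit near [t] starts again from a point [t0] slightly before [t]: continuity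
    on both sides of [t] follows from the bound on operators and from right
    continuity at [0]. *)
Lemma semigroup_cont x t eps : 0 <= t -> 0 < eps ->
  exists d, 0 < d /\ forall s, 0 <= s -> Rabs (s - t) < d ->
  norm (minus (S s x) (S t x)) < eps.
Proof.
intros Ht He.
set (t0 := Rmax 0 (t - d0 / 2)). set (y := S t0 x).
assert (T0 : 0 <= t0) by apply Rmax_l.
assert (T1 : t - d0 / 2 <= t0) by apply Rmax_r.
assert (T2 : t0 <= t) by (apply Rmax_lub; lra).
destruct (semigroup_right_cont y (eps / C0)) as [d [Hd Q]].
{ now apply Rdiv_lt_0_compat. }
assert (K : forall a b, 0 <= a <= d0 -> a <= b < a + d ->
  norm (minus (S b y) (S a y)) < eps).
{ intros a b Ha Hb. replace b with (a + (b - a)) by ring.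
  rewrite semigroup_add, <- (is_linear_minus (S a)) by (try apply semigroup_linear; lra).
  eapply Rle_lt_trans; [apply Bound; exact Ha|].
  replace eps with (C0 * (eps / C0)) by (field; lra).
  apply Rmult_lt_compat_l; [exact HC0|]. apply Q; lra. }
exists (Rmin (d0 / 2) d). split; [apply Rmin_glb_lt; lra|]. intros s Hs Hst.
assert (Hst1 := Rlt_le_trans _ _ _ Hst (Rmin_l _ _)).
assert (Hst2 := Rlt_le_trans _ _ _ Hst (Rmin_r _ _)).
apply Rabs_def2 in Hst1. apply Rabs_def2 in Hst2.
assert (T3 : t0 <= s) by (apply Rmax_lub; lra).
replace s with ((s - t0) + t0) by ring. replace t with ((t - t0) + t0) at 1 by ring.
rewrite !semigroup_add by lra. fold y.
destruct (Rle_lt_dec s t) as [L|L].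
- rewrite norm_minus_sym. apply K; lra.
- apply K; lra.
Qed.

Lemma semigroup_continuous x t : continuous (fun s => S (Rmax 0 s) x) t.
Proof.
apply continuous_iff. intros eps He.
destruct (semigroup_cont x (Rmax 0 t) eps (Rmax_l _ _) He) as [d [Hd Q]].
exists d. split; [exact Hd|]. intros s Hs. apply Q; [apply Rmax_l|].
eapply Rle_lt_trans; [apply Rmax_0_lipschitz|exact Hs].
Qed.

Lemma orbit_linear_cont (l : Y -> R_NormedModule) x t : is_linear l ->
  continuous (fun s => l (S (Rmax 0 s) x)) t.
Proof.
intros L. apply (continuous_comp (fun s => S (Rmax 0 s) x) l); [apply semigroup_continuous|].
now apply is_linear_continuous.
Qed.

(** Seen through a functional such as a coefficient, the generator is bounded. *)
Context (l m : Y -> R_NormedModule) (Ll : is_linear l) (Lm : is_linear m)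
  (Lgen : forall x y, generator S x y -> l y = m x).

Lemma generator_primitive x y b : generator S x y -> 0 <= b ->
  is_RInt (fun s => m (S (Rmax 0 s) x)) 0 b (l (S b x) - l x).
Proof.
intros G Hb. destruct (linear_norm _ Ll) as [Ml [HMl Bl]].
assert (Q := is_RInt_rderiv (fun s => l (S (Rmax 0 s) x)) (fun s => m (S (Rmax 0 s) x))
  0 b (fun t => orbit_linear_cont l x t Ll) (fun t => orbit_linear_cont m x t Lm)).
cbv beta in Q. rewrite (Rmax_right 0 b), (Rmax_left 0 0), semigroup_0 in Q by lra.
apply Q; [|exact Hb]. intros s Hs eps He.
assert (Gs := generator_orbit s x y (proj1 Hs) G).
destruct (proj1 (generator_iff _ _) Gs (eps / Ml)) as [d [Hd E]]; [now apply Rdiv_lt_0_compat|].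
exists d. split; [exact Hd|]. intros r Hr. rewrite !Rmax_right by lra.
specialize (E (r - s) ltac:(lra)). rewrite <- (Lgen _ _ Gs).
replace (l (S r x) - l (S s x) - (r - s) * l (S s y)) with
  (l (minus (minus (S (r - s) (S s x)) (S s x)) (scal (r - s) (S s y)))).
- eapply Rle_trans; [apply Bl|].
  apply Rmult_le_compat_l with (1 := Rlt_le _ _ HMl) in E.
  replace (Ml * (eps / Ml * (r - s))) with (eps * (r - s)) in E by (field; lra). exact E.
- rewrite !(is_linear_minus l) by exact Ll.
  assert (E1 : l (scal (r - s) (S s y)) = scal (r - s) (l (S s y)))
    by exact (linear_scal _ Ll (r - s) (S s y)).
  rewrite E1, <- semigroup_add by lra.
  replace (r - s + s) with r by ring. reflexivity.
Qed.

(** The integral formula for the orbits in the domain is stable under limits, uniformly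
    for short times, and the domain is dense. *)
Lemma weak_generator x t :
  (forall x eps, 0 < eps -> exists x' y', generator S x' y' /\ norm (minus x x') <= eps) ->
  0 <= t -> is_rderiv (fun s => l (S s x)) t (m (S t x)).
Proof.
intros Dense Ht.
destruct (linear_norm _ Ll) as [Ml [HMl Bl]].
destruct (linear_norm _ Lm) as [Mm [HMm Bm]].
assert (All : forall z b, 0 <= b <= d0 ->
  is_RInt (fun s => m (S (Rmax 0 s) z)) 0 b (l (S b z) - l z)).
{ intros z b Hb.
  apply (is_RInt_limit (V := R_NormedModule) _ 0 b _ (Ml * (1 + C0) / (Mm * C0))); [lra| |].
  { apply (ex_RInt_cont (V := R_CompleteNormedModule)). intros s.
    now apply (orbit_linear_cont m). }
  intros eps He. assert (PMC : 0 < Mm * C0) by now apply Rmult_lt_0_compat.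
  destruct (Dense z (eps / (Mm * C0))) as [z' [w [G Hz]]]; [now apply Rdiv_lt_0_compat|].
  exists (fun s => m (S (Rmax 0 s) z')), (l (S b z') - l z').
  split; [apply (generator_primitive z' w b G); lra|].
  assert (Bz : forall s, 0 <= s <= b -> norm (minus (S s z) (S s z')) <= C0 * norm (minus z z')).
  { intros s Hs. rewrite <- (is_linear_minus (S s)) by (apply semigroup_linear; lra).
    apply Bound; lra. }
  split.
  - change (Rabs ((l (S b z') - l z') - (l (S b z) - l z)) <= Ml * (1 + C0) / (Mm * C0) * eps).
    replace ((l (S b z') - l z') - (l (S b z) - l z)) with
      (l (minus z z') + - l (minus (S b z) (S b z')))
      by (rewrite !(is_linear_minus l) by exact Ll; unfold minus, plus, opp; simpl;
          unfold plus, opp; simpl; ring).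
    eapply Rle_trans; [apply Rabs_triang|]. rewrite Rabs_Ropp.
    assert (B1 := Bl (minus z z')). assert (B2 := Bl (minus (S b z) (S b z'))).
    change (Rabs (l (minus z z')) <= Ml * norm (minus z z')) in B1.
    change (Rabs (l (minus (S b z) (S b z'))) <= Ml * norm (minus (S b z) (S b z'))) in B2.
    assert (B3 := Rmult_le_compat_l Ml _ _ ltac:(lra) (Bz b ltac:(lra))).
    assert (B4 := Rmult_le_compat_l (Ml * (1 + C0)) _ _ ltac:(apply Rmult_le_pos; lra) Hz).
    replace (Ml * (1 + C0) / (Mm * C0) * eps) with (Ml * (1 + C0) * (eps / (Mm * C0)))
      by (field; lra).
    lra.
  - intros s Hs. rewrite Rmax_right by lra.
    rewrite <- (is_linear_minus m) by exact Lm.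
    eapply Rle_trans; [apply Bm|].
    assert (B3 := Rmult_le_compat_l Mm _ _ ltac:(lra) (Bz s Hs)).
    assert (B4 := Rmult_le_compat_l (Mm * C0) _ _ ltac:(lra) Hz).
    replace (Mm * C0 * (eps / (Mm * C0))) with eps in B4 by (field; lra). lra. }
intros eps He.
set (z := S t x).
assert (DP : is_rderiv (RInt (fun s => m (S (Rmax 0 s) z)) 0) 0 (m (S (Rmax 0 0) z))).
{ apply is_rderiv_of_derive.
  apply (is_derive_RInt_cont (V := R_CompleteNormedModule) (fun s => m (S (Rmax 0 s) z))).
  intros s. now apply (orbit_linear_cont m). }
destruct (DP eps He) as [d [Hd Q]].
exists (Rmin d d0). split; [now apply Rmin_glb_lt|]. intros s Hs.
assert (K1 := Rmin_l d d0). assert (K2 := Rmin_r d d0).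
specialize (Q (s - t) ltac:(lra)).
rewrite (RInt_point (V := R_CompleteNormedModule)) in Q.
rewrite (is_RInt_unique (V := R_CompleteNormedModule) _ _ _ _ (All z (s - t) ltac:(lra))) in Q.
rewrite Rmax_left, semigroup_0 in Q by lra.
unfold z in Q. rewrite <- semigroup_add in Q by lra.
replace (s - t + t) with s in Q by ring.
change (zero : R) with 0 in Q. rewrite !Rminus_0_r in Q. exact Q.
Qed.

End Semigroup.

(** Otherwise the operators [S t_n] would be unbounded for some [t_n] that tend to
    [0], although they converge on each vector. *)
Lemma semigroup_local_bound (Y : CompleteNormedModule R_AbsRing) (S : R -> Y -> Y) :
  C0_semigroup S ->
  exists d C, 0 < d /\ 0 < C /\ forall t x, 0 <= t <= d -> norm (S t x) <= C * norm x.
Proof.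
intros HS. apply NNPP; intros N.
assert (Bad : forall n, exists t, 0 <= t <= / (INR n + 1) /\
  exists x, INR n * norm x < norm (S t x)).
{ intros n. apply NNPP; intros Nn. apply N. exists (/ (INR n + 1)), (INR n + 1).
  assert (Pn := pos_INR n).
  split; [apply Rinv_0_lt_compat; lra|]. split; [lra|]. intros t x Ht.
  apply Rnot_lt_le. intros L. apply Nn. exists t. split; [exact Ht|]. exists x.
  eapply Rle_lt_trans; [|exact L]. apply Rmult_le_compat_r; [apply norm_ge_0|lra]. }
set (ts := fun n => proj1_sig (constructive_indefinite_description _ (Bad n))).
assert (Hts : forall n, 0 <= ts n <= / (INR n + 1) /\
  exists x, INR n * norm x < norm (S (ts n) x)).
{ intros n. exact (proj2_sig (constructive_indefinite_description _ (Bad n))). }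
destruct (uniform_boundedness (fun n => S (ts n))) as [C HC].
- intros n. apply HS. apply Hts.
- intros x. destruct (semigroup_right_cont S HS x 1 Rlt_0_1) as [d [Hd Q]].
  destruct (archimed_cor1 d Hd) as [k [Hk Pk]].
  assert (Pk' : 0 < INR k) by now apply lt_0_INR.
  assert (Large : forall n, (k <= n)%nat -> norm (S (ts n) x) <= norm x + 1).
  { intros n Hn. destruct (Hts n) as [Ht _].
    assert (Hn' : INR k <= INR n) by now apply le_INR.
    assert (Hinv : / (INR n + 1) <= / INR k) by (apply Rinv_le_contravar; lra).
    specialize (Q (ts n) ltac:(lra)).
    assert (T := norm_plus_minus (V := Y) (S (ts n) x) x). one_path. lra. }
  assert (Small : forall k, exists M, forall n, (n < k)%nat -> norm (S (ts n) x) <= M).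
  { intros j. induction j as [|j [M HM]]; [exists 0; intros; lia|].
    exists (Rmax M (norm (S (ts j) x))). intros n Hn.
    destruct (Nat.eq_dec n j) as [->|Nj]; [apply Rmax_r|].
    eapply Rle_trans; [apply HM; lia|apply Rmax_l]. }
  destruct (Small k) as [M HM]. exists (Rmax M (norm x + 1)). intros n.
  destruct (Nat.le_gt_cases k n) as [L|L].
  + eapply Rle_trans; [now apply Large|apply Rmax_r].
  + eapply Rle_trans; [now apply HM|apply Rmax_l].
- destruct (INR_unbounded C) as [n Hn]. destruct (Hts n) as [_ [x Hx]].
  specialize (HC n x). simpl in HC.
  assert (INR n * norm x >= C * norm x); [|lra].
  apply Rle_ge, Rmult_le_compat_r; [apply norm_ge_0|lra].
Qed.

(** * Modes of the wave equation *)

(** The energy balance of a damped oscillator [p'' + k p' + mu p = r]. *)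
Lemma oscillator_energy (p q r : R -> R) (mu k T : R) :
  (forall t, continuous p t) -> (forall t, continuous q t) -> (forall t, continuous r t) ->
  (forall t, 0 <= t < T -> is_rderiv p t (q t)) ->
  (forall t, 0 <= t < T -> is_rderiv q t (- mu * p t - k * q t + r t)) ->
  0 <= T ->
  is_RInt (fun s => - 2 * k * q s ^ 2 + 2 * (r s * q s)) 0 T
    ((q T ^ 2 + mu * p T ^ 2) - (q 0 ^ 2 + mu * p 0 ^ 2)).
Proof.
intros Cp Cq Cr Dp Dq HT.
set (dq := fun t => - mu * p t - k * q t + r t).
assert (Cdq : forall t, continuous dq t).
{ intros t. unfold dq.
  apply (continuous_plus (V := R_NormedModule)); [|apply Cr].
  apply (continuous_minus (V := R_NormedModule)).
  - apply (continuous_scal_r (V := R_NormedModule)), Cp.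
  - apply (continuous_scal_r (V := R_NormedModule)), Cq. }
destruct (C1_extension p q T Cp Cq Dp) as [P [DP EP]].
destruct (C1_extension q dq T Cq Cdq Dq) as [Q [DQ EQ]].
assert (CP : forall t, continuous P t).
{ intros t. apply (ex_derive_continuous (V := R_NormedModule)). now exists (q t). }
assert (CQ : forall t, continuous Q t).
{ intros t. apply (ex_derive_continuous (V := R_NormedModule)). now exists (dq t). }
rewrite <- (EP T), <- (EP 0), <- (EQ T), <- (EQ 0) by lra.
apply (is_RInt_ext_le (V := R_NormedModule) (fun s => 2 * (Q s * dq s + mu * (P s * q s)))); [exact HT| |].
{ intros s Hs. rewrite EP, EQ by lra. unfold dq. as_R. ring. }
apply (is_RInt_derive (V := R_CompleteNormedModule) (fun t => Q t ^ 2 + mu * P t ^ 2)).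
- intros s _. auto_derive.
  + split; [now exists (dq s)|]. split; [now exists (q s)|exact I].
  + rewrite (is_derive_unique _ _ _ (DP s) : Derive (fun x => P x) s = q s).
    rewrite (is_derive_unique _ _ _ (DQ s) : Derive (fun x => Q x) s = dq s). ring.
- intros s _. apply (continuous_scal_r (V := R_NormedModule) 2).
  apply (continuous_plus (V := R_NormedModule)).
  + apply (continuous_mult (K := R_AbsRing)); [apply CQ|apply Cdq].
  + apply (continuous_scal_r (V := R_NormedModule) mu).
    apply (continuous_mult (K := R_AbsRing)); [apply CP|apply Cq].
Qed.

Section Modes.
Context {H : Hilbert} (A : DiscreteOperator H) (k : R).

Definition pos_mode (i : nat) (z : Yspace A) : R_NormedModule := coef A i (emb (fst z)).
Definition vel_mode (i : nat) (z : Yspace A) : R_NormedModule := coef A i (snd z).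

Lemma is_linear_pos_mode i : is_linear (pos_mode i).
Proof.
apply (is_linear_comp (K := R_AbsRing) (fun z : Yspace A => fst z) (fun u : Dhalf A => coef A i (emb u))).
- apply is_linear_fst.
- apply (is_linear_comp (K := R_AbsRing) (fun u : Dhalf A => emb u) (fun x : H => coef A i x)).
  + apply is_linear_emb.
  + apply is_linear_inner.
Qed.

Lemma is_linear_vel_mode i : is_linear (vel_mode i).
Proof.
apply (is_linear_comp (K := R_AbsRing) (fun z : Yspace A => snd z) (fun x : H => coef A i x)).
- apply is_linear_snd.
- apply is_linear_inner.
Qed.

(** The equation [u' = v], [v' + k v + A u = g] on [[0, T)], tested with the
    eigenvectors. *)
Definition solves_modes (T : R) (z : R -> Yspace A) (g : R -> H) : Prop :=
  forall i t, 0 <= t < T ->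
  is_rderiv (fun s => pos_mode i (z s)) t (vel_mode i (z t)) /\
  is_rderiv (fun s => vel_mode i (z s)) t
    (- eigval A i * pos_mode i (z t) - k * vel_mode i (z t) + coef A i (g t)).

Context (T : R) (HT : 0 <= T) (z : R -> Yspace A) (g : R -> H)
  (Cz : forall t, continuous z t) (Cg : forall t, continuous g t)
  (Modes : solves_modes T z g).

Lemma cont_fst t : continuous (fun s => fst (z s)) t.
Proof. apply (cont_linear (fst : Yspace A -> Dhalf A)); [apply is_linear_fst|apply Cz]. Qed.

Lemma cont_snd t : continuous (fun s => snd (z s)) t.
Proof. apply (cont_linear (snd : Yspace A -> H)); [apply is_linear_snd|apply Cz]. Qed.

Lemma cont_root t : continuous (fun s => root A (fst (z s))) t.
Proof. apply (cont_linear (root A)); [apply is_linear_root|apply cont_fst]. Qed.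

Lemma cont_coef i (f : R -> H) t : continuous f t -> continuous (fun s => coef A i (f s)) t.
Proof. apply (cont_linear (V := H) (W := R_NormedModule) (coef A i)), is_linear_inner. Qed.

Lemma energy_modes n :
  is_RInt (fun s => - 2 * k * norm (proj A n (snd (z s))) ^ 2
                    + 2 * inner (g s) (proj A n (snd (z s)))) 0 T
    ((norm (proj A n (snd (z T))) ^ 2 + norm (proj A n (root A (fst (z T)))) ^ 2)
     - (norm (proj A n (snd (z 0))) ^ 2 + norm (proj A n (root A (fst (z 0)))) ^ 2)).
Proof.
set (term := fun s i => - 2 * k * vel_mode i (z s) ^ 2 + 2 * (coef A i (g s) * vel_mode i (z s))).
set (en := fun s i => vel_mode i (z s) ^ 2 + eigval A i * pos_mode i (z s) ^ 2).
assert (E1 : forall s n, sum_n (term s) n = - 2 * k * norm (proj A n (snd (z s))) ^ 2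
                    + 2 * inner (g s) (proj A n (snd (z s)))).
{ intros s m. rewrite norm_proj_sq, (inner_sym H (g s)), inner_proj.
  induction m as [|m IH].
  - rewrite !sum_O. unfold term, vel_mode. as_R. ring.
  - rewrite !sum_Sn, IH. unfold term, vel_mode. change plus with Rplus. as_R. ring. }
assert (E2 : forall s n, sum_n (en s) n = norm (proj A n (snd (z s))) ^ 2 
                    + norm (proj A n (root A (fst (z s)))) ^ 2).
{ intros s m. rewrite !norm_proj_sq.
  induction m as [|m IH].
  - rewrite !sum_O, coef_root. unfold en, vel_mode, pos_mode.
    rewrite <- sqrt_eigval_sq. as_R. ring.
  - rewrite !sum_Sn, IH, coef_root. unfold en, vel_mode, pos_mode.
    rewrite <- sqrt_eigval_sq. change plus with Rplus. as_R. ring. }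
rewrite <- !E2.
apply (is_RInt_ext (fun s => sum_n (term s) n)); [intros s _; apply E1|].
assert (Q : forall i, is_RInt (fun s => term s i) 0 T (en T i - en 0 i)).
{ intros i. apply (oscillator_energy (fun s => pos_mode i (z s)) (fun s => vel_mode i (z s))
    (fun s => coef A i (g s))).
  - intros t. apply (cont_linear (pos_mode i)); [apply is_linear_pos_mode|apply Cz].
  - intros t. apply (cont_linear (vel_mode i)); [apply is_linear_vel_mode|apply Cz].
  - intros t. apply cont_coef, Cg.
  - intros t Ht. exact (proj1 (Modes i t Ht)).
  - intros t Ht. exact (proj2 (Modes i t Ht)).
  - exact HT. }
induction n as [|n IH].
- apply (is_RInt_ext (fun s => term s 0%nat)); [intros s _; now rewrite sum_O|].
  rewrite !sum_O. apply Q.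
- apply (is_RInt_ext (fun s => plus (sum_n (term s) n) (term s (S n)))).
  { intros s _. now rewrite sum_Sn. }
  rewrite !sum_Sn.
  replace (plus (sum_n (en T) n) (en T (S n)) - plus (sum_n (en 0) n) (en 0 (S n))) with
    (plus (sum_n (en T) n - sum_n (en 0) n) (en T (S n) - en 0 (S n)))
    by (change plus with Rplus; as_R; ring).
  apply (is_RInt_plus (V := R_NormedModule)); [exact IH|apply Q].
Qed.

Lemma norm_sq_proj_diff n (x : H) :
  Rabs (norm x ^ 2 - norm (proj A n x) ^ 2) <= norm x * norm (minus (proj A n x) x).
Proof.
rewrite norm_proj_inner, norm_sq, <- inner_minus_r.
eapply Rle_trans; [apply cauchy_schwarz|]. rewrite (norm_minus_sym (V := H)). apply Rle_refl.
Qed.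

(** The balances of the oscillators add up.  The finite sums pass to the limit
    because the projections of the velocity and of [root u] converge uniformly
    along the curve. *)
Theorem linear_energy :
  is_RInt (fun s => - 2 * k * norm (snd (z s)) ^ 2 + 2 * inner (g s) (snd (z s))) 0 T
    (norm (z T) ^ 2 - norm (z 0) ^ 2).
Proof.
set (v := fun s => snd (z s)). set (w := fun s => root A (fst (z s))).
assert (Cv : forall t, continuous v t) by apply cont_snd.
assert (Cw : forall t, continuous w t) by apply cont_root.
destruct (cont_bounded v T Cv) as [Bv [PBv HBv]].
destruct (cont_bounded w T Cw) as [Bw [PBw HBw]].
destruct (cont_bounded g T Cg) as [Bg [PBg HBg]].
set (B := Bv + Bw + Bg). assert (PB : 0 < B) by (unfold B; lra).
assert (Pk : 0 <= Rabs k) by apply Rabs_pos.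
rewrite !norm_pair_sq.
apply (is_RInt_limit (V := R_NormedModule) _ 0 T _ 2); [exact HT| |].
{ apply (ex_RInt_cont (V := R_CompleteNormedModule)). intros x.
  apply (continuous_plus (V := R_NormedModule)).
  - apply (continuous_scal_r (V := R_NormedModule) (- 2 * k)).
    apply (continuous_ext (fun s => inner (v s) (v s))); [intros s; symmetry; apply norm_sq|].
    now apply cont_inner.
  - apply (continuous_scal_r (V := R_NormedModule) 2).
    apply cont_inner; [apply Cg|apply Cv]. }
intros eps He.
(* each of the errors below is at most [B * e] *)
set (e := eps / (2 * (Rabs k + 1) * B)).
assert (Pe : 0 < e).
{ unfold e. apply Rdiv_lt_0_compat; [exact He|]. apply Rmult_lt_0_compat; lra. }
assert (Ee : 2 * (Rabs k + 1) * (B * e) = eps) by (unfold e; field; lra).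
destruct (proj_lim_unif A v T e Cv Pe HT) as [N1 H1].
destruct (proj_lim_unif A w T e Cw Pe HT) as [N2 H2].
set (n := Nat.max N1 N2).
specialize (H1 n (Nat.le_max_l _ _)). specialize (H2 n (Nat.le_max_r _ _)).
assert (K : forall a b : R, 0 <= a <= B -> 0 <= b <= e -> a * b <= B * e)
  by (intros a b Ha Hb; apply Rmult_le_compat; lra).
assert (Kv : forall s, 0 <= s <= T -> Rabs (norm (v s) ^ 2 - norm (proj A n (v s)) ^ 2) <= B * e).
{ intros s Hs. eapply Rle_trans; [apply norm_sq_proj_diff|].
  apply K; split; try apply (norm_ge_0 (V := H)); [|now apply H1].
  specialize (HBv s Hs). unfold B. lra. }
assert (Kw : forall s, 0 <= s <= T -> Rabs (norm (w s) ^ 2 - norm (proj A n (w s)) ^ 2) <= B * e).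
{ intros s Hs. eapply Rle_trans; [apply norm_sq_proj_diff|].
  apply K; split; try apply (norm_ge_0 (V := H)); [|now apply H2].
  specialize (HBw s Hs). unfold B. lra. }
assert (Kg : forall s, 0 <= s <= T ->
  Rabs (inner (g s) (v s) - inner (g s) (proj A n (v s))) <= B * e).
{ intros s Hs. rewrite <- inner_minus_r. eapply Rle_trans; [apply cauchy_schwarz|].
  rewrite (norm_minus_sym (V := H)).
  apply K; split; try apply (norm_ge_0 (V := H)); [|now apply H1].
  specialize (HBg s Hs). unfold B. lra. }
assert (PBe : 0 < B * e) by now apply Rmult_lt_0_compat.
assert (PkBe : 0 <= Rabs k * (B * e)) by (apply Rmult_le_pos; lra).
eexists. eexists. split; [apply (energy_modes n)|]. split.
- assert (V1 := Kv T ltac:(lra)). assert (V0 := Kv 0 ltac:(lra)).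
  assert (W1 := Kw T ltac:(lra)). assert (W0 := Kw 0 ltac:(lra)).
  unfold v, w in V1, V0, W1, W0. rewrite !norm_root in W1, W0.
  match goal with |- norm ?x <= _ => change (Rabs x <= 2 * eps) end.
  unfold minus, plus, opp; simpl. simpl in V1, V0, W1, W0.
  apply Rabs_le_between in V1. apply Rabs_le_between in V0.
  apply Rabs_le_between in W1. apply Rabs_le_between in W0.
  apply Rabs_le_between. lra.
- intros s Hs. specialize (Kv s Hs). specialize (Kg s Hs). fold (v s).
  match goal with |- norm ?x <= _ => change (Rabs x <= eps) end.
  match goal with |- Rabs ?x <= _ => replace x with
    ((- 2 * k) * (norm (v s) ^ 2 - norm (proj A n (v s)) ^ 2)
     + 2 * (inner (g s) (v s) - inner (g s) (proj A n (v s)))) end.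
  2:{ unfold minus, plus, opp; simpl. unfold v. ring. }
  eapply Rle_trans; [apply Rabs_triang|]. rewrite !Rabs_mult.
  rewrite (Rabs_left1 (-2)), (Rabs_pos_eq 2) by lra.
  apply Rmult_le_compat_l with (1 := Pk) in Kv. lra.
Qed.

(** Both sides have the same coefficients: in [H], though not in [D(A^{1/2})], the
    velocity is the derivative of the position. *)
Lemma modes_primitive :
  is_RInt (fun s => snd (z s)) 0 T (minus (emb (fst (z T))) (emb (fst (z 0)))).
Proof.
assert (K := RInt_cont (V := H) (fun s => snd (z s)) 0 T cont_snd).
replace (minus (emb (fst (z T))) (emb (fst (z 0)))) with (RInt (fun s => snd (z s)) 0 T);
  [exact K|].
apply (coef_inj A). intros i. rewrite coef_minus.
apply (is_RInt_linear (V := R_NormedModule) (coef A i)) in K; [|apply is_linear_inner].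
apply (is_RInt_eq (V := R_NormedModule) _ _ _ _ _ K).
apply (is_RInt_rderiv (fun s => pos_mode i (z s)) (fun s => vel_mode i (z s))).
- intros t. apply (cont_linear (pos_mode i)); [apply is_linear_pos_mode|apply Cz].
- intros t. apply (cont_linear (vel_mode i)); [apply is_linear_vel_mode|apply Cz].
- intros t Ht. exact (proj1 (Modes i t Ht)).
- exact HT.
Qed.

End Modes.

(** * Duhamel's formula for a contraction semigroup *)

Section Duhamel.
Context {Y : CompleteNormedModule R_AbsRing} (S : R -> Y -> Y) (HS : C0_semigroup S)
  (Contr : forall t x, 0 <= t -> norm (S t x) <= norm x)
  (G : R -> Y) (CG : forall t, continuous G t).

Lemma contraction_cont x t eps : 0 <= t -> 0 < eps ->
  exists d, 0 < d /\ forall s, 0 <= s -> Rabs (s - t) < d ->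
  norm (minus (S s x) (S t x)) < eps.
Proof.
apply (semigroup_cont S HS 1 1 Rlt_0_1 Rlt_0_1).
intros s y Hs. rewrite Rmult_1_l. now apply Contr.
Qed.

Lemma contraction_minus t x y : 0 <= t ->
  norm (minus (S t x) (S t y)) <= norm (minus x y).
Proof.
intros Ht. assert (E := is_linear_minus (S t) x y (semigroup_linear S HS t Ht)).
one_path. rewrite <- E. now apply Contr.
Qed.

Lemma duhamel_integrand_cont t s : continuous (fun s => S (Rmax 0 (t - s)) (G s)) s.
Proof.
apply (continuous_iff (V := Y)). intros eps He.
destruct (contraction_cont (G s) (Rmax 0 (t - s)) (eps / 2) (Rmax_l _ _)) as [d1 [Hd1 E1]]; [lra|].
destruct (proj1 (continuous_iff (V := Y) G s) (CG s) (eps / 2)) as [d2 [Hd2 E2]]; [lra|].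
exists (Rmin d1 d2). split; [now apply Rmin_glb_lt|]. intros r Hr.
assert (Hr1 := Rlt_le_trans _ _ _ Hr (Rmin_l _ _)).
specialize (E2 r (Rlt_le_trans _ _ _ Hr (Rmin_r _ _))).
assert (E1' := E1 (Rmax 0 (t - r)) (Rmax_l _ _)). clear E1.
assert (K : Rabs (Rmax 0 (t - r) - Rmax 0 (t - s)) < d1).
{ eapply Rle_lt_trans; [apply Rmax_0_lipschitz|].
  replace (t - r - (t - s)) with (- (r - s)) by ring. now rewrite Rabs_Ropp. }
specialize (E1' K).
assert (K2 := contraction_minus (Rmax 0 (t - r)) (G r) (G s) (Rmax_l _ _)).
assert (T := norm_minus_triangle (V := Y) (S (Rmax 0 (t - r)) (G s))
  (S (Rmax 0 (t - r)) (G r)) (S (Rmax 0 (t - s)) (G s))).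
one_path. lra.
Qed.

Lemma duhamel_ex t a b : 0 <= a <= b -> b <= t -> ex_RInt (fun s => S (t - s) (G s)) a b.
Proof.
intros Hab Hb.
apply (ex_RInt_ext (V := Y) (fun s => S (Rmax 0 (t - s)) (G s))).
- rewrite Rmin_left, Rmax_right by lra. intros s Hs. rewrite Rmax_right; [reflexivity|lra].
- apply (ex_RInt_cont (V := Y)). intros s. apply duhamel_integrand_cont.
Qed.

Context (T : R) (V : R -> Y)
  (Mild : forall t, 0 <= t <= T -> exists I,
     is_RInt (fun s => S (t - s) (G s)) 0 t I /\ V t = plus (S t (V 0)) I).

(** The semigroup law splits Duhamel's integral at [a]. *)
Lemma mild_restart a b : 0 <= a <= b -> b <= T -> exists J,
  is_RInt (fun s => S (b - s) (G s)) a b J /\ V b = plus (S (b - a) (V a)) J.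
Proof.
intros Hab HbT.
destruct (Mild a) as [Ia [Ha Ea]]; [lra|].
destruct (Mild b) as [Ib [Hb Eb]]; [lra|].
destruct (duhamel_ex b a b Hab (Rle_refl b)) as [J HJ].
exists J. split; [exact HJ|].
assert (L : is_linear (S (b - a))) by (apply (semigroup_linear S HS); lra).
assert (HI : is_RInt (fun s => S (b - s) (G s)) 0 a (S (b - a) Ia)).
{ apply (is_RInt_ext_le (V := Y) (fun s => S (b - a) (S (a - s) (G s)))); [lra| |].
  - intros s Hs. rewrite <- (semigroup_add S HS) by lra. f_equal. ring.
  - now apply (is_RInt_linear (S (b - a))). }
assert (EI : Ib = plus (S (b - a) Ia) J).
{ apply (is_RInt_eq (V := Y) _ _ _ _ _ Hb). exact (is_RInt_Chasles (V := Y) _ 0 a b _ _ HI HJ). }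
rewrite Eb, EI, Ea.
assert (E1 : S (b - a) (plus (S a (V 0)) Ia) = plus (S (b - a) (S a (V 0))) (S (b - a) Ia))
  by exact (linear_plus _ L _ _).
rewrite E1, <- (semigroup_add S HS) by lra.
replace (b - a + a) with b by ring. module_eq Y.
Qed.

(** Up to a small integral, [V] follows near [t] an orbit of the semigroup that
    starts at an earlier time [t0]. *)
Lemma mild_cont t eps : 0 <= t <= T -> 0 < eps ->
  exists d, 0 < d /\ forall s, 0 <= s <= T -> Rabs (s - t) < d ->
  norm (minus (V s) (V t)) < eps.
Proof.
intros Ht He.
destruct (bounded_continuity G 0 T (fun x _ => CG x)) as [B HB].
assert (PB : 0 < B) by (eapply Rle_lt_trans; [apply (norm_ge_0 (G t))|apply HB; lra]).
(* an integral over a length of [2 * e] is at most [eps / 4] *)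
set (e := eps / (8 * B)).
assert (Pe : 0 < e) by (apply Rdiv_lt_0_compat; lra).
assert (EB : 2 * e * B = eps / 4) by (unfold e; field; lra).
set (t0 := Rmax 0 (t - e)).
assert (T0 : 0 <= t0) by apply Rmax_l.
assert (T1 : t - e <= t0) by apply Rmax_r.
assert (T2 : t0 <= t) by (apply Rmax_lub; lra).
assert (Tail : forall s, t0 <= s -> s <= T -> s - t0 <= 2 * e ->
  norm (minus (V s) (S (s - t0) (V t0))) <= eps / 4).
{ intros s Hs1 Hs2 Hs3. destruct (mild_restart t0 s) as [J [HJ EJ]]; [lra|exact Hs2|].
  rewrite EJ.
  assert (E : minus (plus (S (s - t0) (V t0)) J) (S (s - t0) (V t0)) = J) by module_eq Y.
  rewrite E. eapply Rle_trans.
  - apply (norm_RInt_le_const (fun r => S (s - r) (G r)) t0 s J B Hs1); [|exact HJ].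
    intros r Hr. eapply Rle_trans; [apply Contr; lra|]. left. apply HB. lra.
  - rewrite <- EB. apply Rmult_le_compat_r; lra. }
destruct (contraction_cont (V t0) (t - t0) (eps / 4)) as [d [Hd Q]]; [lra|lra|].
exists (Rmin e d). split; [now apply Rmin_glb_lt|]. intros s Hs Hst.
assert (Hst1 := Rlt_le_trans _ _ _ Hst (Rmin_l _ _)).
assert (Hst2 := Rlt_le_trans _ _ _ Hst (Rmin_r _ _)).
apply Rabs_def2 in Hst1.
assert (T3 : t0 <= s) by (apply Rmax_lub; lra).
specialize (Q (s - t0) ltac:(lra)).
replace (s - t0 - (t - t0)) with (s - t) in Q by ring. specialize (Q Hst2).
assert (Q1 := Tail s T3 ltac:(lra) ltac:(lra)).
assert (Q2 := Tail t T2 ltac:(lra) ltac:(lra)).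
rewrite (norm_minus_sym (V := Y)) in Q2.
assert (R1 := norm_minus_triangle (V := Y) (S (s - t0) (V t0)) (V s) (V t)).
assert (R2 := norm_minus_triangle (V := Y) (S (t - t0) (V t0)) (S (s - t0) (V t0)) (V t)).
one_path. lra.
Qed.

(** After a restart at [t], the orbit contributes the generator and the integral
    contributes the value of its integrand at [t]. *)
Lemma mild_rderiv (l m : Y -> R_NormedModule) t :
  is_linear l -> 0 <= t < T ->
  (forall x, is_rderiv (fun s => l (S s x)) 0 (m x)) ->
  is_rderiv (fun s => l (V s)) t (m (V t) + l (G t)).
Proof.
intros Ll Ht D eps He.
destruct (linear_norm _ Ll) as [Ml [HMl Bl]].
destruct (D (V t) (eps / 2)) as [d1 [Hd1 E1]]; [lra|].
set (e := eps / (4 * Ml)).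
assert (Pe : 0 < e) by (apply Rdiv_lt_0_compat; lra).
assert (Ee : Ml * (2 * e) = eps / 2) by (unfold e; field; lra).
destruct (proj1 (continuous_iff (V := Y) G t) (CG t) e Pe) as [d2 [Hd2 E2]].
destruct (contraction_cont (G t) 0 e (Rle_refl 0) Pe) as [d3 [Hd3 E3]].
exists (Rmin (Rmin d1 d2) (Rmin d3 (T - t))).
split; [repeat apply Rmin_glb_lt; lra|]. intros s Hs.
assert (K1 := Rmin_l (Rmin d1 d2) (Rmin d3 (T - t))).
assert (K2 := Rmin_r (Rmin d1 d2) (Rmin d3 (T - t))).
assert (K3 := Rmin_l d1 d2). assert (K4 := Rmin_r d1 d2).
assert (K5 := Rmin_l d3 (T - t)). assert (K6 := Rmin_r d3 (T - t)).
destruct (mild_restart t s) as [J [HJ EJ]]; [lra|lra|].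
specialize (E1 (s - t) ltac:(lra)). rewrite (semigroup_0 S HS), Rminus_0_r in E1.
assert (Near : norm (minus J (scal (s - t) (G t))) <= (s - t) * (2 * e)).
{ apply (is_RInt_close (V := Y) (fun r => S (s - r) (G r)) (fun _ => G t) t s); [lra|exact HJ| |].
  - apply (is_RInt_const (V := Y)).
  - intros r Hr.
    assert (A1 := contraction_minus (s - r) (G r) (G t) ltac:(lra)).
    assert (A2 : Rabs (r - t) < d2) by (rewrite Rabs_pos_eq; lra).
    apply E2 in A2.
    assert (A3 : Rabs (s - r - 0) < d3) by (rewrite Rabs_pos_eq; lra).
    apply E3 in A3; [|lra]. rewrite (semigroup_0 S HS) in A3.
    assert (A4 := norm_minus_triangle (V := Y) (S (s - r) (G t)) (S (s - r) (G r)) (G t)).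
    one_path. lra. }
assert (L1 : l (V s) = l (S (s - t) (V t)) + l J)
  by (rewrite EJ; exact (linear_plus _ Ll _ _)).
assert (L2 : l (minus J (scal (s - t) (G t))) = l J - (s - t) * l (G t)).
{ refine (eq_trans (is_linear_minus l J (scal (s - t) (G t)) Ll) _).
  assert (E : l (scal (s - t) (G t)) = scal (s - t) (l (G t))) by exact (linear_scal _ Ll _ _).
  rewrite E. reflexivity. }
rewrite L1.
replace (l (S (s - t) (V t)) + l J - l (V t) - (s - t) * (m (V t) + l (G t))) with
  ((l (S (s - t) (V t)) - l (V t) - (s - t) * m (V t)) + (l J - (s - t) * l (G t))) by ring.
eapply Rle_trans; [apply Rabs_triang|].
assert (B2 : Rabs (l J - (s - t) * l (G t)) <= Ml * norm (minus J (scal (s - t) (G t)))).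
{ rewrite <- L2. apply Bl. }
apply Rmult_le_compat_l with (r := Ml) in Near; [|lra].
replace (Ml * ((s - t) * (2 * e))) with ((s - t) * (Ml * (2 * e))) in Near by ring.
rewrite Ee in Near. one_path. lra.
Qed.

End Duhamel.

Lemma is_linear_Rcomb {U : NormedModule R_AbsRing} (l m : U -> R_NormedModule) (a b : R) :
  is_linear l -> is_linear m -> is_linear (fun x => a * l x + b * m x : R_NormedModule).
Proof.
intros Ll Lm. apply Build_is_linear.
- intros x y. rewrite (linear_plus l Ll), (linear_plus m Lm).
  change plus with Rplus. as_R. ring.
- intros c x. rewrite (linear_scal l Ll), (linear_scal m Lm).
  change scal with Rmult. as_R. ring.
- destruct (linear_norm l Ll) as [Ml [HMl Bl]]. destruct (linear_norm m Lm) as [Mm [HMm Bm]].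
  assert (Pa := Rabs_pos a). assert (Pb := Rabs_pos b).
  exists (Rabs a * Ml + Rabs b * Mm + 1). split.
  + assert (0 <= Rabs a * Ml) by (apply Rmult_le_pos; lra).
    assert (0 <= Rabs b * Mm) by (apply Rmult_le_pos; lra). lra.
  + intros x. specialize (Bl x). specialize (Bm x). assert (Px := norm_ge_0 x).
    change (Rabs (a * l x + b * m x) <= (Rabs a * Ml + Rabs b * Mm + 1) * norm x).
    eapply Rle_trans; [apply Rabs_triang|]. rewrite !Rabs_mult.
    change (Rabs (l x) <= Ml * norm x) in Bl. change (Rabs (m x) <= Mm * norm x) in Bm.
    apply Rmult_le_compat_l with (1 := Pa) in Bl.
    apply Rmult_le_compat_l with (1 := Pb) in Bm. lra.
Qed.

(** * The wave semigroup *)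

Section Wave.
Context {H : Hilbert} (A : DiscreteOperator H) (k : R) (S : R -> Yspace A -> Yspace A)
  (S_wave : wave_semigroup A k S).

Lemma op_dom_plus x y : op_dom A x -> op_dom A y -> op_dom A (plus x y).
Proof.
intros Dx Dy. destruct (op_self_adjoint A) as [_ SA].
apply (proj2 (SA (plus x y) (plus (op_fun A x) (op_fun A y)))). intros w Dw.
rewrite !inner_plus_l. f_equal.
- exact (proj1 (SA x _) (conj Dx eq_refl) w Dw).
- exact (proj1 (SA y _) (conj Dy eq_refl) w Dw).
Qed.

Lemma op_dom_scal (c : R) x : op_dom A x -> op_dom A (scal c x).
Proof.
intros Dx. destruct (op_self_adjoint A) as [_ SA].
apply (proj2 (SA (scal c x) (scal c (op_fun A x)))). intros w Dw.
rewrite !inner_scal_l. f_equal. exact (proj1 (SA x _) (conj Dx eq_refl) w Dw).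
Qed.

Lemma op_dom_proj n x : op_dom A (proj A n x).
Proof.
unfold proj. induction n as [|n IH].
- rewrite sum_O. apply op_dom_scal, eigvec_dom.
- rewrite sum_Sn. apply op_dom_plus; [exact IH|]. apply op_dom_scal, eigvec_dom.
Qed.

Lemma coef_op_fun i x : op_dom A x -> coef A i (op_fun A x) = eigval A i * coef A i x.
Proof.
intros Dx. destruct (op_self_adjoint A) as [_ SA].
assert (E := proj1 (SA x _) (conj Dx eq_refl) _ (eigvec_dom A i)).
unfold coef. rewrite <- E, eigvec_eq. apply inner_scal_r.
Qed.

Lemma generator_modes x y i : generator S x y ->
  pos_mode A i y = vel_mode A i x /\
  vel_mode A i y = - eigval A i * pos_mode A i x - k * vel_mode A i x.
Proof.
intros G. destruct (proj1 (proj2 S_wave x y) G) as [Dx [v [Ev Ey]]].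
assert (E1 : fst y = v).
{ transitivity (opp (opp (fst y))); [module_eq (Dhalf A)|].
  change (opp (fst y)) with (fst (opp y)). rewrite Ey. simpl. module_eq (Dhalf A). }
assert (E2 : snd y = opp (plus (op_fun A (emb (fst x))) (scal k (emb v)))).
{ transitivity (opp (opp (snd y))); [module_eq H|].
  change (opp (snd y)) with (snd (opp y)). rewrite Ey. reflexivity. }
unfold pos_mode, vel_mode. rewrite E1, E2, Ev. split; [reflexivity|].
unfold coef at 1. rewrite inner_opp_l, inner_plus_l, inner_scal_l.
change (- (coef A i (op_fun A (emb (fst x))) + k * coef A i (snd x))
  = - eigval A i * coef A i (emb (fst x)) - k * coef A i (snd x)).
rewrite coef_op_fun by exact Dx. ring.
Qed.

(** The spectral projections of a state lie in the domain. *)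
Lemma generator_dense (x : Yspace A) eps : 0 < eps ->
  exists x' y', generator S x' y' /\ norm (minus x x') <= eps.
Proof.
intros He.
destruct (proj_lim A (root A (fst x)) (eps / 2)) as [N1 H1]; [lra|].
destruct (proj_lim A (snd x) (eps / 2)) as [N2 H2]; [lra|].
set (n := Nat.max N1 N2).
specialize (H1 n (Nat.le_max_l _ _)). specialize (H2 n (Nat.le_max_r _ _)).
set (v := proj_half A n (snd x)).
set (x' := (proj_half A n (emb (fst x)), proj A n (snd x)) : Yspace A).
set (w := (opp v, plus (op_fun A (emb (fst x'))) (scal k (emb v))) : Yspace A).
exists x', (opp w). split.
- apply (proj2 (proj2 S_wave x' (opp w))). split.
  + change (op_dom A (emb (proj_half A n (emb (fst x))))).
    rewrite emb_proj_half. apply op_dom_proj.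
  + exists v. split; [apply emb_proj_half|].
    transitivity w; [module_eq (Yspace A)|reflexivity].
- eapply Rle_trans; [apply norm_pair_le|].
  assert (B1 : norm (fst (minus x x')) <= eps / 2).
  { change (fst (minus x x')) with (minus (fst x) (fst x')).
    rewrite <- norm_root, root_minus.
    change (fst x') with (proj_half A n (emb (fst x))). rewrite root_proj_half.
    rewrite (norm_minus_sym (V := H)). left. exact H1. }
  assert (B2 : norm (snd (minus x x')) <= eps / 2).
  { change (norm (minus (snd x) (proj A n (snd x))) <= eps / 2).
    rewrite (norm_minus_sym (V := H)). left. exact H2. }
  lra.
Qed.

Lemma wave_rderiv x t i : 0 <= t ->
  is_rderiv (fun s => pos_mode A i (S s x)) t (vel_mode A i (S t x)) /\
  is_rderiv (fun s => vel_mode A i (S s x)) t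
    (- eigval A i * pos_mode A i (S t x) - k * vel_mode A i (S t x)).
Proof.
intros Ht.
destruct (semigroup_local_bound (Ycomplete A) S (proj1 S_wave)) as [d [C [Hd [HC B]]]].
split.
- apply (weak_generator S (proj1 S_wave) d C Hd HC B (pos_mode A i) (vel_mode A i)).
  + apply is_linear_pos_mode.
  + apply is_linear_vel_mode.
  + intros y w G. apply (generator_modes y w i G).
  + exact generator_dense.
  + exact Ht.
- replace (- eigval A i * pos_mode A i (S t x) - k * vel_mode A i (S t x)) with
    (- eigval A i * pos_mode A i (S t x) + - k * vel_mode A i (S t x)) by (as_R; ring).
  apply (weak_generator S (proj1 S_wave) d C Hd HC B (vel_mode A i)
    (fun y => - eigval A i * pos_mode A i y + - k * vel_mode A i y : R_NormedModule)).
  + apply is_linear_vel_mode.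
  + apply is_linear_Rcomb; [apply is_linear_pos_mode|apply is_linear_vel_mode].
  + intros y w G. rewrite (proj2 (generator_modes y w i G)). as_R. ring.
  + exact generator_dense.
  + exact Ht.
Qed.

(** Without forcing, the energy balance has the damping as its only source. *)
Lemma wave_contraction (k_ge_0 : 0 <= k) t x : 0 <= t -> norm (S t x) <= norm x.
Proof.
intros Ht.
destruct (semigroup_local_bound (Ycomplete A) S (proj1 S_wave)) as [d [C [Hd [HC B]]]].
set (z := fun s => S (Rmax 0 s) x).
assert (Q := linear_energy A k t Ht z (fun _ => zero)).
assert (Q' : is_RInt (fun s => - 2 * k * norm (snd (z s)) ^ 2 + 2 * inner zero (snd (z s))) 0 t
  (norm (z t) ^ 2 - norm (z 0) ^ 2)).
{ apply Q.
  - exact (semigroup_continuous S (proj1 S_wave) d C Hd HC B x).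
  - intros s. apply (continuous_const (zero : H)).
  - intros i s Hs. destruct (wave_rderiv x s i (proj1 Hs)) as [D1 D2].
    assert (E : Rmax 0 s = s) by (apply Rmax_right; lra).
    unfold z. unfold coef at 1. rewrite inner_zero_l, Rplus_0_r. split.
    + rewrite E. intros eps He. destruct (D1 eps He) as [d1 [Hd1 E1]].
      exists d1. split; [exact Hd1|]. intros r Hr. rewrite Rmax_right, E by lra. now apply E1.
    + rewrite E. intros eps He. destruct (D2 eps He) as [d1 [Hd1 E1]].
      exists d1. split; [exact Hd1|]. intros r Hr. rewrite Rmax_right, E by lra. now apply E1. }
unfold z in Q'. rewrite (Rmax_right 0 t), (Rmax_left 0 0), (semigroup_0 S (proj1 S_wave)) in Q' by lra.
assert (N : norm (S t x) ^ 2 - norm x ^ 2 <= (t - 0) * 0).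
{ apply (is_RInt_le _ (fun _ => 0) 0 t _ _ Ht Q').
  - exact (is_RInt_const (V := R_NormedModule) 0 t 0).
  - intros s _. rewrite inner_zero_l.
    assert (P := pow2_ge_0 (norm (snd (S (Rmax 0 s) x)))).
    assert (0 <= k * norm (snd (S (Rmax 0 s) x)) ^ 2) by now apply Rmult_le_pos. lra. }
apply Rsqr_incr_0_var; [|apply norm_ge_0]. rewrite !Rsqr_pow2. lra.
Qed.

End Wave.

(** * The energy of the nonlinear equation *)

Section Nonlinear_energy.
Context {H : Hilbert} (A : DiscreteOperator H) (k : R).

Definition locally_lipschitz (f : Dhalf A -> H) : Prop :=
  forall r : R, 0 < r -> exists L : R, 0 < L /\
  forall u1 u2 : Dhalf A, norm u1 <= r -> norm u2 <= r ->
  norm (minus (f u1) (f u2)) <= L * norm (minus u1 u2).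

Lemma locally_lipschitz_minus f1 f2 :
  locally_lipschitz f1 -> locally_lipschitz f2 ->
  locally_lipschitz (fun u => minus (f1 u) (f2 u)).
Proof.
intros L1 L2 r Hr. destruct (L1 r Hr) as [c1 [P1 B1]]. destruct (L2 r Hr) as [c2 [P2 B2]].
exists (c1 + c2). split; [lra|]. intros u1 u2 H1 H2.
specialize (B1 u1 u2 H1 H2). specialize (B2 u1 u2 H1 H2).
assert (E : minus (minus (f1 u1) (f2 u1)) (minus (f1 u2) (f2 u2))
  = minus (minus (f1 u1) (f1 u2)) (minus (f2 u1) (f2 u2))) by module_eq H.
rewrite E. eapply Rle_trans; [apply (norm_minus_le (V := H))|]. one_path. lra.
Qed.

Lemma locally_lipschitz_cont f (w : R -> Dhalf A) t :
  locally_lipschitz f -> continuous w t -> continuous (fun s => f (w s)) t.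
Proof.
intros Lf Cw. apply (continuous_iff (V := H)). intros eps He.
destruct (Lf (norm (w t) + 1)) as [L [HL B]]; [assert (P := norm_ge_0 (w t)); lra|].
destruct (proj1 (continuous_iff w t) Cw (Rmin 1 (eps / L))) as [d [Hd Q]].
{ apply Rmin_glb_lt; [lra|]. now apply Rdiv_lt_0_compat. }
exists d. split; [exact Hd|]. intros s Hs. specialize (Q s Hs).
assert (Q1 := Rlt_le_trans _ _ _ Q (Rmin_l _ _)).
assert (Q2 := Rlt_le_trans _ _ _ Q (Rmin_r _ _)).
assert (T := norm_plus_minus (w s) (w t)).
eapply Rle_lt_trans; [apply B; lra|].
replace eps with (L * (eps / L)) by (field; lra). now apply Rmult_lt_compat_l.
Qed.

Context (T : R) (HT : 0 <= T) (z : R -> Yspace A) (g : R -> H)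
  (Cz : forall t, continuous z t) (Cg : forall t, continuous g t)
  (Modes : solves_modes A k T z g).

(** The chain rule [d/dt Pi(u) = (Pi'(u), u')].  The curve [u] is differentiable
    in [H] only; its projections are differentiable in [D(A^{1/2})], and the
    formula passes to the limit because [Pi'] takes its values in [H]. *)
Lemma potential_chain (Pi : Dhalf A -> R) (dPi : Dhalf A -> Dhalf A -> R) (f : Dhalf A -> H) :
  (forall u : Dhalf A, filterdiff Pi (locally u) (dPi u)) ->
  locally_lipschitz f ->
  (forall u v : Dhalf A, inner (f u) (emb v) = dPi u v) ->
  is_RInt (fun s => inner (f (fst (z s))) (snd (z s))) 0 T (Pi (fst (z T)) - Pi (fst (z 0))).
Proof.
intros DPi Lf Split.
set (u := fun s => fst (z s)). set (v := fun s => snd (z s)).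
assert (Cu : forall t, continuous u t) by (intros t; apply (cont_fst A z Cz)).
assert (Cv : forall t, continuous v t) by (intros t; apply (cont_snd A z Cz)).
assert (Cr : forall t, continuous (fun s => root A (u s)) t)
  by (intros t; apply (cont_root A z Cz)).
assert (Cq : forall i t, continuous (fun s => coef A i (v s)) t)
  by (intros i t; now apply cont_coef).
assert (Ext : forall i, exists P : R -> R, (forall t, is_derive P t (coef A i (v t))) /\
  forall t, 0 <= t <= T -> P t = coef A i (emb (u t))).
{ intros i.
  apply (C1_extension (fun s => pos_mode A i (z s)) (fun s => vel_mode A i (z s))).
  - intros s. apply (cont_linear (pos_mode A i)); [apply is_linear_pos_mode|apply Cz].
  - apply Cq.
  - intros s Hs. now apply (Modes i s). }
set (P := fun i => proj1_sig (constructive_indefinite_description _ (Ext i))).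
assert (DP : forall i t, is_derive (P i) t (coef A i (v t)))
  by (intros i; apply (proj2_sig (constructive_indefinite_description _ (Ext i)))).
assert (EP : forall i t, 0 <= t <= T -> P i t = coef A i (emb (u t)))
  by (intros i; apply (proj2_sig (constructive_indefinite_description _ (Ext i)))).
set (W := fun n t => sum_n (fun i => scal (P i t) (eigvec_half A i)) n : Dhalf A).
assert (DW : forall n t, is_derive (W n) t (proj_half A n (v t))).
{ intros n t. unfold W, proj_half. induction n as [|n IH].
  - apply (is_derive_ext (fun s => scal (P 0%nat s) (eigvec_half A 0))).
    { intros s. now rewrite sum_O. }
    rewrite sum_O. apply (is_derive_scal_l (V := Dhalf A) (P 0%nat)). apply DP.
  - apply (is_derive_ext (fun s => plus (sum_n (fun i => scal (P i s) (eigvec_half A i)) n)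
       (scal (P (S n) s) (eigvec_half A (S n))))).
    { intros s. now rewrite sum_Sn. }
    rewrite sum_Sn. apply (is_derive_plus (V := Dhalf A)); [exact IH|].
    apply (is_derive_scal_l (V := Dhalf A) (P (S n))). apply DP. }
assert (EW : forall n t, 0 <= t <= T -> W n t = proj_half A n (emb (u t))).
{ intros n t Ht. unfold W, proj_half. apply sum_n_ext. intros i. now rewrite EP. }
assert (CW : forall n t, continuous (W n) t).
{ intros n t. apply (ex_derive_continuous (V := Dhalf A)). eexists. apply DW. }
assert (Cproj : forall n t, continuous (fun s => proj A n (v s)) t).
{ intros n t. apply (continuous_iff (V := H)). intros eps He.
  destruct (proj1 (continuous_iff v t) (Cv t) eps He) as [d [Hd Q]].
  exists d. split; [exact Hd|]. intros s Hs. specialize (Q s Hs).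
  one_path. rewrite <- (proj_minus A n (v s) (v t)). eapply Rle_lt_trans; [apply norm_proj_le|exact Q]. }
assert (Approx : forall n, is_RInt (fun s => inner (f (W n s)) (proj A n (v s))) 0 T
    (Pi (W n T) - Pi (W n 0))).
{ intros n. apply (is_RInt_derive (V := R_CompleteNormedModule) (fun t => Pi (W n t))).
  - intros s _. rewrite <- emb_proj_half, Split.
    assert (Q := filterdiff_comp' (K := R_AbsRing) (V := Dhalf A) (W n) Pi s _ _ (DW n s) (DPi (W n s))).
    apply (filterdiff_ext_lin _ _ _ Q). intros y.
    destruct (DPi (W n s)) as [L _]. exact (linear_scal _ L y _).
  - intros s _. apply cont_inner; [|apply Cproj].
    apply locally_lipschitz_cont; [exact Lf|apply CW]. }
assert (CPi : forall w eps, 0 < eps -> exists d, 0 < d /\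
   forall w', norm (minus w' w) < d -> Rabs (Pi w' - Pi w) < eps).
{ intros w eps He.
  assert (C : filterlim Pi (locally w) (locally (Pi w))).
  { apply (filterdiff_continuous (V := R_NormedModule) Pi w). eexists. apply DPi. }
  assert (Q := proj1 (filterlim_norm_iff (V := R_NormedModule) (locally w) Pi (Pi w)) C eps He).
  apply (locally_norm_le_locally (V := Dhalf A) w) in Q. destruct Q as [d Q].
  exists d. split; [apply cond_pos|]. intros w' Hw'. apply Q, Hw'. }
assert (Cf : forall t, continuous (fun s => f (u s)) t)
  by (intros t; now apply locally_lipschitz_cont).
destruct (cont_bounded v T Cv) as [Bv [PBv HBv]].
destruct (cont_bounded u T Cu) as [Bu [PBu HBu]].
destruct (cont_bounded (fun s => f (u s)) T Cf) as [Bf [PBf HBf]].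
destruct (Lf Bu PBu) as [L [HL BL]].
apply (is_RInt_limit (V := R_NormedModule) _ 0 T _ 2); [exact HT| |].
{ apply (ex_RInt_cont (V := R_CompleteNormedModule)). intros x.
  apply cont_inner; [apply Cf|apply Cv]. }
intros eps He.
destruct (CPi (u T) eps He) as [d1 [Hd1 K1]].
destruct (CPi (u 0) eps He) as [d2 [Hd2 K2]].
set (e1 := Rmin (Rmin d1 d2 / 2) (eps / (2 * L * Bv))).
assert (Pe1 : 0 < e1).
{ assert (0 < Rmin d1 d2) by now apply Rmin_glb_lt.
  apply Rmin_glb_lt; [lra|]. apply Rdiv_lt_0_compat; [exact He|].
  repeat apply Rmult_lt_0_compat; lra. }
assert (Pe2 : 0 < eps / (2 * Bf)) by (apply Rdiv_lt_0_compat; lra).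
destruct (proj_lim_unif A (fun s => root A (u s)) T e1 Cr Pe1 HT) as [N1 H1].
destruct (proj_lim_unif A v T (eps / (2 * Bf)) Cv Pe2 HT) as [N2 H2].
set (n := Nat.max N1 N2).
specialize (H1 n (Nat.le_max_l _ _)). specialize (H2 n (Nat.le_max_r _ _)).
assert (NW : forall t, 0 <= t <= T -> norm (minus (W n t) (u t)) <= e1).
{ intros t Ht. rewrite EW by exact Ht. rewrite <- norm_root, root_minus, root_proj_half.
  now apply H1. }
assert (E1a : e1 < d1 /\ e1 < d2).
{ assert (M1 := Rmin_l d1 d2). assert (M2 := Rmin_r d1 d2).
  assert (M3 := Rmin_l (Rmin d1 d2 / 2) (eps / (2 * L * Bv))). fold e1 in M3.
  assert (0 < Rmin d1 d2) by now apply Rmin_glb_lt. lra. }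
exists (fun s => inner (f (W n s)) (proj A n (v s))), (Pi (W n T) - Pi (W n 0)).
split; [apply Approx|]. split.
- assert (Q1 := K1 (W n T) (Rle_lt_trans _ _ _ (NW T ltac:(lra)) (proj1 E1a))).
  assert (Q2 := K2 (W n 0) (Rle_lt_trans _ _ _ (NW 0 ltac:(lra)) (proj2 E1a))).
  change (Rabs ((Pi (W n T) - Pi (W n 0)) - (Pi (u T) - Pi (u 0))) <= 2 * eps).
  apply Rabs_def2 in Q1. apply Rabs_def2 in Q2. apply Rabs_le_between. lra.
- intros s Hs.
  change (Rabs (inner (f (u s)) (v s) - inner (f (W n s)) (proj A n (v s))) <= eps).
  replace (inner (f (u s)) (v s) - inner (f (W n s)) (proj A n (v s))) with
    (inner (minus (f (u s)) (f (W n s))) (proj A n (v s))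
     + inner (f (u s)) (minus (v s) (proj A n (v s))))
    by (one_path; rewrite inner_minus_l, inner_minus_r; ring).
  assert (S1 := cauchy_schwarz (minus (f (u s)) (f (W n s))) (proj A n (v s))).
  assert (S2 := cauchy_schwarz (f (u s)) (minus (v s) (proj A n (v s)))).
  assert (S3 : norm (minus (f (u s)) (f (W n s))) <= L * e1).
  { eapply Rle_trans; [apply BL|].
    - now apply HBu.
    - rewrite EW by exact Hs. rewrite <- norm_root, root_proj_half.
      eapply Rle_trans; [apply norm_proj_le|]. rewrite norm_root. now apply HBu.
    - rewrite norm_minus_sym. apply Rmult_le_compat_l; [lra|now apply NW]. }
  assert (S4 : norm (proj A n (v s)) <= Bv).
  { eapply Rle_trans; [apply norm_proj_le|now apply HBv]. }
  assert (S5 := H2 s Hs). rewrite (norm_minus_sym (V := H)) in S5.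
  assert (S6 : norm (f (u s)) <= Bf) by now apply (HBf s).
  assert (R1 : norm (minus (f (u s)) (f (W n s))) * norm (proj A n (v s)) <= L * e1 * Bv).
  { apply Rmult_le_compat; auto; apply (norm_ge_0 (V := H)). }
  assert (R2 : norm (f (u s)) * norm (minus (v s) (proj A n (v s))) <= Bf * (eps / (2 * Bf))).
  { apply Rmult_le_compat; auto; apply (norm_ge_0 (V := H)). }
  assert (R3 : L * e1 * Bv <= L * (eps / (2 * L * Bv)) * Bv).
  { apply Rmult_le_compat_r; [lra|]. apply Rmult_le_compat_l; [lra|]. apply Rmin_r. }
  replace (L * (eps / (2 * L * Bv)) * Bv) with (eps / 2) in R3 by (field; lra).
  replace (Bf * (eps / (2 * Bf))) with (eps / 2) in R2 by (field; lra).
  eapply Rle_trans; [apply Rabs_triang|]. lra.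
Qed.

(** The part of the forcing that derives from the potential is integrated by the
    chain rule, the other one stays under the integral. *)
Lemma nonlinear_energy (Pi : Dhalf A -> R) (dPi : Dhalf A -> Dhalf A -> R)
  (F Fstar : Dhalf A -> H) (m : R -> H) :
  (forall u : Dhalf A, filterdiff Pi (locally u) (dPi u)) ->
  locally_lipschitz F -> locally_lipschitz Fstar ->
  (forall u v : Dhalf A, inner (F u) (emb v) = dPi u v + inner (Fstar u) (emb v)) ->
  (forall s, 0 <= s <= T -> g s = minus (opp (F (fst (z s)))) (m s)) ->
  is_RInt (fun s => - k * norm (snd (z s)) ^ 2 - inner (Fstar (fst (z s))) (snd (z s))
                    - inner (m s) (snd (z s))) 0 T
   ((/ 2 * norm (z T) ^ 2 + Pi (fst (z T))) - (/ 2 * norm (z 0) ^ 2 + Pi (fst (z 0)))).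
Proof.
intros DPi LF LFs Split Eg.
assert (E1 := linear_energy A k T HT z g Cz Cg Modes).
assert (E2 : is_RInt (fun s => inner (minus (F (fst (z s))) (Fstar (fst (z s)))) (snd (z s))) 0 T
  (Pi (fst (z T)) - Pi (fst (z 0)))).
{ apply (potential_chain Pi dPi (fun u => minus (F u) (Fstar u)) DPi).
  - now apply locally_lipschitz_minus.
  - intros u v. rewrite inner_minus_l, Split. ring. }
apply (is_RInt_scal (V := R_NormedModule) _ _ _ (/ 2)) in E1.
assert (E3 := is_RInt_plus (V := R_NormedModule) _ _ _ _ _ _ E1 E2).
replace ((/ 2 * norm (z T) ^ 2 + Pi (fst (z T))) - (/ 2 * norm (z 0) ^ 2 + Pi (fst (z 0))))
  with (plus (scal (/ 2) (norm (z T) ^ 2 - norm (z 0) ^ 2)) (Pi (fst (z T)) - Pi (fst (z 0))) : R).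
2:{ change scal with Rmult. change plus with Rplus. ring. }
revert E3. apply (is_RInt_ext_le (V := R_NormedModule)); [exact HT|].
intros s Hs. rewrite Eg by exact Hs. rewrite !inner_minus_l, inner_opp_l.
change scal with Rmult. change plus with Rplus. as_R. field.
Qed.

End Nonlinear_energy.

(** * The phase space [W] and segments of paths *)

Section Maximum.
Context (a b : R) (Hab : a <= b) (f : R -> R).

Lemma max_on_finite m : (forall x, a <= x <= b -> f x <= m) ->
  is_lub_Rbar (fun y => exists x, a <= x <= b /\ y = f x) (max_on a b f).
Proof.
intros B. unfold max_on.
assert (L := Lub_Rbar_correct (fun y => exists x, a <= x <= b /\ y = f x)).
destruct (Lub_Rbar _) as [l| |]; [exact L| |]; exfalso.
- assert (Q : Rbar_le p_infty m); [|exact Q].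
  apply L. intros y [x [Hx ->]]. now apply B.
- assert (Q : Rbar_le (f a) m_infty); [|exact Q].
  apply L. exists a. split; [lra|reflexivity].
Qed.

Lemma max_on_ge m x : (forall x, a <= x <= b -> f x <= m) -> a <= x <= b ->
  f x <= max_on a b f.
Proof.
intros B Hx. apply (proj1 (max_on_finite m B) (f x)). now exists x.
Qed.

Lemma max_on_le m : (forall x, a <= x <= b -> f x <= m) -> max_on a b f <= m.
Proof.
intros B. apply (proj2 (max_on_finite m B) (Finite m)). intros y [x [Hx ->]]. now apply B.
Qed.

End Maximum.

Lemma max_on_ext a b f g : (forall x, a <= x <= b -> f x = g x) ->
  max_on a b f = max_on a b g.
Proof.
intros E. unfold max_on. f_equal. apply Lub_Rbar_eqset. intros y.
split; intros [x [Hx ->]]; exists x; split; auto. now rewrite E.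
Qed.

Lemma interval_limit_point a b t d : a < b -> a <= t <= b -> 0 < d ->
  exists s, a <= s <= b /\ 0 < Rabs (s - t) < d.
Proof.
intros Hab Ht Hd.
destruct (Rlt_le_dec t b) as [L|L].
- exists (t + Rmin (b - t) (d / 2)).
  assert (M1 := Rmin_l (b - t) (d / 2)). assert (M2 := Rmin_r (b - t) (d / 2)).
  assert (0 < Rmin (b - t) (d / 2)) by (apply Rmin_glb_lt; lra).
  split; [lra|]. rewrite Rabs_pos_eq; lra.
- exists (t - Rmin (b - a) (d / 2)).
  assert (M1 := Rmin_l (b - a) (d / 2)). assert (M2 := Rmin_r (b - a) (d / 2)).
  assert (0 < Rmin (b - a) (d / 2)) by (apply Rmin_glb_lt; lra).
  split; [lra|]. rewrite Rabs_left1; lra.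
Qed.

Lemma unif_cont_on {V : NormedModule R_AbsRing} (f : R -> V) a b eps :
  a <= b -> continuous_on (fun t => a <= t <= b) f -> 0 < eps ->
  exists d, 0 < d /\ forall x y, a <= x <= b -> a <= y <= b -> Rabs (x - y) < d ->
  norm (minus (f x) (f y)) < eps.
Proof.
intros Hab C He.
destruct (unifcont_normed_1d (fun x => f (clamp a b x)) a b) with (eps := mkposreal eps He)
  as [d Hd].
{ intros x _. now apply (continuous_clamp (fun t => a <= t <= b)). }
exists d. split; [apply cond_pos|]. intros x y Hx Hy Hxy.
specialize (Hd y x Hy Hx Hxy). unfold ball_norm in Hd. simpl in Hd.
now rewrite !clamp_id in Hd by assumption.
Qed.

Lemma bounded_on {V : NormedModule R_AbsRing} (f : R -> V) a b :
  a <= b -> continuous_on (fun t => a <= t <= b) f ->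
  exists B, forall t, a <= t <= b -> norm (f t) <= B.
Proof.
intros Hab C.
destruct (bounded_continuity (fun x => f (clamp a b x)) a b) as [B HB].
{ intros x _. now apply (continuous_clamp (fun t => a <= t <= b)). }
exists B. intros t Ht. specialize (HB t Ht). rewrite clamp_id in HB by assumption. lra.
Qed.

Lemma is_derive_on_of_derive {V : NormedModule R_AbsRing} (D : R -> Prop) (f : R -> V) t l :
  is_derive f t l -> is_derive_on D f t l.
Proof.
intros [_ E]. apply is_derive_on_iff. intros eps He.
destruct (E t (fun P h => h) (mkposreal eps He)) as [d Hd].
exists d. split; [apply cond_pos|]. intros s _ Hs. exact (Hd s Hs).
Qed.

Lemma derive_on_unique {V : CompleteNormedModule R_AbsRing} (D : R -> Prop) (f : R -> V) t l :
  (forall d, 0 < d -> exists s, D s /\ 0 < Rabs (s - t) < d) ->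
  is_derive_on D f t l -> derive_on D f t = l.
Proof.
intros Acc L. apply (iota_unique (V := V)); [|exact L].
intros y Ly. exact (is_derive_on_unique D f t y l Acc Ly L).
Qed.

Lemma continuous_on_ext {V : NormedModule R_AbsRing} (D : R -> Prop) (f g : R -> V) :
  (forall t, D t -> f t = g t) -> continuous_on D f -> continuous_on D g.
Proof.
intros E C. apply (proj2 (continuous_on_iff D g)). intros t Dt eps He.
destruct (proj1 (continuous_on_iff D f) C t Dt eps He) as [d [Hd Q]].
exists d. split; [exact Hd|]. intros s Ds Hs. rewrite <- !E by assumption. now apply Q.
Qed.

Lemma continuous_on_subset {V : NormedModule R_AbsRing} (D D' : R -> Prop) (f : R -> V) :
  (forall t, D' t -> D t) -> continuous_on D f -> continuous_on D' f.
Proof.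
intros E C. apply (proj2 (continuous_on_iff D' f)). intros t Dt eps He.
destruct (proj1 (continuous_on_iff D f) C t (E t Dt) eps He) as [d [Hd Q]].
exists d. split; [exact Hd|]. intros s Ds Hs. apply Q; auto.
Qed.

Lemma continuous_on_minus {V : NormedModule R_AbsRing} (D : R -> Prop) (f g : R -> V) :
  continuous_on D f -> continuous_on D g -> continuous_on D (fun t => minus (f t) (g t)).
Proof.
intros Cf Cg t Dt. eapply filterlim_comp_2; [apply (Cf t Dt)|apply (Cg t Dt)|].
unfold minus. eapply filterlim_comp_2.
- apply filterlim_fst.
- eapply filterlim_comp; [apply filterlim_snd|apply (filterlim_opp (V := V))].
- apply (filterlim_plus (V := V)).
Qed.

Lemma continuous_on_linear {U V : NormedModule R_AbsRing} (l : U -> V) (D : R -> Prop) (f : R -> U) :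
  is_linear l -> continuous_on D f -> continuous_on D (fun t => l (f t)).
Proof.
intros L C t Dt. eapply filterlim_comp; [apply (C t Dt)|]. now apply is_linear_continuous.
Qed.

Lemma continuous_on_of_continuous {V : NormedModule R_AbsRing} (D : R -> Prop) (f : R -> V) :
  (forall t, continuous f t) -> continuous_on D f.
Proof.
intros C t Dt. apply filterlim_within_ext with (f := f); [reflexivity|].
eapply filterlim_filter_le_1; [apply filter_le_within|apply C].
Qed.

Lemma ex_RInt_on {V : CompleteNormedModule R_AbsRing} (f : R -> V) a b : a <= b ->
  continuous_on (fun t => a <= t <= b) f -> ex_RInt f a b.
Proof.
intros Hab C. apply (ex_RInt_ext (V := V) (fun s => f (clamp a b s))).
- rewrite Rmin_left, Rmax_right by lra. intros s Hs. now rewrite clamp_id by lra.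
- apply (ex_RInt_cont (V := V)). intros t.
  now apply (continuous_clamp (V := V) (fun t => a <= t <= b)).
Qed.

Lemma continuous_on_inner {H : Hilbert} (f g : R -> H) a b : a <= b ->
  continuous_on (fun t => a <= t <= b) f -> continuous_on (fun t => a <= t <= b) g ->
  continuous_on (fun t => a <= t <= b) (fun t => inner (f t) (g t)).
Proof.
intros Hab Cf Cg.
apply (continuous_on_ext (V := R_NormedModule) _
  (fun t => inner (f (clamp a b t)) (g (clamp a b t)))).
- intros t Ht. now rewrite clamp_id.
- apply (continuous_on_of_continuous (V := R_NormedModule)). intros t.
  apply (cont_inner (fun t => f (clamp a b t)) (fun t => g (clamp a b t))).
  + now apply (continuous_clamp (V := H) (fun t => a <= t <= b)).
  + now apply (continuous_clamp (V := H) (fun t => a <= t <= b)).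
Qed.

Section Paths.
Context {H : Hilbert} {A : DiscreteOperator H}.

(** The regularity of mild solutions and of elements of [W].  The velocity is a
    separate function, which can be chosen, bounded and passed to the limit. *)
Definition path (D : R -> Prop) (u : R -> Dhalf A) (v : R -> H) : Prop :=
  continuous_on D u /\ continuous_on D v /\
  forall t, D t -> is_derive_on D (fun s => emb (u s)) t (v t).

Lemma path_subset (D D' : R -> Prop) u v :
  (forall t, D' t -> D t) -> path D u v -> path D' u v.
Proof.
intros E [C1 [C2 D1]]. split; [|split].
- now apply (continuous_on_subset D).
- now apply (continuous_on_subset (V := H) D).
- intros t Dt. apply is_derive_on_iff. intros eps He.
  destruct (proj1 (is_derive_on_iff _ _ _ _) (D1 t (E t Dt)) eps He) as [d [Hd Q]].
  exists d. split; [exact Hd|]. intros s Ds Hs. apply Q; auto.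
Qed.

Lemma path_ext (D : R -> Prop) (u u' : R -> Dhalf A) (v v' : R -> H) :
  (forall t, D t -> u t = u' t) -> (forall t, D t -> v t = v' t) ->
  path D u v -> path D u' v'.
Proof.
intros Eu Ev [C1 [C2 D1]]. split; [|split].
- now apply (continuous_on_ext D u).
- now apply (continuous_on_ext (V := H) D v).
- intros t Dt. apply is_derive_on_iff. intros eps He.
  destruct (proj1 (is_derive_on_iff _ _ _ _) (D1 t Dt) eps He) as [d [Hd Q]].
  exists d. split; [exact Hd|]. intros s Ds Hs.
  rewrite <- (Eu s Ds), <- (Eu t Dt), <- (Ev t Dt). now apply Q.
Qed.

Lemma path_minus (D : R -> Prop) u1 u2 v1 v2 :
  path D u1 v1 -> path D u2 v2 ->
  path D (fun t => minus (u1 t) (u2 t)) (fun t => minus (v1 t) (v2 t)).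
Proof.
intros [C1 [C2 D1]] [C1' [C2' D1']]. split; [|split].
- now apply continuous_on_minus.
- now apply (continuous_on_minus (V := H)).
- intros t Dt. unfold is_derive_on.
  apply (filterdiff_ext_lin (V := H) _ (fun s : R => minus (scal s (v1 t)) (scal s (v2 t)))).
  + apply (filterdiff_minus_fct (V := H)); [apply (D1 t Dt)|apply (D1' t Dt)].
  + intros s. module_eq H.
Qed.

Lemma path_scal (D : R -> Prop) u v (c : R) :
  path D u v -> path D (fun t => scal c (u t)) (fun t => scal c (v t)).
Proof.
assert (Lc : forall V : NormedModule R_AbsRing, is_linear (fun x : V => scal c x)).
{ intros V. apply (is_linear_scal_r (K := R_AbsRing) (V := V) c). exact Rmult_comm. }
intros [C1 [C2 D1]]. split; [|split].
- exact (continuous_on_linear _ D u (Lc (Dhalf A)) C1).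
- exact (continuous_on_linear _ D v (Lc H) C2).
- intros t Dt. unfold is_derive_on.
  apply (filterdiff_ext_lin (V := H) _ (fun s : R => scal c (scal s (v t)))).
  + apply (filterdiff_scal_r_fct (V := H) c); [exact Rmult_comm|apply (D1 t Dt)].
  + intros s. module_eq H.
Qed.

Lemma path_segment (D D' : R -> Prop) u v s :
  (forall theta, D' theta -> D (s + theta)) -> path D u v ->
  path D' (segment u s) (segment v s).
Proof.
intros E [C1 [C2 D1]]. unfold segment.
assert (Shift : forall r t : R, s + r - (s + t) = r - t) by (intros; ring).
split; [|split].
- apply (proj2 (continuous_on_iff D' _)). intros t Dt eps He.
  destruct (proj1 (continuous_on_iff D u) C1 _ (E t Dt) eps He) as [d [Hd Q]].
  exists d. split; [exact Hd|]. intros r Dr Hr. apply Q; [auto|now rewrite Shift].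
- apply (proj2 (continuous_on_iff (V := H) D' _)). intros t Dt eps He.
  destruct (proj1 (continuous_on_iff (V := H) D v) C2 _ (E t Dt) eps He) as [d [Hd Q]].
  exists d. split; [exact Hd|]. intros r Dr Hr. apply Q; [auto|now rewrite Shift].
- intros t Dt. apply is_derive_on_iff. intros eps He.
  destruct (proj1 (is_derive_on_iff _ _ _ _) (D1 _ (E t Dt)) eps He) as [d [Hd Q]].
  exists d. split; [exact Hd|]. intros r Dr Hr.
  specialize (Q (s + r) (E r Dr)). rewrite Shift in Q. now apply Q.
Qed.

Lemma path_of_primitive (D : R -> Prop) (u : R -> Dhalf A) (v : R -> H) :
  (forall t, continuous u t) -> (forall t, continuous v t) ->
  (forall t, D t -> is_RInt v 0 t (minus (emb (u t)) (emb (u 0)))) ->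
  path D u v.
Proof.
intros Cu Cv P. split; [|split].
- now apply continuous_on_of_continuous.
- now apply (continuous_on_of_continuous (V := H)).
- intros t Dt.
  assert (Q := is_derive_on_of_derive D _ _ _ (is_derive_RInt_cont (V := H) v 0 t Cv)).
  apply is_derive_on_iff. intros eps He.
  destruct (proj1 (is_derive_on_iff _ _ _ _) Q eps He) as [d [Hd B]].
  exists d. split; [exact Hd|]. intros s Ds Hs. specialize (B s Ds Hs).
  rewrite (is_RInt_unique (V := H) _ _ _ _ (P s Ds)) in B.
  rewrite (is_RInt_unique (V := H) _ _ _ _ (P t Dt)) in B.
  assert (E : minus (minus (emb (u s)) (emb (u 0))) (minus (emb (u t)) (emb (u 0)))
    = minus (emb (u s)) (emb (u t))) by module_eq H.
  one_path. rewrite E in B. exact B.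
Qed.

Lemma path_primitive u v a b :
  a <= b -> path (fun t => a <= t <= b) u v -> is_RInt v a b (minus (emb (u b)) (emb (u a))).
Proof.
intros Hab [C1 [C2 D1]].
assert (Cv : forall t, continuous (fun s => v (clamp a b s)) t)
  by (intros t; now apply (continuous_clamp (V := H) (fun t => a <= t <= b))).
assert (Cu : forall t, continuous (fun s => u (clamp a b s)) t)
  by (intros t; now apply (continuous_clamp (fun t => a <= t <= b))).
assert (K := RInt_cont (V := H) _ a b Cv).
apply (is_RInt_ext_le (V := H) (fun s => v (clamp a b s))); [exact Hab| |].
{ intros s Hs. now rewrite clamp_id. }
replace (minus (emb (u b)) (emb (u a))) with (RInt (fun s => v (clamp a b s)) a b); [exact K|].
apply (coef_inj A). intros i. rewrite coef_minus.
apply (is_RInt_linear (V := R_NormedModule) (coef A i)) in K; [|apply is_linear_inner].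
apply (is_RInt_eq (V := R_NormedModule) _ _ _ _ _ K).
replace (coef A i (emb (u b)) - coef A i (emb (u a))) with
  (coef A i (emb (u (clamp a b b))) - coef A i (emb (u (clamp a b a))))
  by (rewrite !clamp_id by lra; reflexivity).
apply (is_RInt_rderiv (fun s => coef A i (emb (u (clamp a b s))))
  (fun s => coef A i (v (clamp a b s)))).
- intros t. apply (cont_coef A i (fun s => emb (u (clamp a b s)))).
  apply (cont_linear emb (fun s => u (clamp a b s)) t); [apply is_linear_emb|apply Cu].
- intros t. apply (cont_coef A i (fun s => v (clamp a b s))). apply Cv.
- intros t Ht eps He.
  destruct (proj1 (is_derive_on_iff _ _ _ _) (D1 t ltac:(lra)) eps He) as [d [Hd Q]].
  exists (Rmin d (b - t)). split; [apply Rmin_glb_lt; lra|]. intros s Hs.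
  assert (M1 := Rmin_l d (b - t)). assert (M2 := Rmin_r d (b - t)).
  rewrite !clamp_id by lra.
  assert (Ps : Rabs (s - t) = s - t) by (apply Rabs_pos_eq; lra).
  specialize (Q s ltac:(lra)). rewrite Ps in Q. specialize (Q ltac:(lra)).
  replace (coef A i (emb (u s)) - coef A i (emb (u t)) - (s - t) * coef A i (v t)) with
    (coef A i (minus (minus (emb (u s)) (emb (u t))) (scal (s - t) (v t)))).
  + eapply Rle_trans; [apply coef_le|]. one_path. exact Q.
  + now rewrite !coef_minus, coef_scal.
- exact Hab.
Qed.

Context (h : R) (h_pos : 0 < h).

Lemma path_derive_on phi psi theta :
  path (delay_interval h) phi psi -> delay_interval h theta ->
  derive_on (delay_interval h) (fun s => emb (phi s)) theta = psi theta.
Proof.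
intros [_ [_ D1]] Dt. apply (derive_on_unique (V := H)); [|now apply D1].
intros d Hd. apply interval_limit_point; [lra|exact Dt|exact Hd].
Qed.

Lemma path_of_in_W phi : in_W h phi ->
  path (delay_interval h) phi (derive_on (delay_interval h) (fun s => emb (phi s))).
Proof. intros [C [D1 C1]]. split; [exact C|split; [exact C1|exact D1]]. Qed.

Lemma in_W_of_path phi psi : path (delay_interval h) phi psi -> in_W h phi.
Proof.
intros P. destruct P as [C1 [C2 D1]] eqn:EP. split; [exact C1|]. split.
- intros t Dt. rewrite (path_derive_on phi psi t P Dt). now apply D1.
- apply (continuous_on_ext (V := H) _ psi); [|exact C2].
  intros t Dt. symmetry; now apply path_derive_on.
Qed.

Section Wnorm_bounds.
Context (phi : R -> Dhalf A) (psi : R -> H) (P : path (delay_interval h) phi psi).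

Lemma Wnorm_path : Wnorm h phi =
  max_on (- h) 0 (fun t => norm (phi t)) + max_on (- h) 0 (fun t => norm (psi t)).
Proof.
unfold Wnorm. f_equal. apply max_on_ext. intros t Ht.
now rewrite (path_derive_on phi psi t P Ht).
Qed.

Lemma Wnorm_ge t t' : delay_interval h t -> delay_interval h t' ->
  norm (phi t) + norm (psi t') <= Wnorm h phi.
Proof.
intros Dt Dt'. rewrite Wnorm_path. destruct P as [C1 [C2 _]].
destruct (bounded_on phi (- h) 0 ltac:(lra) C1) as [B1 H1].
destruct (bounded_on (V := H) psi (- h) 0 ltac:(lra) C2) as [B2 H2].
apply Rplus_le_compat.
- apply (max_on_ge (- h) 0 ltac:(lra) (fun t => norm (phi t)) B1 t H1 Dt).
- apply (max_on_ge (- h) 0 ltac:(lra) (fun t => norm (psi t)) B2 t' H2 Dt').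
Qed.

(** The suprema are taken over independent times, so that the norm of [W] is the
    least bound of these sums. *)
Lemma Wnorm_le m :
  (forall t t', delay_interval h t -> delay_interval h t' -> norm (phi t) + norm (psi t') <= m) ->
  Wnorm h phi <= m.
Proof.
intros B. rewrite Wnorm_path.
assert (Q : max_on (- h) 0 (fun t => norm (psi t))
  <= m - max_on (- h) 0 (fun t => norm (phi t))); [|lra].
apply max_on_le; [lra|]. intros t' Dt'.
assert (Q : max_on (- h) 0 (fun t => norm (phi t)) <= m - norm (psi t')); [|lra].
apply max_on_le; [lra|]. intros t Dt. specialize (B t t' Dt Dt'). lra.
Qed.

Lemma Wnorm_ge_0 : 0 <= Wnorm h phi.
Proof.
assert (D0 : delay_interval h 0) by (unfold delay_interval; lra).
assert (Q := Wnorm_ge 0 0 D0 D0). assert (P1 := norm_ge_0 (phi 0)).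
assert (P2 := norm_ge_0 (psi 0)). lra.
Qed.

End Wnorm_bounds.

Section Wdist_bounds.
Context (phi1 phi2 : R -> Dhalf A) (psi1 psi2 : R -> H)
  (P1 : path (delay_interval h) phi1 psi1) (P2 : path (delay_interval h) phi2 psi2).

Lemma Wdist_ge t t' : delay_interval h t -> delay_interval h t' ->
  norm (minus (phi1 t) (phi2 t)) + norm (minus (psi1 t') (psi2 t')) <= Wdist h phi1 phi2.
Proof. exact (Wnorm_ge _ _ (path_minus _ _ _ _ _ P1 P2) t t'). Qed.

Lemma Wdist_le m :
  (forall t t', delay_interval h t -> delay_interval h t' ->
    norm (minus (phi1 t) (phi2 t)) + norm (minus (psi1 t') (psi2 t')) <= m) ->
  Wdist h phi1 phi2 <= m.
Proof. exact (Wnorm_le _ _ (path_minus _ _ _ _ _ P1 P2) m). Qed.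

Lemma Wdist_ge_0 : 0 <= Wdist h phi1 phi2.
Proof. exact (Wnorm_ge_0 _ _ (path_minus _ _ _ _ _ P1 P2)). Qed.

Lemma Wnorm_triangle : Wnorm h phi1 <= Wdist h phi1 phi2 + Wnorm h phi2.
Proof.
apply (Wnorm_le _ _ P1). intros t t' Dt Dt'.
assert (Q1 := Wdist_ge t t' Dt Dt'). assert (Q2 := Wnorm_ge _ _ P2 t t' Dt Dt').
assert (T1 := norm_plus_minus (phi1 t) (phi2 t)).
assert (T2 := norm_plus_minus (V := H) (psi1 t') (psi2 t')). one_path. lra.
Qed.

End Wdist_bounds.

(** The position and the velocity are uniformly continuous on [[- h, T]]. *)
Lemma segment_modulus T u v eps : 0 <= T -> path (fun t => - h <= t <= T) u v -> 0 < eps ->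
  exists d, 0 < d /\ forall s t, 0 <= s <= T -> 0 <= t <= T -> Rabs (s - t) < d ->
  Wdist h (segment u s) (segment u t) <= eps.
Proof.
intros HT P He. assert (P' := P). destruct P' as [C1 [C2 _]].
destruct (unif_cont_on u (- h) T (eps / 2) ltac:(lra) C1 ltac:(lra)) as [d1 [Hd1 Q1]].
destruct (unif_cont_on (V := H) v (- h) T (eps / 2) ltac:(lra) C2 ltac:(lra)) as [d2 [Hd2 Q2]].
exists (Rmin d1 d2). split; [now apply Rmin_glb_lt|]. intros s t Hs Ht Hst.
assert (S1 := Rlt_le_trans _ _ _ Hst (Rmin_l _ _)).
assert (S2 := Rlt_le_trans _ _ _ Hst (Rmin_r _ _)).
assert (W : forall r, 0 <= r <= T -> path (delay_interval h) (segment u r) (segment v r)).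
{ intros r Hr. apply (path_segment (fun t => - h <= t <= T)); [|exact P].
  unfold delay_interval. intros theta Hth. lra. }
apply (Wdist_le _ _ _ _ (W s Hs) (W t Ht)). unfold segment, delay_interval. intros x y Hx Hy.
assert (K1 := Q1 (s + x) (t + x) ltac:(lra) ltac:(lra)).
assert (K2 := Q2 (s + y) (t + y) ltac:(lra) ltac:(lra)).
replace (s + x - (t + x)) with (s - t) in K1 by ring.
replace (s + y - (t + y)) with (s - t) in K2 by ring.
specialize (K1 S1). specialize (K2 S2). one_path. lra.
Qed.

Lemma segment_bound T u v : 0 <= T -> path (fun t => - h <= t <= T) u v ->
  exists B, 0 < B /\ forall s, 0 <= s <= T -> Wnorm h (segment u s) <= B.
Proof.
intros HT P. assert (P' := P). destruct P' as [C1 [C2 _]].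
destruct (bounded_on u (- h) T ltac:(lra) C1) as [B1 H1].
destruct (bounded_on (V := H) v (- h) T ltac:(lra) C2) as [B2 H2].
exists (Rmax 1 (B1 + B2)). split; [eapply Rlt_le_trans; [apply Rlt_0_1|apply Rmax_l]|].
intros s Hs. apply Rle_trans with (B1 + B2); [|apply Rmax_r].
apply (Wnorm_le (segment u s) (segment v s)).
- apply (path_segment (fun t => - h <= t <= T)); [|exact P].
  unfold delay_interval. intros theta Hth. lra.
- unfold segment, delay_interval. intros x y Hx Hy.
  specialize (H1 (s + x) ltac:(lra)). specialize (H2 (s + y) ltac:(lra)). one_path. lra.
Qed.

End Paths.

(** * Mild solutions with a given forcing *)

Section Forced.
Context {H : Hilbert} (A : DiscreteOperator H) (h k : R) (S : R -> Yspace A -> Yspace A)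
  (h_pos : 0 < h) (k_ge_0 : 0 <= k) (S_wave : wave_semigroup A k S).

Definition impulse (x : H) : Yspace A := (zero, x).

Lemma is_linear_impulse : is_linear (U := H) (V := Yspace A) impulse.
Proof.
apply Build_is_linear.
- intros x y. unfold impulse. change (plus (zero, x) (zero, y) : Yspace A) with
    ((plus zero zero : Dhalf A), plus x y). f_equal. module_eq (Dhalf A).
- intros c x. unfold impulse. change (scal c ((zero, x) : Yspace A)) with
    ((scal c zero : Dhalf A), scal c x). f_equal. module_eq (Dhalf A).
- exists 1. split; [lra|]. intros x. rewrite Rmult_1_l.
  eapply Rle_trans; [apply norm_pair_le|]. unfold impulse; simpl fst; simpl snd.
  rewrite norm_zero. one_path. lra.
Qed.

Lemma norm_impulse x : norm (impulse x) = norm x.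
Proof.
apply Rle_antisym.
- eapply Rle_trans; [apply norm_pair_le|]. unfold impulse; simpl fst; simpl snd.
  rewrite norm_zero. one_path. lra.
- exact (norm_snd_le A (impulse x)).
Qed.

Lemma impulse_cont (g : R -> H) t : continuous g t -> continuous (fun s => impulse (g s)) t.
Proof. apply (cont_linear (V := H) (W := Yspace A)), is_linear_impulse. Qed.

Lemma pair_cont (u : R -> Dhalf A) (v : R -> H) t :
  continuous u t -> continuous v t -> continuous (fun s => (u s, v s) : Yspace A) t.
Proof.
intros C1 C2. apply (continuous_iff (V := Yspace A)). intros eps He.
destruct (near_and t _ _ (continuous_near u t (eps / 2) C1 ltac:(lra))
  (continuous_near v t (eps / 2) C2 ltac:(lra))) as [d [Hd Q]].
exists d. split; [exact Hd|]. intros s Hs. destruct (Q s Hs) as [Q1 Q2].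
eapply Rle_lt_trans; [apply norm_pair_le|].
change (norm (minus (u s) (u t)) + norm (minus (v s) (v t)) < eps). one_path. lra.
Qed.

Definition duhamel (T : R) (z : R -> Yspace A) (g : R -> H) : Prop :=
  forall t, 0 <= t <= T -> exists I : Yspace A,
  is_RInt (fun s => S (t - s) (impulse (g s))) 0 t I /\ z t = plus (S t (z 0)) I.

(** The contraction property gives the continuity of Duhamel's integrand, and the
    right derivatives of the modes follow. *)
Lemma duhamel_modes T z g : (forall t, continuous g t) -> duhamel T z g ->
  solves_modes A k T z g.
Proof.
intros Cg Du i t Ht.
assert (R := mild_rderiv (Y := Ycomplete A) S (proj1 S_wave)
  (wave_contraction A k S S_wave k_ge_0) (fun s => impulse (g s))
  (fun s => impulse_cont g s (Cg s)) T z Du).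
assert (E1 : pos_mode A i (impulse (g t)) = 0) by exact (inner_zero_l _).
assert (E2 : vel_mode A i (impulse (g t)) = coef A i (g t)) by reflexivity.
split.
- rewrite <- (Rplus_0_r (vel_mode A i (z t))), <- E1.
  apply R; [apply is_linear_pos_mode|exact Ht|]. intros x.
  assert (W := proj1 (wave_rderiv A k S S_wave x 0 i (Rle_refl 0))).
  now rewrite (semigroup_0 S (proj1 S_wave)) in W.
- rewrite <- E2.
  apply (R (vel_mode A i) (fun y => - eigval A i * pos_mode A i y - k * vel_mode A i y));
    [apply is_linear_vel_mode|exact Ht|]. intros x.
  assert (W := proj2 (wave_rderiv A k S S_wave x 0 i (Rle_refl 0))).
  now rewrite (semigroup_0 S (proj1 S_wave)) in W.
Qed.

Definition solution_on (T : R) (u : R -> Dhalf A) (v g : R -> H) : Prop :=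
  path (fun t => - h <= t <= T) u v /\
  continuous_on (fun t => 0 <= t <= T) g /\
  duhamel T (fun t => (u t, v t)) g.

Lemma solution_restrict T T' u v g : 0 <= T' <= T ->
  solution_on T u v g -> solution_on T' u v g.
Proof.
intros HT [P [Cg D]]. split; [|split].
- apply (path_subset (fun t => - h <= t <= T)); [intros; lra|exact P].
- apply (continuous_on_subset (V := H) (fun t => 0 <= t <= T)); [intros; lra|exact Cg].
- intros t Ht. apply D. lra.
Qed.

Lemma duhamel_ext T z z' g g' :
  (forall t, 0 <= t <= T -> z t = z' t) -> (forall t, 0 <= t <= T -> g t = g' t) ->
  duhamel T z g -> duhamel T z' g'.
Proof.
intros Ez Eg D t Ht. destruct (D t Ht) as [I [HI E]]. exists I. split.
- apply (is_RInt_ext_le (V := Yspace A) (fun s => S (t - s) (impulse (g s)))); [lra| |exact HI].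
  intros s Hs. rewrite Eg; [reflexivity|lra].
- rewrite <- !Ez by lra. exact E.
Qed.

Lemma solution_forcing_ext T u v g g' :
  (forall t, 0 <= t <= T -> g t = g' t) -> solution_on T u v g -> solution_on T u v g'.
Proof.
intros E [P [Cg D]]. split; [exact P|split].
- now apply (continuous_on_ext (V := H) _ g).
- now apply (duhamel_ext T (fun t => (u t, v t)) (fun t => (u t, v t)) g g').
Qed.

Lemma solution_minus T u1 v1 g1 u2 v2 g2 :
  solution_on T u1 v1 g1 -> solution_on T u2 v2 g2 ->
  solution_on T (fun t => minus (u1 t) (u2 t)) (fun t => minus (v1 t) (v2 t))
    (fun t => minus (g1 t) (g2 t)).
Proof.
intros [P1 [C1 D1]] [P2 [C2 D2]]. split; [|split].
- now apply path_minus.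
- now apply (continuous_on_minus (V := H)).
- intros t Ht. destruct (D1 t Ht) as [I1 [H1 E1]]. destruct (D2 t Ht) as [I2 [H2 E2]].
  exists (minus I1 I2). split.
  + apply (is_RInt_ext_le (V := Yspace A)
      (fun s => minus (S (t - s) (impulse (g1 s))) (S (t - s) (impulse (g2 s))))); [lra| |].
    * intros s Hs. 
      rewrite <- (is_linear_minus (S (t - s))) by (apply (semigroup_linear S (proj1 S_wave)); lra).
      f_equal. symmetry. exact (is_linear_minus impulse (g1 s) (g2 s) is_linear_impulse).
    * apply (is_RInt_minus (V := Yspace A)); assumption.
  + change ((minus (u1 t) (u2 t), minus (v1 t) (v2 t)) : Yspace A) with
      (minus ((u1 t, v1 t) : Yspace A) (u2 t, v2 t)).
    change ((minus (u1 0) (u2 0), minus (v1 0) (v2 0)) : Yspace A) with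
      (minus ((u1 0, v1 0) : Yspace A) (u2 0, v2 0)).
    rewrite (is_linear_minus (S t)) by (apply (semigroup_linear S (proj1 S_wave)); lra).
    transitivity (minus (plus (S t (u1 0, v1 0)) I1) (plus (S t (u2 0, v2 0)) I2) : Yspace A).
    * f_equal; [exact E1|f_equal; exact E2].
    * module_eq (Yspace A).
Qed.

(** Frozen outside of [[0, T]], a solution becomes continuous on the line, without
    any change of its modes before [T]. *)
Lemma solution_extend T u v g : 0 <= T -> solution_on T u v g ->
  exists (z : R -> Yspace A) (g' : R -> H),
  (forall t, continuous z t) /\ (forall t, continuous g' t) /\
  (forall t, 0 <= t <= T -> z t = (u t, v t)) /\
  (forall t, 0 <= t <= T -> g' t = g t) /\
  solves_modes A k T z g'.
Proof.
intros HT [[Cu [Cv _]] [Cg D]].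
set (z := fun t => (u (clamp 0 T t), v (clamp 0 T t)) : Yspace A).
set (g' := fun t => g (clamp 0 T t)).
assert (Cg' : forall t, continuous g' t)
  by (intros t; now apply (continuous_clamp (V := H) (fun t => 0 <= t <= T))).
assert (Ez : forall t, 0 <= t <= T -> z t = (u t, v t))
  by (intros t Ht; unfold z; now rewrite clamp_id).
assert (Eg : forall t, 0 <= t <= T -> g' t = g t)
  by (intros t Ht; unfold g'; now rewrite clamp_id).
exists z, g'. split; [|split; [exact Cg'|split; [exact Ez|split; [exact Eg|]]]].
- intros t. apply pair_cont.
  + apply (continuous_clamp (fun t => - h <= t <= T)); [exact HT|intros; lra|exact Cu].
  + apply (continuous_clamp (V := H) (fun t => - h <= t <= T)); [exact HT|intros; lra|exact Cv].
- apply duhamel_modes; [exact Cg'|].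
  apply (duhamel_ext T (fun t => (u t, v t)) _ g); [| |exact D].
  + intros t Ht. symmetry; now apply Ez.
  + intros t Ht. symmetry; now apply Eg.
Qed.

Lemma solution_linear_energy T u v g : 0 <= T -> solution_on T u v g ->
  is_RInt (fun s => - 2 * k * norm (v s) ^ 2 + 2 * inner (g s) (v s)) 0 T
    ((norm (u T) ^ 2 + norm (v T) ^ 2) - (norm (u 0) ^ 2 + norm (v 0) ^ 2)).
Proof.
intros HT Sol.
destruct (solution_extend T u v g HT Sol) as [z [g' [Cz [Cg' [Ez [Eg Mo]]]]]].
assert (Q := linear_energy A k T HT z g' Cz Cg' Mo).
rewrite !norm_pair_sq, (Ez T), (Ez 0) in Q by lra.
revert Q. apply (is_RInt_ext_le (V := R_NormedModule)); [exact HT|].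
intros s Hs. now rewrite Ez, Eg.
Qed.

Lemma solution_nonlinear_energy (Pi : Dhalf A -> R) (dPi : Dhalf A -> Dhalf A -> R)
  (F Fstar : Dhalf A -> H) (m : R -> H) T u v g :
  (forall u : Dhalf A, filterdiff Pi (locally u) (dPi u)) ->
  locally_lipschitz A F -> locally_lipschitz A Fstar ->
  (forall u v : Dhalf A, inner (F u) (emb v) = dPi u v + inner (Fstar u) (emb v)) ->
  0 <= T -> solution_on T u v g ->
  (forall s, 0 <= s <= T -> g s = minus (opp (F (u s))) (m s)) ->
  is_RInt (fun s => - k * norm (v s) ^ 2 - inner (Fstar (u s)) (v s) - inner (m s) (v s)) 0 T
   ((/ 2 * (norm (u T) ^ 2 + norm (v T) ^ 2) + Pi (u T))
    - (/ 2 * (norm (u 0) ^ 2 + norm (v 0) ^ 2) + Pi (u 0))).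
Proof.
intros DPi LF LFs Split HT Sol Em.
destruct (solution_extend T u v g HT Sol) as [z [g' [Cz [Cg' [Ez [Eg Mo]]]]]].
assert (Q := nonlinear_energy A k T HT z g' Cz Cg' Mo Pi dPi F Fstar m DPi LF LFs Split).
rewrite !norm_pair_sq, (Ez T), (Ez 0) in Q by lra.
assert (Em' : forall s, 0 <= s <= T -> g' s = minus (opp (F (fst (z s)))) (m s)).
{ intros s Hs. rewrite Eg, Ez by exact Hs. simpl. now apply Em. }
specialize (Q Em'). revert Q. apply (is_RInt_ext_le (V := R_NormedModule)); [exact HT|].
intros s Hs. now rewrite Ez.
Qed.

Lemma solution_norm_cont T u v g : 0 <= T -> solution_on T u v g ->
  exists y : R -> R, (forall t, continuous y t) /\
  forall t, 0 <= t <= T -> y t = norm ((u t, v t) : Yspace A).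
Proof.
intros HT Sol.
destruct (solution_extend T u v g HT Sol) as [z [g' [Cz [Cg' [Ez [Eg Mo]]]]]].
exists (fun t => norm (z t)). split.
- intros t. apply (continuous_comp z (fun x : Yspace A => norm x)); [apply Cz|].
  apply (filterlim_norm (z t)).
- intros t Ht. now rewrite Ez.
Qed.

End Forced.

(** * Global solutions for a globally Lipschitz right-hand side *)

Section Picard.
Context {H : Hilbert} {A : DiscreteOperator H} (h k : R)
  (S : R -> Yspace A -> Yspace A)
  (h_pos : 0 < h) (k_ge_0 : 0 <= k) (S_wave : wave_semigroup A k S)
  (G : R -> (R -> Dhalf A) -> H)
  (G_lip : forall T, 0 <= T -> exists L, 0 <= L /\ forall t phi1 phi2, 0 <= t <= T ->
     in_W h phi1 -> in_W h phi2 ->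
     norm (minus (G t phi1) (G t phi2)) <= L * Wdist h phi1 phi2)
  (G_cont : forall u v, path (fun t => - h <= t) u v ->
     continuous_on (fun t => 0 <= t) (fun t => G t (segment u t)))
  (phi : R -> Dhalf A) (psi : R -> H) (phi_path : path (delay_interval h) phi psi).

Let Contr := wave_contraction A k S S_wave k_ge_0.

Definition history (t : R) : Yspace A := (phi (clamp (- h) 0 t), psi (clamp (- h) 0 t)).

Definition duhamel_sum (g : R -> H) (t : R) : Yspace A :=
  plus (S t (history 0))
    (RInt (V := Ycomplete A) (fun s => S (t - s) (impulse A (g s))) 0 t).

(** This is [history] before [0] and [duhamel_sum] after; the two terms that cancel
    make the continuity at [0] visible. *)
Definition picard (g : R -> H) (t : R) : Yspace A :=
  plus (history t) (minus (duhamel_sum g (Rmax 0 t)) (history 0)).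

Lemma duhamel_sum_0 g : duhamel_sum g 0 = history 0.
Proof.
unfold duhamel_sum. rewrite (semigroup_0 S (proj1 S_wave)).
assert (E := RInt_point (V := Ycomplete A) 0 (fun s => S (0 - s) (impulse A (g s)))).
transitivity (plus (history 0) (zero : Yspace A)); [f_equal; exact E|module_eq (Yspace A)].
Qed.

Lemma history_pos t : 0 <= t -> history t = history 0.
Proof.
intros Ht. unfold history. replace (clamp (- h) 0 t) with (clamp (- h) 0 0); [reflexivity|].
unfold clamp. rewrite !Rmin_left by lra. reflexivity.
Qed.

Lemma picard_neg g t : t <= 0 -> picard g t = history t.
Proof.
intros Ht. unfold picard. rewrite Rmax_left, duhamel_sum_0 by exact Ht. module_eq (Yspace A).
Qed.

Lemma picard_pos g t : 0 <= t -> picard g t = duhamel_sum g t.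
Proof.
intros Ht. unfold picard. rewrite Rmax_right, history_pos by exact Ht. module_eq (Yspace A).
Qed.

Lemma duhamel_sum_correct g t : (forall t, continuous g t) -> 0 <= t ->
  is_RInt (fun s => S (t - s) (impulse A (g s))) 0 t (minus (duhamel_sum g t) (S t (history 0))).
Proof.
intros Cg Ht.
assert (E := duhamel_ex (Y := Ycomplete A) S (proj1 S_wave) Contr (fun s => impulse A (g s))
  (fun s => impulse_cont A g s (Cg s)) t 0 t ltac:(lra) ltac:(lra)).
apply (RInt_correct (V := Ycomplete A)) in E.
replace (minus (duhamel_sum g t) (S t (history 0))) with
  (RInt (V := Ycomplete A) (fun s => S (t - s) (impulse A (g s))) 0 t : Yspace A); [exact E|].
unfold duhamel_sum. module_eq (Yspace A).
Qed.

Lemma picard_duhamel g T : (forall t, continuous g t) -> duhamel A S T (picard g) g.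
Proof.
intros Cg t Ht. eexists. split; [apply duhamel_sum_correct; [exact Cg|lra]|].
rewrite picard_pos, picard_pos, duhamel_sum_0 by lra. module_eq (Yspace A).
Qed.

Lemma history_cont t : continuous history t.
Proof.
apply (pair_cont A).
- apply (continuous_clamp (delay_interval h)); [lra|auto|apply phi_path].
- apply (continuous_clamp (V := H) (delay_interval h)); [lra|auto|apply phi_path].
Qed.

Lemma picard_cont g : (forall t, continuous g t) -> forall t, continuous (picard g) t.
Proof.
intros Cg t. apply (continuous_plus (V := Yspace A)); [apply history_cont|].
apply (continuous_minus (V := Yspace A)); [|apply (continuous_const (V := Yspace A))].
apply (continuous_iff (V := Yspace A)). intros eps He.
set (t' := Rmax 0 t). assert (Pt : 0 <= t') by apply Rmax_l.
destruct (mild_cont (Y := Ycomplete A) S (proj1 S_wave) Contr (fun s => impulse A (g s))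
  (fun s => impulse_cont A g s (Cg s)) (t' + 1) (duhamel_sum g)) with (t := t') (eps := eps)
  as [d [Hd Q]]; [|lra|exact He|].
{ intros s Hs. eexists. split; [apply duhamel_sum_correct; [exact Cg|lra]|].
  rewrite duhamel_sum_0. module_eq (Yspace A). }
exists (Rmin d 1). split; [apply Rmin_glb_lt; lra|]. intros s Hs.
assert (S1 := Rlt_le_trans _ _ _ Hs (Rmin_l _ _)).
assert (S2 := Rlt_le_trans _ _ _ Hs (Rmin_r _ _)).
assert (Q1 : Rabs (Rmax 0 s - t') <= Rabs (s - t)) by apply Rmax_0_lipschitz.
apply Q; [|lra]. split; [apply Rmax_l|].
assert (Q2 := Rle_abs (Rmax 0 s - t')). lra.
Qed.

(** The class in which the iteration takes place.  That the second component is the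
    derivative of the first one is stated with an integral, because this passes
    to uniform limits. *)
Definition admissible (z : R -> Yspace A) : Prop :=
  (forall t, continuous z t) /\ (forall t, t <= 0 -> z t = history t) /\
  (forall t, 0 <= t ->
     is_RInt (fun s => snd (z s)) 0 t (minus (emb (fst (z t))) (emb (fst (z 0))))).

Lemma picard_admissible g : (forall t, continuous g t) -> admissible (picard g).
Proof.
intros Cg. split; [now apply picard_cont|split; [intros; now apply picard_neg|]].
intros t Ht.
apply (modes_primitive A k t Ht (picard g) g (picard_cont g Cg)).
apply (duhamel_modes A k S k_ge_0 S_wave t (picard g) g Cg). now apply picard_duhamel.
Qed.

Lemma admissible_path z : admissible z ->
  path (fun t => - h <= t) (fun t => fst (z t)) (fun t => snd (z t)).
Proof.
intros [Cz [Hz Pz]].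
apply path_of_primitive; [apply (cont_fst A z Cz)|apply (cont_snd A z Cz)|].
intros t Ht. destruct (Rle_lt_dec 0 t) as [L|L]; [now apply Pz|].
assert (Ez : forall s, t <= s <= 0 -> z s = (phi s, psi s)).
{ intros s Hs. rewrite Hz by lra. unfold history. now rewrite clamp_id by lra. }
assert (Q : is_RInt psi t 0 (minus (emb (phi 0)) (emb (phi t)))).
{ apply path_primitive; [lra|].
  apply (path_subset (delay_interval h)); [|exact phi_path].
  unfold delay_interval. intros; lra. }
apply (is_RInt_swap (V := H)) in Q.
rewrite (Ez t), (Ez 0) by lra. simpl.
replace (minus (emb (phi t)) (emb (phi 0))) with (opp (minus (emb (phi 0)) (emb (phi t))))
  by module_eq H.
apply (is_RInt_ext psi); [|exact Q].
rewrite Rmin_right, Rmax_left by lra. intros s Hs. now rewrite Ez by lra.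
Qed.

Definition forcing (z : R -> Yspace A) (t : R) : H :=
  G (Rmax 0 t) (segment (fun s => fst (z s)) (Rmax 0 t)).

Lemma forcing_cont z : admissible z -> forall t, continuous (forcing z) t.
Proof.
intros Az t. apply (continuous_iff (V := H)). intros eps He.
destruct (proj1 (continuous_on_iff (V := H) _ _) (G_cont _ _ (admissible_path z Az))
  (Rmax 0 t) (Rmax_l _ _) eps He) as [d [Hd Q]].
exists d. split; [exact Hd|]. intros s Hs. apply Q; [apply Rmax_l|].
eapply Rle_lt_trans; [apply Rmax_0_lipschitz|exact Hs].
Qed.

Lemma admissible_segment z t : admissible z -> 0 <= t ->
  path (delay_interval h) (segment (fun s => fst (z s)) t) (segment (fun s => snd (z s)) t).
Proof.
intros Az Ht. apply (path_segment (fun t => - h <= t)); [|now apply admissible_path].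
unfold delay_interval. intros; lra.
Qed.

Lemma forcing_close T L z z' t m : admissible z -> admissible z' ->
  0 <= L ->
  (forall t phi1 phi2, 0 <= t <= T -> in_W h phi1 -> in_W h phi2 ->
     norm (minus (G t phi1) (G t phi2)) <= L * Wdist h phi1 phi2) ->
  0 <= t <= T -> (forall s, 0 <= s <= t -> norm (minus (z s) (z' s)) <= m) ->
  norm (minus (forcing z t) (forcing z' t)) <= L * (2 * m).
Proof.
intros Az Az' PL BL Ht B. unfold forcing. rewrite Rmax_right by lra.
assert (P := admissible_segment z t Az ltac:(lra)).
assert (P' := admissible_segment z' t Az' ltac:(lra)).
eapply Rle_trans; [apply BL; [exact Ht| |]|].
- exact (in_W_of_path h h_pos _ _ P).
- exact (in_W_of_path h h_pos _ _ P').
- apply Rmult_le_compat_l; [exact PL|].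
  assert (B' : forall s, s <= t -> norm (minus (z s) (z' s)) <= m).
  { intros s Hs. destruct (Rle_lt_dec 0 s) as [K|K]; [apply B; lra|].
    rewrite (proj1 (proj2 Az)), (proj1 (proj2 Az')), norm_minus_self by lra.
    apply Rle_trans with (norm (minus (z 0) (z' 0))); [apply norm_ge_0|apply B; lra]. }
  apply (Wdist_le h h_pos _ _ _ _ P P'). unfold segment, delay_interval. intros x y Hx Hy.
  assert (B1 := Rle_trans _ _ _ (norm_fst_le A (minus (z (t + x)) (z' (t + x)))) (B' (t + x) ltac:(lra))).
  assert (B2 := Rle_trans _ _ _ (norm_snd_le A (minus (z (t + y)) (z' (t + y)))) (B' (t + y) ltac:(lra))).
  change (norm (minus (fst (z (t + x))) (fst (z' (t + x)))) <= m) in B1.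
  change (norm (minus (snd (z (t + y))) (snd (z' (t + y)))) <= m) in B2.
  one_path. lra.
Qed.

Lemma impulse_close (g g' : R -> H) (s t : R) : s <= t ->
  norm (minus (S (t - s) (impulse A (g s))) (S (t - s) (impulse A (g' s))))
  <= norm (minus (g s) (g' s)).
Proof.
intros Hs.
eapply Rle_trans; [apply (contraction_minus (Y := Ycomplete A) S (proj1 S_wave) Contr); lra|].
rewrite <- (norm_impulse A (minus (g s) (g' s))). right. f_equal.
symmetry. exact (is_linear_minus (impulse A) (g s) (g' s) (is_linear_impulse A)).
Qed.

Lemma picard_close (g g' : R -> H) (c l t : R) :
  (forall t, continuous g t) -> (forall t, continuous g' t) -> 0 <= t -> l <> 0 ->
  (forall s, 0 <= s <= t -> norm (minus (g s) (g' s)) <= c * exp (l * s)) ->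
  norm (minus (picard g t) (picard g' t)) <= c / l * (exp (l * t) - 1).
Proof.
intros Cg Cg' Ht Hl B. rewrite !picard_pos by exact Ht.
assert (J := duhamel_sum_correct g t Cg Ht). assert (J' := duhamel_sum_correct g' t Cg' Ht).
assert (D := is_RInt_minus (V := Yspace A) _ _ _ _ _ _ J J').
assert (E : minus (duhamel_sum g t) (duhamel_sum g' t) =
  minus (minus (duhamel_sum g t) (S t (history 0)))
    (minus (duhamel_sum g' t) (S t (history 0)))) by module_eq (Yspace A).
rewrite E.
apply (norm_RInt_le (V := Yspace A) _ (fun s => c * exp (l * s)) 0 t _ _ Ht) with (2 := D).
- intros s Hs. eapply Rle_trans; [apply impulse_close; lra|]. now apply B.
- now apply is_RInt_exp.
Qed.

Fixpoint iterate (n : nat) : R -> Yspace A :=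
  match n with
  | O => picard (fun _ => zero)
  | Datatypes.S m => picard (forcing (iterate m))
  end.

Lemma iterate_admissible n : admissible (iterate n).
Proof.
induction n as [|n IH]; apply picard_admissible.
- intros t. apply (continuous_const (V := H)).
- now apply forcing_cont.
Qed.

(** For the norm weighted by [exp (- l t)], with [l] large with respect to the
    Lipschitz constant on [[0, T]], the iteration contracts by [1/2]. *)
Lemma iterate_cauchy T : 0 <= T -> exists C, 0 <= C /\ forall n m, (n <= m)%nat ->
  forall t, t <= T -> norm (minus (iterate m t) (iterate n t)) <= C * (/ 2) ^ n.
Proof.
intros HT. destruct (G_lip T HT) as [L [PL BL]].
(* a bound [m] on the states is a bound [2 * m] on the segments, which gives the
   factor [2 * L / l] *)
set (l := 4 * L + 1).
destruct (bounded_continuity (V := Yspace A) (fun t => minus (iterate 1 t) (iterate 0 t)) 0 T)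
  as [B HB].
{ intros t _. apply (continuous_minus (V := Yspace A)); apply iterate_admissible. }
assert (PB : 0 < B).
{ apply Rle_lt_trans with (norm (minus (iterate 1 0) (iterate 0 0))).
  - apply norm_ge_0.
  - apply HB. lra. }
assert (Step : forall n t, 0 <= t <= T ->
  norm (minus (iterate (Datatypes.S n) t) (iterate n t)) <= B * (/ 2) ^ n * exp (l * t)).
{ induction n as [|n IH]; intros t Ht.
  - rewrite pow_O, Rmult_1_r. left. eapply Rlt_le_trans; [now apply HB|].
    rewrite <- (Rmult_1_r B) at 1. apply Rmult_le_compat_l; [lra|].
    apply exp_ge_1; unfold l; lra.
  - set (c := B * (/ 2) ^ n).
    assert (Pc : 0 <= c) by (apply Rmult_le_pos; [lra|apply pow_le; lra]).
    change (norm (minus (picard (forcing (iterate (Datatypes.S n))) t) (picard (forcing (iterate n)) t))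
      <= B * (/ 2) ^ Datatypes.S n * exp (l * t)).
    eapply Rle_trans.
    + apply (picard_close _ _ (2 * L * c) l); try (apply forcing_cont, iterate_admissible); [lra|unfold l; lra|].
      intros s Hs.
      replace (2 * L * c * exp (l * s)) with (L * (2 * (c * exp (l * s)))) by ring.
      apply (forcing_close T); auto using iterate_admissible; [lra|].
      intros r Hr. eapply Rle_trans; [apply IH; lra|].
      apply Rmult_le_compat_l; [exact Pc|]. apply exp_mono; unfold l; lra.
    + assert (P := exp_ge_1 l t ltac:(unfold l; lra) ltac:(lra)).
      apply Rle_trans with (2 * L * c / l * exp (l * t)).
      * apply Rmult_le_compat_l; [|lra]. apply Rdiv_le_0_compat; [|unfold l; lra].
        apply Rmult_le_pos; lra.
      * apply Rmult_le_compat_r; [lra|]. simpl pow. 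
        replace (B * (/ 2 * (/ 2) ^ n)) with (/ 2 * c) by (unfold c; ring).
        apply (Rmult_le_reg_r l); [unfold l; lra|].
        unfold Rdiv. rewrite Rmult_assoc, Rinv_l by (unfold l; lra).
        assert (0 <= L * c) by now apply Rmult_le_pos. unfold l. lra. }
exists (2 * (B * exp (l * T))).
assert (Pe := exp_pos (l * T)).
assert (PC : 0 < B * exp (l * T)) by now apply Rmult_lt_0_compat.
split; [lra|]. intros n m Hnm t Ht.
assert (Step' : forall j, norm (minus (iterate (Datatypes.S j) t) (iterate j t))
  <= B * exp (l * T) * (/ 2) ^ j).
{ intros j. assert (Pj : 0 <= (/ 2) ^ j) by (apply pow_le; lra).
  destruct (Rle_lt_dec 0 t) as [K|K].
  - eapply Rle_trans; [apply Step; lra|].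
    replace (B * exp (l * T) * (/ 2) ^ j) with (B * (/ 2) ^ j * exp (l * T)) by ring.
    apply Rmult_le_compat_l; [apply Rmult_le_pos; lra|]. apply exp_mono; unfold l; lra.
  - rewrite (proj1 (proj2 (iterate_admissible (Datatypes.S j)))) by lra.
    rewrite (proj1 (proj2 (iterate_admissible j))) by lra.
    rewrite norm_minus_self. apply Rmult_le_pos; lra. }
assert (Tele : norm (minus (iterate m t) (iterate n t))
  <= 2 * (B * exp (l * T)) * ((/ 2) ^ n - (/ 2) ^ m)).
{ induction Hnm as [|m Hnm IH].
  - rewrite norm_minus_self. lra.
  - eapply Rle_trans; [apply (norm_minus_triangle (iterate m t))|].
    specialize (Step' m). simpl pow. lra. }
eapply Rle_trans; [exact Tele|]. apply Rmult_le_compat_l; [lra|].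
assert (0 <= (/ 2) ^ m) by (apply pow_le; lra). lra.
Qed.

Lemma half_pow_small C eps : 0 < eps -> exists n, C * (/ 2) ^ n < eps.
Proof.
intros He. assert (PC := Rabs_pos C).
destruct (pow_lt_1_zero (/ 2)) with (y := eps / (Rabs C + 1)) as [N HN].
{ rewrite Rabs_pos_eq; lra. }
{ apply Rdiv_lt_0_compat; lra. }
exists N. specialize (HN N (Nat.le_refl N)).
assert (PN : 0 <= (/ 2) ^ N) by (apply pow_le; lra).
rewrite Rabs_pos_eq in HN by exact PN.
apply Rle_lt_trans with ((Rabs C + 1) * (/ 2) ^ N).
- apply Rmult_le_compat_r; [exact PN|]. assert (Q := Rle_abs C). lra.
- replace eps with ((Rabs C + 1) * (eps / (Rabs C + 1))) by (field; lra).
  apply Rmult_lt_compat_l; lra.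
Qed.

Lemma iterate_limit : exists z : R -> Yspace A, forall T, 0 <= T -> exists C, 0 <= C /\
  forall n t, t <= T -> norm (minus (z t) (iterate n t)) <= C * (/ 2) ^ n.
Proof.
assert (Lim : forall t, exists l : Yspace A, exists C, forall n,
  norm (minus l (iterate n t)) <= C * (/ 2) ^ n).
{ intros t. destruct (iterate_cauchy (Rmax 0 t) (Rmax_l _ _)) as [C [PC HC]].
  destruct (seq_lim (V := Ycomplete A) (fun n => iterate n t) (fun n => C * (/ 2) ^ n)) as [l Hl].
  - intros n m Hnm. apply HC; [exact Hnm|apply Rmax_r].
  - intros eps He. now apply half_pow_small.
  - exists l, C. exact Hl. }
set (z := fun t => proj1_sig (constructive_indefinite_description _ (Lim t))).
assert (Hz : forall t, exists C, forall n, norm (minus (z t) (iterate n t)) <= C * (/ 2) ^ n).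
{ intros t. exact (proj2_sig (constructive_indefinite_description _ (Lim t))). }
exists z. intros T HT. destruct (iterate_cauchy T HT) as [C [PC HC]].
exists C. split; [exact PC|]. intros n t Ht. apply le_epsilon. intros eps He.
destruct (Hz t) as [C' HC'].
destruct (half_pow_small (Rabs C') eps He) as [m Hm].
assert (Q := HC' (Nat.max n m)). assert (Q' := HC n (Nat.max n m) (Nat.le_max_l _ _) t Ht).
assert (Pow : (/ 2) ^ Nat.max n m <= (/ 2) ^ m).
{ rewrite !pow_inv. apply Rinv_le_contravar; [apply pow_lt; lra|].
  apply Rle_pow; [lra|lia]. }
assert (P0 : 0 <= (/ 2) ^ Nat.max n m) by (apply pow_le; lra).
assert (Q2 : C' * (/ 2) ^ Nat.max n m <= Rabs C' * (/ 2) ^ m).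
{ apply Rle_trans with (Rabs C' * (/ 2) ^ Nat.max n m).
  - apply Rmult_le_compat_r; [exact P0|apply Rle_abs].
  - apply Rmult_le_compat_l; [apply Rabs_pos|exact Pow]. }
eapply Rle_trans; [apply (norm_minus_triangle (iterate (Nat.max n m) t))|]. lra.
Qed.

(** The forcing, the velocity and Duhamel's integral of the iterates converge
    uniformly on bounded intervals. *)
Theorem picard_solution : exists (u : R -> Dhalf A) (v : R -> H),
  path (fun t => - h <= t) u v /\
  (forall t, - h <= t <= 0 -> u t = phi t) /\
  forall T, 0 <= T -> solution_on A h S T u v (fun t => G t (segment u t)).
Proof.
destruct iterate_limit as [z Hz].
assert (Hist : forall t, t <= 0 -> z t = history t).
{ intros t Ht. destruct (Hz 0 (Rle_refl 0)) as [C [PC HC]].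
  apply (eq_of_small _ _ 1). intros eps He. destruct (half_pow_small C eps He) as [n Hn].
  specialize (HC n t Ht). rewrite (proj1 (proj2 (iterate_admissible n)) t Ht) in HC. lra. }
assert (Az : admissible z).
{ assert (Cz : forall t, continuous z t).
  { intros t. apply (continuous_iff (V := Yspace A)). intros eps He.
    destruct (Hz (Rmax 0 (t + 1)) (Rmax_l _ _)) as [C [PC HC]].
    assert (HR := Rmax_r 0 (t + 1)).
    destruct (half_pow_small C (eps / 3)) as [n Hn]; [lra|].
    destruct (proj1 (continuous_iff (V := Yspace A) _ _) (proj1 (iterate_admissible n) t) (eps / 3))
      as [d [Hd Q]]; [lra|].
    exists (Rmin d 1). split; [apply Rmin_glb_lt; lra|]. intros s Hs.
    assert (S1 := Rlt_le_trans _ _ _ Hs (Rmin_l _ _)).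
    assert (S2 := Rlt_le_trans _ _ _ Hs (Rmin_r _ _)). apply Rabs_def2 in S2.
    specialize (Q s S1). assert (Q1 := HC n s ltac:(lra)). assert (Q2 := HC n t ltac:(lra)).
    rewrite norm_minus_sym in Q2.
    assert (T1 := norm_minus_triangle (iterate n s) (z s) (z t)).
    assert (T2 := norm_minus_triangle (iterate n t) (iterate n s) (z t)). lra. }
  split; [exact Cz|split; [exact Hist|]]. intros t Ht.
  destruct (Hz t Ht) as [C [PC HC]].
  assert (Ps : 0 < / sqrt_eigval A 0) by apply Rinv_0_lt_compat, sqrt_eigval_gt_0.
  apply (is_RInt_limit (V := H) _ 0 t _ (2 * / sqrt_eigval A 0)); [exact Ht| |].
  { apply (ex_RInt_cont (V := H)). apply (cont_snd A z Cz). }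
  intros eps He. destruct (half_pow_small C eps He) as [n Hn].
  exists (fun s => snd (iterate n s)),
    (minus (emb (fst (iterate n t))) (emb (fst (iterate n 0)))).
  split; [now apply iterate_admissible|]. split.
  - assert (B : forall s, s <= t -> norm (minus (emb (fst (iterate n s))) (emb (fst (z s))))
      <= / sqrt_eigval A 0 * eps).
    { intros s Hs. rewrite <- emb_minus. eapply Rle_trans; [apply emb_norm_le|].
      apply Rmult_le_compat_l; [lra|].
      assert (Q := HC n s Hs). rewrite norm_minus_sym in Q.
      assert (Q' := norm_fst_le A (minus (iterate n s) (z s))).
      change (norm (minus (fst (iterate n s)) (fst (z s))) <= norm (minus (iterate n s) (z s))) in Q'.
      lra. }
    assert (B1 := B t (Rle_refl t)). assert (B0 := B 0 Ht).
    assert (E : minus (minus (emb (fst (iterate n t))) (emb (fst (iterate n 0))))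
       (minus (emb (fst (z t))) (emb (fst (z 0))))
     = minus (minus (emb (fst (iterate n t))) (emb (fst (z t))))
       (minus (emb (fst (iterate n 0))) (emb (fst (z 0))))) by module_eq H.
    one_path. rewrite E. eapply Rle_trans; [apply (norm_minus_le (V := H))|]. one_path. lra.
  - intros s Hs. assert (Q := HC n s ltac:(lra)).
    assert (Q' := norm_snd_le A (minus (z s) (iterate n s))).
    change (norm (minus (snd (z s)) (snd (iterate n s))) <= norm (minus (z s) (iterate n s))) in Q'.
    one_path. lra. }
assert (Pz := admissible_path z Az).
exists (fun t => fst (z t)), (fun t => snd (z t)).
split; [exact Pz|]. split.
{ intros t Ht. rewrite Hist by lra. unfold history; simpl. now rewrite clamp_id. }
intros T HT. split; [|split].
{ apply (path_subset (fun t => - h <= t)); [intros; lra|exact Pz]. }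
{ apply (continuous_on_subset (V := H) (fun t => 0 <= t)); [intros; lra|].
  exact (G_cont _ _ Pz). }
apply (duhamel_ext A S T z _ (forcing z)).
{ intros t _. apply surjective_pairing. }
{ intros t Ht. unfold forcing. now rewrite Rmax_right by lra. }
intros t Ht. exists (minus (z t) (S t (z 0))). split; [|module_eq (Yspace A)].
destruct (Hz T HT) as [C [PC HC]]. destruct (G_lip T HT) as [L [PL BL]].
apply (is_RInt_limit (V := Yspace A) _ 0 t _ 1); [lra| |].
{ apply (duhamel_ex (Y := Ycomplete A) S (proj1 S_wave) Contr (fun s => impulse A (forcing z s))
    (fun s => impulse_cont A _ s (forcing_cont z Az s))); lra. }
intros eps He.
destruct (half_pow_small C (eps / (1 + 2 * L))) as [n Hn]; [apply Rdiv_lt_0_compat; lra|].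
assert (Hn' : (1 + 2 * L) * (C * (/ 2) ^ n) <= eps).
{ replace eps with ((1 + 2 * L) * (eps / (1 + 2 * L))) by (field; lra).
  apply Rmult_le_compat_l; lra. }
assert (Pn : 0 <= C * (/ 2) ^ n) by (apply Rmult_le_pos; [exact PC|apply pow_le; lra]).
assert (PLn : 0 <= L * (C * (/ 2) ^ n)) by now apply Rmult_le_pos.
exists (fun s => S (t - s) (impulse A (forcing (iterate n) s))),
  (minus (iterate (Datatypes.S n) t) (S t (history 0))).
split; [|split].
- simpl iterate. rewrite picard_pos by lra.
  apply duhamel_sum_correct; [|lra]. apply forcing_cont, iterate_admissible.
- rewrite (Hist 0 (Rle_refl 0)).
  assert (E : minus (minus (iterate (Datatypes.S n) t) (S t (history 0))) (minus (z t) (S t (history 0)))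
    = minus (iterate (Datatypes.S n) t) (z t)) by module_eq (Yspace A).
  rewrite E, norm_minus_sym. eapply Rle_trans; [apply HC; lra|]. simpl pow. lra.
- intros s Hs. eapply Rle_trans; [apply impulse_close; lra|].
  eapply Rle_trans; [apply (forcing_close T L z (iterate n) s (C * (/ 2) ^ n) Az (iterate_admissible n) PL BL); [lra|]|lra].
  intros r Hr. apply HC. lra.
Qed.

End Picard.

(** * A priori bound and continuous dependence *)

Section Equation.
Context {H : Hilbert} {A : DiscreteOperator H} (h k : R)
  (S : R -> Yspace A -> Yspace A)
  (F Fstar : Dhalf A -> H) (Pi Pi0 Pi1 : Dhalf A -> R)
  (dPi : Dhalf A -> Dhalf A -> R)
  (M : (R -> Dhalf A) -> H) (c0 M0 M1 : R)
  (h_pos : 0 < h) (k_ge_0 : 0 <= k)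
  (S_wave : wave_semigroup A k S)
  (F_lip : locally_lipschitz A F)
  (Pi_diff : forall u : Dhalf A, filterdiff Pi (locally u) (dPi u))
  (F_split : forall u v : Dhalf A,
     inner (F u) (emb v) = dPi u v + inner (Fstar u) (emb v))
  (Fstar_lip : forall u1 u2 : Dhalf A,
     norm (minus (Fstar u1) (Fstar u2)) ^ 2 <= c0 * norm (minus u1 u2) ^ 2)
  (Pi_split : forall u : Dhalf A, Pi u = Pi0 u + Pi1 u)
  (Pi0_ge_0 : forall u : Dhalf A, 0 <= Pi0 u)
  (Pi0_bounded : forall r : R, exists C : R,
     forall u : Dhalf A, norm u <= r -> Rabs (Pi0 u) <= C)
  (Pi1_bound : forall eta : R, 0 < eta -> exists C : R, 0 < C /\
     forall u : Dhalf A, Rabs (Pi1 u) <= eta * (norm u ^ 2 + Pi0 u) + C)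
  (M_lip : forall rho : R, 0 < rho -> exists C : R,
     forall phi1 phi2 : R -> Dhalf A, in_W h phi1 -> in_W h phi2 ->
     Wnorm h phi1 <= rho -> Wnorm h phi2 <= rho ->
     norm (minus (M phi1) (M phi2)) <= C * Wdist h phi1 phi2)
  (M0_ge_0 : 0 <= M0) (M1_ge_0 : 0 <= M1)
  (M_growth : forall phi : R -> Dhalf A, in_W h phi ->
     norm (M phi) <= M0 + M1 * Wnorm h phi).

Lemma Fstar_lipschitz u1 u2 :
  norm (minus (Fstar u1) (Fstar u2)) <= (1 + Rabs c0) * norm (minus u1 u2).
Proof.
assert (P := norm_ge_0 (minus u1 u2)). assert (Pc := Rabs_pos c0).
apply Rsqr_incr_0_var; [|apply Rmult_le_pos; lra].
rewrite !Rsqr_pow2. eapply Rle_trans; [apply Fstar_lip|].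
rewrite Rpow_mult_distr. apply Rmult_le_compat_r; [apply pow2_ge_0|].
assert (Q := Rle_abs c0). nra.
Qed.

Lemma Fstar_locally_lipschitz : locally_lipschitz A Fstar.
Proof.
intros r _. exists (1 + Rabs c0). split; [assert (P := Rabs_pos c0); lra|].
intros u1 u2 _ _. apply Fstar_lipschitz.
Qed.

Lemma Fstar_growth : exists f0 f1, 0 <= f0 /\ 0 <= f1 /\
  forall u, norm (Fstar u) <= f0 + f1 * norm u.
Proof.
exists (norm (Fstar zero)), (1 + Rabs c0).
split; [apply (norm_ge_0 (V := H))|].
split; [assert (P := Rabs_pos c0); lra|]. intros u.
assert (Q : norm (minus (Fstar u) (Fstar zero)) <= (1 + Rabs c0) * norm u).
{ eapply Rle_trans; [apply Fstar_lipschitz|]. right. do 2 f_equal. module_eq (Dhalf A). }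
assert (T := norm_plus_minus (V := H) (Fstar u) (Fstar zero)). one_path. lra.
Qed.

(** The right-hand side of [u'' + k u' + A u = nonlinearity u_t]. *)
Definition nonlinearity (phi : R -> Dhalf A) : H := minus (opp (F (phi 0))) (M phi).

Lemma nonlinearity_lipschitz rho : 0 < rho -> exists L, 0 <= L /\
  forall phi1 phi2 : R -> Dhalf A, in_W h phi1 -> in_W h phi2 ->
  Wnorm h phi1 <= rho -> Wnorm h phi2 <= rho ->
  norm (minus (nonlinearity phi1) (nonlinearity phi2)) <= L * Wdist h phi1 phi2.
Proof.
intros Hr. destruct (F_lip rho Hr) as [LF [PL BF]]. destruct (M_lip rho Hr) as [LM BM].
exists (LF + Rmax 0 LM). assert (PM := Rmax_l 0 LM). assert (PM' := Rmax_r 0 LM).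
split; [lra|]. intros phi1 phi2 W1 W2 N1 N2.
assert (D0 : delay_interval h 0) by (unfold delay_interval; lra).
assert (P1 := path_of_in_W h phi1 W1). assert (P2 := path_of_in_W h phi2 W2).
assert (G1 := Wnorm_ge h h_pos _ _ P1 0 0 D0 D0).
assert (G2 := Wnorm_ge h h_pos _ _ P2 0 0 D0 D0).
assert (G := Wdist_ge h h_pos _ _ _ _ P1 P2 0 0 D0 D0).
assert (Pd := Wdist_ge_0 h h_pos _ _ _ _ P1 P2).
set (d1 := derive_on _ _) in P1, G1, G. set (d2 := derive_on _ _) in P2, G2, G.
assert (Q1 := norm_ge_0 (V := H) (d1 0)). assert (Q2 := norm_ge_0 (V := H) (d2 0)).
assert (Q := norm_ge_0 (V := H) (minus (d1 0) (d2 0))).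
one_path.
assert (BF' := BF (phi1 0) (phi2 0) ltac:(lra) ltac:(lra)).
assert (BM' := BM phi1 phi2 W1 W2 N1 N2).
unfold nonlinearity.
assert (E : minus (minus (opp (F (phi1 0))) (M phi1)) (minus (opp (F (phi2 0))) (M phi2))
  = minus (opp (minus (F (phi1 0)) (F (phi2 0)))) (minus (M phi1) (M phi2))) by module_eq H.
rewrite E. eapply Rle_trans; [apply (norm_minus_le (V := H))|].
rewrite (norm_opp (V := H)). one_path.
assert (LF * norm (minus (phi1 0) (phi2 0)) <= LF * Wdist h phi1 phi2)
  by (apply Rmult_le_compat_l; lra).
assert (LM * Wdist h phi1 phi2 <= Rmax 0 LM * Wdist h phi1 phi2)
  by (apply Rmult_le_compat_r; lra).
lra.
Qed.

Lemma segment_path T (u : R -> Dhalf A) (v : R -> H) t : 0 <= t <= T -> path (fun t => - h <= t <= T) u v ->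
  path (delay_interval h) (segment u t) (segment v t).
Proof.
intros Ht. apply path_segment. unfold delay_interval. intros theta Hth. lra.
Qed.

Lemma state_norms (u : Dhalf A) (v : H) m : norm ((u, v) : Yspace A) <= m ->
  norm u <= m /\ norm v <= m.
Proof.
intros B. split; (eapply Rle_trans; [|exact B]).
- exact (norm_fst_le A (u, v)).
- exact (norm_snd_le A (u, v)).
Qed.

Lemma state_norm_sq (u : Dhalf A) (v : H) :
  norm ((u, v) : Yspace A) ^ 2 = norm u ^ 2 + norm v ^ 2.
Proof. exact (norm_pair_sq A (u, v)). Qed.

Lemma segment_norm_le T (u : R -> Dhalf A) (v : R -> H) rho m t :
  path (fun t => - h <= t <= T) u v -> 0 <= t <= T ->
  Wnorm h u <= rho -> rho <= m ->
  (forall s, 0 <= s <= t -> norm ((u s, v s) : Yspace A) <= m) ->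
  Wnorm h (segment u t) <= 2 * m.
Proof.
intros P Ht Wu Hm B.
assert (P0 : path (delay_interval h) u v).
{ apply (path_subset (fun t => - h <= t <= T)); [|exact P].
  unfold delay_interval; intros; lra. }
assert (Bu : forall s, - h <= s <= t -> norm (u s) <= m /\ norm (v s) <= m).
{ intros s Hs. destruct (Rle_lt_dec 0 s) as [L|L].
  - apply state_norms, B. lra.
  - assert (Ds : delay_interval h s) by (unfold delay_interval; lra).
    assert (G := Wnorm_ge h h_pos _ _ P0 s s Ds Ds).
    assert (Q1 := norm_ge_0 (u s)). assert (Q2 := norm_ge_0 (v s)). lra. }
apply (Wnorm_le h h_pos _ _ (segment_path T u v t Ht P)).
unfold segment, delay_interval. intros x y Hx Hy.
assert (B1 := proj1 (Bu (t + x) ltac:(lra))). assert (B2 := proj2 (Bu (t + y) ltac:(lra))).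
lra.
Qed.

(** The energy controls [norm U ^ 2] from above and below, and its growth is at most
    [c] times the square of a barrier that [norm U] has respected so far, by the
    linear growth of [Fstar] and [M].  While the barrier is respected, segments have
    at most twice its size: the forcing needs to be the true nonlinearity only
    there, so that the bound also holds for a nonlinearity truncated beyond. *)
Lemma a_priori_bound rho : 0 < rho -> exists K b, rho <= K /\ 0 < b /\
  forall T u v g, 0 <= T -> solution_on A h S T u v g ->
  Wnorm h u <= rho ->
  (forall t, 0 <= t <= T -> Wnorm h (segment u t) <= 2 * (K * exp (b * t)) ->
     g t = nonlinearity (segment u t)) ->
  forall t, 0 <= t <= T -> norm ((u t, v t) : Yspace A) < K * exp (b * t).
Proof.
intros Hrho.
destruct Fstar_growth as [f0 [f1 [Pf0 [Pf1 BFs]]]].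
destruct (Pi1_bound (/ 4)) as [C1 [PC1 BC1]]; [lra|].
destruct (Pi0_bounded rho) as [C2' BC2'].
set (C2 := Rmax 0 C2').
assert (PC2 : 0 <= C2) by apply Rmax_l.
assert (BC2 : forall u : Dhalf A, norm u <= rho -> Pi0 u <= C2).
{ intros u Hu. eapply Rle_trans; [apply Rle_abs|].
  eapply Rle_trans; [now apply BC2'|apply Rmax_r]. }
set (c := f0 + f1 + M0 + 2 * M1). assert (Pc : 0 <= c) by (unfold c; lra).
(* [c] bounds the power of the forcing relative to the square of the barrier *)
set (b := 2 * c + 1). assert (Pb : 0 < b) by (unfold b; lra).
(* [a] bounds the initial energy plus the defect of positivity of the energy *)
set (a := / 2 * rho ^ 2 + C2 + (/ 4 * (rho ^ 2 + C2) + C1) + C1).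
assert (Prho := pow2_ge_0 rho).
assert (Pa : 0 < a) by (unfold a; lra).
set (K := 1 + rho + 4 * a).
assert (PK : 1 <= K) by (unfold K; lra).
exists K, b. split; [unfold K; lra|]. split; [exact Pb|].
intros T u v g HT Sol Wu Hg.
assert (P : path (fun t => - h <= t <= T) u v) by apply Sol.
assert (D0 : delay_interval h 0) by (unfold delay_interval; lra).
assert (P0 : path (delay_interval h) u v).
{ apply (path_subset (fun t => - h <= t <= T)); [|exact P].
  unfold delay_interval; intros; lra. }
assert (G0 := Wnorm_ge h h_pos _ _ P0 0 0 D0 D0).
assert (N1 := norm_ge_0 (u 0)). assert (N2 := norm_ge_0 (v 0)).
assert (Z0 : norm ((u 0, v 0) : Yspace A) <= rho).
{ eapply Rle_trans; [apply norm_pair_le|]. simpl. lra. }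
destruct (solution_norm_cont A h k S h_pos k_ge_0 S_wave T u v g HT Sol) as [y [Cy Ey]].
assert (Sq0 : norm (u 0) ^ 2 + norm (v 0) ^ 2 <= rho ^ 2).
{ rewrite <- (state_norm_sq (u 0) (v 0)). apply pow_incr. split; [apply norm_ge_0|exact Z0]. }
assert (High : Pi (u 0) <= C2 + (/ 4 * (rho ^ 2 + C2) + C1)).
{ rewrite Pi_split. assert (Q := BC1 (u 0)). apply Rabs_le_between in Q.
  assert (Q1 : Pi0 (u 0) <= C2) by (apply BC2; lra).
  assert (Q2 : norm (u 0) ^ 2 <= rho ^ 2) by (apply pow_incr; lra). lra. }
intros t0 Ht0. rewrite <- (Ey t0 Ht0). revert t0 Ht0.
apply (quadratic_barrier y T (4 * a) (4 * c) K b Cy); try (unfold b, K; nra).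
{ intros t Ht. rewrite Ey by exact Ht. apply norm_ge_0. }
{ rewrite Ey by lra. unfold K. lra. }
intros t Ht Past.
assert (Past' : forall s, 0 <= s <= t -> norm ((u s, v s) : Yspace A) <= K * exp (b * s)).
{ intros s Hs. rewrite <- Ey by lra. now apply Past. }
assert (Hm1 : forall s, 0 <= s -> 1 <= K * exp (b * s) /\ rho <= K * exp (b * s)).
{ intros s Hs. assert (Q := exp_ge_1 b s ltac:(lra) Hs).
  assert (K * 1 <= K * exp (b * s)) by (apply Rmult_le_compat_l; lra). unfold K in *; lra. }
assert (Seg : forall s, 0 <= s <= t -> Wnorm h (segment u s) <= 2 * (K * exp (b * s))).
{ intros s Hs. apply (segment_norm_le T u v rho _ s P); [lra|exact Wu|apply Hm1; lra|].
  intros r Hr. eapply Rle_trans; [apply Past'; lra|].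
  apply Rmult_le_compat_l; [lra|]. apply exp_mono; lra. }
assert (Sol' := solution_restrict A h S T t u v g ltac:(lra) Sol).
(* below the barrier the forcing splits into the potential part and [m] *)
set (m := fun s => minus (opp (F (u s))) (g s)).
assert (Em : forall s, 0 <= s <= t -> m s = M (segment u s)).
{ intros s Hs. unfold m. rewrite Hg by (try apply Seg; lra).
  unfold nonlinearity, segment at 1. rewrite Rplus_0_r. module_eq H. }
assert (En := solution_nonlinear_energy A h k S h_pos k_ge_0 S_wave Pi dPi F Fstar m t u v g
  Pi_diff F_lip Fstar_locally_lipschitz F_split ltac:(lra) Sol').
assert (Eg : forall s, 0 <= s <= t -> g s = minus (opp (F (u s))) (m s)).
{ intros s _. unfold m. module_eq H. }
apply (is_RInt_scal (V := R_NormedModule) _ _ _ 4) in En; [|exact Eg].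
eexists. eexists. split; [exact En|]. split.
{ assert (Low : - / 4 * norm ((u t, v t) : Yspace A) ^ 2 - C1 <= Pi (u t)).
  { rewrite Pi_split, state_norm_sq. assert (Q := BC1 (u t)). apply Rabs_le_between in Q.
    assert (Q1 := Pi0_ge_0 (u t)). assert (Q2 := pow2_ge_0 (norm (v t))). lra. }
  rewrite Ey by lra. rewrite state_norm_sq in Low |- *.
  change scal with Rmult. change scal with Rmult. unfold a. lra. }
intros s Hs. change scal with Rmult. cbv beta.
  set (ms := K * exp (b * s)) in *.
  assert (B := Past' s ltac:(lra)). fold ms in B. apply state_norms in B. destruct B as [B1 B2].
  assert (Ms := proj1 (Hm1 s ltac:(lra))). fold ms in Ms.
  assert (Wm : in_W h (segment u s)).
  { apply (in_W_of_path h h_pos _ (segment v s)). apply (segment_path T u v s ltac:(lra) P). }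
  assert (Bm : norm (m s) <= M0 + M1 * (2 * ms)).
  { rewrite Em by lra. eapply Rle_trans; [now apply M_growth|].
    apply Rplus_le_compat_l, Rmult_le_compat_l; [exact M1_ge_0|]. apply Seg; lra. }
  assert (Bf : norm (Fstar (u s)) <= f0 + f1 * ms).
  { eapply Rle_trans; [apply BFs|]. apply Rplus_le_compat_l, Rmult_le_compat_l; [exact Pf1|exact B1]. }
  assert (S1 := cauchy_schwarz (Fstar (u s)) (v s)).
  assert (S2 := cauchy_schwarz (m s) (v s)).
  assert (N3 := norm_ge_0 (v s)).
  assert (N4 := norm_ge_0 (Fstar (u s))). assert (N5 := norm_ge_0 (m s)).
  assert (R1 : norm (Fstar (u s)) * norm (v s) <= (f0 + f1 * ms) * ms)
    by (apply Rmult_le_compat; assumption).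
  assert (R2 : norm (m s) * norm (v s) <= (M0 + M1 * (2 * ms)) * ms)
    by (apply Rmult_le_compat; assumption).
  assert (R3 : 0 <= k * norm (v s) ^ 2) by (apply Rmult_le_pos; [exact k_ge_0|apply pow2_ge_0]).
  assert (R4 : f0 * ms <= f0 * ms ^ 2) by (apply Rmult_le_compat_l; [exact Pf0|nra]).
  assert (R5 : M0 * ms <= M0 * ms ^ 2) by (apply Rmult_le_compat_l; [exact M0_ge_0|nra]).
  apply Rabs_le_between in S1. apply Rabs_le_between in S2.
  unfold c. lra.
Qed.

(** The difference of two solutions solves the linear equation whose forcing is the
    difference of their forcings, and this is bounded by the difference of the
    segments since both solutions respect the same a priori bound. *)
Lemma continuous_dependence rho T : 0 < rho -> 0 <= T -> exists C, 0 <= C /\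
  forall u1 v1 g1 u2 v2 g2,
  solution_on A h S T u1 v1 g1 -> solution_on A h S T u2 v2 g2 ->
  Wnorm h u1 <= rho -> Wnorm h u2 <= rho ->
  (forall t, 0 <= t <= T -> g1 t = nonlinearity (segment u1 t)) ->
  (forall t, 0 <= t <= T -> g2 t = nonlinearity (segment u2 t)) ->
  forall t, 0 <= t <= T ->
  norm (minus (u1 t) (u2 t)) + norm (minus (v1 t) (v2 t)) <= C * Wdist h u1 u2.
Proof.
intros Hrho HT.
destruct (a_priori_bound rho Hrho) as [K [b [HK [Pb Bound]]]].
set (R := 2 * (K * exp (b * T))).
assert (PKT : rho <= K * exp (b * T)).
{ assert (Q := exp_ge_1 b T ltac:(lra) HT).
  assert (K * 1 <= K * exp (b * T)) by (apply Rmult_le_compat_l; lra). lra. }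
destruct (nonlinearity_lipschitz R) as [L [PL BL]]; [unfold R; lra|].
set (be := 2 * L + 1).
exists (2 * exp (be * T)). split; [assert (Q := exp_pos (be * T)); lra|].
intros u1 v1 g1 u2 v2 g2 Sol1 Sol2 W1 W2 E1 E2.
assert (Path1 : path (fun t => - h <= t <= T) u1 v1) by apply Sol1.
assert (Path2 : path (fun t => - h <= t <= T) u2 v2) by apply Sol2.
assert (Seg : forall u v g, solution_on A h S T u v g -> Wnorm h u <= rho ->
  (forall t, 0 <= t <= T -> g t = nonlinearity (segment u t)) ->
  forall t, 0 <= t <= T -> in_W h (segment u t) /\ Wnorm h (segment u t) <= R).
{ intros u v g Sol Wu Eg t Ht.
  assert (P : path (fun t => - h <= t <= T) u v) by apply Sol.
  split; [apply (in_W_of_path h h_pos _ (segment v t)), (segment_path T u v t Ht P)|].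
  apply (segment_norm_le T u v rho _ t P Ht Wu PKT). intros s Hs.
  assert (Q := Bound T u v g HT Sol Wu (fun t Ht _ => Eg t Ht) s ltac:(lra)).
  left. eapply Rlt_le_trans; [exact Q|]. apply Rmult_le_compat_l; [lra|].
  apply exp_mono; lra. }
assert (Sol := solution_minus A h k S S_wave T u1 v1 g1 u2 v2 g2 Sol1 Sol2).
set (u := fun t => minus (u1 t) (u2 t)) in Sol. set (v := fun t => minus (v1 t) (v2 t)) in Sol.
set (g := fun t => minus (g1 t) (g2 t)) in Sol.
assert (P : path (fun t => - h <= t <= T) u v) by apply Sol.
assert (P0 : path (delay_interval h) u v).
{ apply (path_subset (fun t => - h <= t <= T)); [|exact P].
  unfold delay_interval; intros; lra. }
set (d := Wdist h u1 u2).
assert (Pd : 0 <= d) by exact (Wnorm_ge_0 h h_pos u v P0).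
assert (D0 : delay_interval h 0) by (unfold delay_interval; lra).
assert (G0 := Wnorm_ge h h_pos _ _ P0 0 0 D0 D0). change (Wnorm h u) with d in G0.
assert (Z0 : norm ((u 0, v 0) : Yspace A) <= d).
{ eapply Rle_trans; [apply norm_pair_le|]. exact G0. }
destruct (solution_norm_cont A h k S h_pos k_ge_0 S_wave T u v g HT Sol) as [y [Cy Ey]].
assert (Main : forall eps, 0 < eps -> forall t, 0 <= t <= T -> y t < (d + eps) * exp (be * t)).
{ intros eps He.
  apply (quadratic_barrier y T (d ^ 2) (4 * L) (d + eps) be Cy); try (unfold be; nra).
  { intros t Ht. rewrite Ey by exact Ht. apply norm_ge_0. }
  { rewrite Ey by lra. eapply Rle_lt_trans; [exact Z0|lra]. }
  intros t Ht Past.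
  assert (Past' : forall s, 0 <= s <= t -> norm ((u s, v s) : Yspace A) <= (d + eps) * exp (be * s)).
  { intros s Hs. rewrite <- Ey by lra. now apply Past. }
  assert (Sol' := solution_restrict A h S T t u v g ltac:(lra) Sol).
  assert (En := solution_linear_energy A h k S h_pos k_ge_0 S_wave t u v g ltac:(lra) Sol').
  eexists. eexists. split; [exact En|]. split.
  - assert (Sq0 : norm (u 0) ^ 2 + norm (v 0) ^ 2 <= d ^ 2).
    { rewrite <- (state_norm_sq (u 0) (v 0)).
      apply pow_incr; split; [apply norm_ge_0|exact Z0]. }
    rewrite Ey by lra.
    apply Rle_trans with (norm (u t) ^ 2 + norm (v t) ^ 2);
      [right; exact (state_norm_sq (u t) (v t))|lra].
  - intros s Hs.
    set (ms := (d + eps) * exp (be * s)) in *.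
    assert (Hd : d <= ms).
    { assert (Q := exp_ge_1 be s ltac:(unfold be; lra) ltac:(lra)).
      assert ((d + eps) * 1 <= ms) by (apply Rmult_le_compat_l; lra). lra. }
    assert (Wd : Wdist h (segment u1 s) (segment u2 s) <= 2 * ms).
    { apply (segment_norm_le T u v d ms s P ltac:(lra) (Rle_refl d) Hd).
      intros r Hr. eapply Rle_trans; [apply Past'; lra|].
      apply Rmult_le_compat_l; [lra|]. apply exp_mono; unfold be; lra. }
    destruct (Seg u1 v1 g1 Sol1 W1 E1 s ltac:(lra)) as [I1 B1].
    destruct (Seg u2 v2 g2 Sol2 W2 E2 s ltac:(lra)) as [I2 B2].
    assert (Bg : norm (g s) <= L * (2 * ms)).
    { unfold g. rewrite E1, E2 by lra. eapply Rle_trans; [now apply BL|].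
      now apply Rmult_le_compat_l. }
    assert (Bv := proj2 (state_norms _ _ _ (Past' s ltac:(lra)))). fold ms in Bv.
    assert (CS := cauchy_schwarz (g s) (v s)). apply Rabs_le_between in CS.
    assert (R1 : norm (g s) * norm (v s) <= L * (2 * ms) * ms).
    { apply Rmult_le_compat; auto; apply (norm_ge_0 (V := H)). }
    assert (R3 : 0 <= k * norm (v s) ^ 2) by (apply Rmult_le_pos; [exact k_ge_0|apply pow2_ge_0]).
    lra. }
intros t Ht.
assert (Q : y t <= d * exp (be * T)).
{ apply le_epsilon. intros eps He.
  assert (Pe := exp_pos (be * T)).
  assert (Q := Main (eps / exp (be * T)) ltac:(now apply Rdiv_lt_0_compat) t Ht).
  assert (Q' : (d + eps / exp (be * T)) * exp (be * t) <= (d + eps / exp (be * T)) * exp (be * T)).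
  { apply Rmult_le_compat_l.
    - assert (0 < eps / exp (be * T)) by now apply Rdiv_lt_0_compat. lra.
    - apply exp_mono; unfold be; lra. }
  replace ((d + eps / exp (be * T)) * exp (be * T)) with (d * exp (be * T) + eps) in Q'
    by (field; lra). lra. }
rewrite Ey in Q by exact Ht. apply state_norms in Q. destruct Q as [Q1 Q2].
fold (u t) (v t) d. lra.
Qed.

(** * Existence *)

(** The radial retraction of [W] onto the ball of radius [r]. *)
Definition truncate (r : R) (phi : R -> Dhalf A) : R -> Dhalf A :=
  fun theta => scal (r / Rmax r (Wnorm h phi)) (phi theta).

Lemma ratio_Rmax r n : 0 < r -> 0 <= n ->
  0 <= r / Rmax r n <= 1 /\ r / Rmax r n * n = Rmin r n.
Proof.
intros Hr Hn. unfold Rmax, Rmin. destruct (Rle_dec r n) as [L|L].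
- split; [|field; lra]. split; [apply Rdiv_le_0_compat; lra|].
  apply (Rmult_le_reg_r n); [lra|]. unfold Rdiv. rewrite Rmult_assoc, Rinv_l by lra. lra.
- replace (r / r) with 1 by (field; lra). lra.
Qed.

Lemma truncate_path r phi psi : path (delay_interval h) phi psi ->
  path (delay_interval h) (truncate r phi)
    (fun t => scal (r / Rmax r (Wnorm h phi)) (psi t)).
Proof. apply path_scal. Qed.

Lemma truncate_norm_le r phi psi : 0 < r -> path (delay_interval h) phi psi ->
  Wnorm h (truncate r phi) <= r.
Proof.
intros Hr P. assert (Pn := Wnorm_ge_0 h h_pos phi psi P).
destruct (ratio_Rmax r (Wnorm h phi) Hr Pn) as [[C1 C2] C3].
apply (Wnorm_le h h_pos _ _ (truncate_path r phi psi P)). intros t t' Dt Dt'.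
unfold truncate. rewrite norm_scal_R, (norm_scal_R (V := H)), Rabs_pos_eq by exact C1.
assert (G := Wnorm_ge h h_pos phi psi P t t' Dt Dt').
apply Rmult_le_compat_l with (1 := C1) in G. rewrite C3 in G.
assert (Q := Rmin_l r (Wnorm h phi)). lra.
Qed.

Lemma truncate_id (r : R) (phi : R -> Dhalf A) : 0 < r -> Wnorm h phi <= r -> truncate r phi = phi.
Proof.
intros Hr Hn. apply functional_extensionality. intros t. unfold truncate.
rewrite Rmax_left by exact Hn. replace (r / r) with 1 by (field; lra).
module_eq (Dhalf A).
Qed.

Lemma Wdist_sym (phi1 phi2 : R -> Dhalf A) (psi1 psi2 : R -> H) :
  path (delay_interval h) phi1 psi1 -> path (delay_interval h) phi2 psi2 ->
  Wdist h phi1 phi2 <= Wdist h phi2 phi1.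
Proof.
intros P1 P2. apply (Wdist_le h h_pos _ _ _ _ P1 P2). intros t t' Dt Dt'.
rewrite norm_minus_sym, (norm_minus_sym (V := H)).
exact (Wdist_ge h h_pos _ _ _ _ P2 P1 t t' Dt Dt').
Qed.

Lemma truncate_lipschitz (r1 r2 : R) (phi1 phi2 : R -> Dhalf A) (psi1 psi2 : R -> H) : 0 < r1 -> 0 < r2 ->
  path (delay_interval h) phi1 psi1 -> path (delay_interval h) phi2 psi2 ->
  Wdist h (truncate r1 phi1) (truncate r2 phi2) <= 3 * Wdist h phi1 phi2 + Rabs (r1 - r2).
Proof.
intros Hr1 Hr2 P1 P2.
set (n1 := Wnorm h phi1). set (n2 := Wnorm h phi2). set (d := Wdist h phi1 phi2).
assert (Pn1 : 0 <= n1) by exact (Wnorm_ge_0 h h_pos phi1 psi1 P1).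
assert (Pn2 : 0 <= n2) by exact (Wnorm_ge_0 h h_pos phi2 psi2 P2).
assert (Hn : Rabs (n1 - n2) <= d).
{ assert (T1 := Wnorm_triangle h h_pos _ _ _ _ P1 P2).
  assert (T2 := Wnorm_triangle h h_pos _ _ _ _ P2 P1).
  assert (T3 := Wdist_sym _ _ _ _ P2 P1). fold n1 n2 in T1, T2. fold d in T1, T3.
  apply Rabs_le_between. lra. }
destruct (ratio_Rmax r1 n1 Hr1 Pn1) as [[A1 A2] A3].
destruct (ratio_Rmax r2 n2 Hr2 Pn2) as [[B1 B2] B3].
set (c1 := r1 / Rmax r1 n1) in *. set (c2 := r2 / Rmax r2 n2) in *.
assert (Hc : Rabs (c1 - c2) * n2 <= 2 * d + Rabs (r1 - r2)).
{ rewrite <- (Rabs_pos_eq n2 Pn2) at 1. rewrite <- Rabs_mult.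
  replace ((c1 - c2) * n2) with (c1 * (n2 - n1) + (Rmin r1 n1 - Rmin r2 n2))
    by (rewrite <- A3, <- B3; ring).
  assert (E1 : Rabs (c1 * (n2 - n1)) <= 1 * d).
  { rewrite Rabs_mult, (Rabs_pos_eq c1 A1), Rabs_minus_sym.
    apply Rmult_le_compat; [exact A1|apply Rabs_pos|exact A2|exact Hn]. }
  assert (E2 : Rabs (Rmin r1 n1 - Rmin r2 n2) <= Rabs (n1 - n2) + Rabs (r1 - r2)).
  { unfold Rmin; repeat destruct (Rle_dec _ _); unfold Rabs; repeat destruct (Rcase_abs _); lra. }
  eapply Rle_trans; [apply Rabs_triang|]. lra. }
apply (Wdist_le h h_pos _ _ _ _ (truncate_path r1 _ _ P1) (truncate_path r2 _ _ P2)).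
intros t t' Dt Dt'. unfold truncate. fold n1 n2 c1 c2.
assert (G := Wdist_ge h h_pos _ _ _ _ P1 P2 t t' Dt Dt'). fold d in G.
assert (G2 := Wnorm_ge h h_pos _ _ P2 t t' Dt Dt'). fold n2 in G2.
assert (S1 : norm (minus (scal c1 (phi1 t)) (scal c2 (phi2 t)))
  <= c1 * norm (minus (phi1 t) (phi2 t)) + Rabs (c1 - c2) * norm (phi2 t)).
{ assert (E : minus (scal c1 (phi1 t)) (scal c2 (phi2 t))
    = plus (scal c1 (minus (phi1 t) (phi2 t))) (scal (c1 - c2) (phi2 t)))
    by module_eq (Dhalf A).
  rewrite E. eapply Rle_trans; [apply (norm_triangle (V := Dhalf A))|].
  rewrite !(norm_scal_R (V := Dhalf A)), (Rabs_pos_eq c1 A1). apply Rle_refl. }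
assert (S2 : norm (minus (scal c1 (psi1 t')) (scal c2 (psi2 t')))
  <= c1 * norm (minus (psi1 t') (psi2 t')) + Rabs (c1 - c2) * norm (psi2 t')).
{ assert (E : minus (scal c1 (psi1 t')) (scal c2 (psi2 t'))
    = plus (scal c1 (minus (psi1 t') (psi2 t'))) (scal (c1 - c2) (psi2 t')))
    by module_eq H.
  rewrite E. eapply Rle_trans; [apply (norm_triangle (V := H))|].
  rewrite !(norm_scal_R (V := H)), (Rabs_pos_eq c1 A1). apply Rle_refl. }
assert (G' := Rmult_le_compat_l _ _ _ A1 G).
assert (G2' := Rmult_le_compat_l _ _ _ (Rabs_pos (c1 - c2)) G2).
assert (Pd : 0 <= d) by (assert (Q := Rabs_pos (n1 - n2)); lra).
assert (c1 * d <= 1 * d) by (apply Rmult_le_compat_r; lra).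
one_path. lra.
Qed.

Lemma segment_map_cont (N : (R -> Dhalf A) -> H) (T : R) (u : R -> Dhalf A) (v : R -> H) :
  (forall rho : R, 0 < rho -> exists C : R,
     forall phi1 phi2 : R -> Dhalf A, in_W h phi1 -> in_W h phi2 ->
     Wnorm h phi1 <= rho -> Wnorm h phi2 <= rho ->
     norm (minus (N phi1) (N phi2)) <= C * Wdist h phi1 phi2) ->
  0 <= T -> path (fun t => - h <= t <= T) u v ->
  continuous_on (fun t => 0 <= t <= T) (fun t => N (segment u t)).
Proof.
intros N_lip HT P. apply (continuous_on_iff (V := H)). intros t Ht eps He.
destruct (segment_bound h h_pos T u v HT P) as [B [PB HB]].
destruct (N_lip B PB) as [C HC].
assert (PC := Rabs_pos C).
set (e := eps / (2 * (Rabs C + 1))).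
assert (Pe : 0 < e) by (apply Rdiv_lt_0_compat; lra).
destruct (segment_modulus h h_pos T u v e HT P Pe) as [d [Hd Q]].
exists d. split; [exact Hd|]. intros s Hs Hst.
assert (P1 := segment_path T u v s Hs P). assert (P2 := segment_path T u v t Ht P).
specialize (Q s t Hs Ht Hst).
assert (Pd := Wdist_ge_0 h h_pos _ _ _ _ P1 P2).
eapply Rle_lt_trans.
- apply HC; [exact (in_W_of_path h h_pos _ _ P1)|exact (in_W_of_path h h_pos _ _ P2)| |]; now apply HB.
- apply Rle_lt_trans with ((Rabs C + 1) * e).
  + apply Rle_trans with (Rabs C * Wdist h (segment u s) (segment u t)).
    * apply Rmult_le_compat_r; [exact Pd|apply Rle_abs].
    * apply Rmult_le_compat; lra.
  + replace ((Rabs C + 1) * e) with (eps / 2) by (unfold e; field; lra). lra.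
Qed.

Lemma nonlinearity_segment u t :
  nonlinearity (segment u t) = minus (opp (F (u t))) (M (segment u t)).
Proof. unfold nonlinearity, segment at 1. now rewrite Rplus_0_r. Qed.

Lemma Wnorm_history (u phi : R -> Dhalf A) (psi : R -> H) : path (delay_interval h) phi psi ->
  (forall t, - h <= t <= 0 -> u t = phi t) -> Wnorm h u = Wnorm h phi.
Proof.
intros P E.
assert (P' : path (delay_interval h) u psi).
{ apply (path_ext _ phi u psi psi); auto. intros t Ht. symmetry; now apply E. }
rewrite (Wnorm_path h h_pos u psi P'), (Wnorm_path h h_pos phi psi P). f_equal.
apply max_on_ext. intros t Ht. now rewrite E.
Qed.

(** The truncated nonlinearity is globally Lipschitz.  Its radius grows with time
    like the a priori bound, which therefore shows that the truncation is never
    active: one truncated problem gives the solution for all times. *)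
Lemma global_solution phi : in_W h phi -> exists (u : R -> Dhalf A) (v : R -> H),
  path (fun t => - h <= t) u v /\
  (forall t, - h <= t <= 0 -> u t = phi t) /\
  forall T, 0 <= T -> solution_on A h S T u v (fun t => nonlinearity (segment u t)).
Proof.
intros Wphi. assert (P := path_of_in_W h phi Wphi).
set (psi := derive_on _ _) in P.
assert (Pn := Wnorm_ge_0 h h_pos phi psi P).
destruct (a_priori_bound (Wnorm h phi + 1)) as [K [b [HK [Pb Bound]]]]; [lra|].
set (r := fun t => 2 * (K * exp (b * t))).
assert (Pr : forall t, 0 < r t).
{ intros t. unfold r. assert (Q := exp_pos (b * t)).
  assert (0 < K * exp (b * t)) by (apply Rmult_lt_0_compat; lra). lra. }
assert (Mr : forall s t, s <= t -> r s <= r t).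
{ intros s t Hst. unfold r. assert (Q := exp_mono b s t ltac:(lra) Hst).
  apply Rmult_le_compat_l; [lra|]. apply Rmult_le_compat_l; lra. }
set (G := fun t phi => nonlinearity (truncate (r t) phi)).
assert (G_close : forall T, 0 <= T -> exists L, 0 <= L /\
  forall s t phi1 phi2, 0 <= s <= T -> 0 <= t <= T -> in_W h phi1 -> in_W h phi2 ->
  norm (minus (G s phi1) (G t phi2)) <= L * (3 * Wdist h phi1 phi2 + Rabs (r s - r t))).
{ intros T HT. destruct (nonlinearity_lipschitz (r T) (Pr T)) as [L [PL BL]].
  exists L. split; [exact PL|]. intros s t phi1 phi2 Hs Ht W1 W2.
  assert (P1 := path_of_in_W h phi1 W1). assert (P2 := path_of_in_W h phi2 W2).
  eapply Rle_trans.
  - apply BL.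
    + exact (in_W_of_path h h_pos _ _ (truncate_path (r s) _ _ P1)).
    + exact (in_W_of_path h h_pos _ _ (truncate_path (r t) _ _ P2)).
    + eapply Rle_trans; [exact (truncate_norm_le (r s) _ _ (Pr s) P1)|apply Mr; lra].
    + eapply Rle_trans; [exact (truncate_norm_le (r t) _ _ (Pr t) P2)|apply Mr; lra].
  - apply Rmult_le_compat_l; [exact PL|].
    exact (truncate_lipschitz _ _ _ _ _ _ (Pr s) (Pr t) P1 P2). }
destruct (picard_solution h k S h_pos k_ge_0 S_wave G) with (phi := phi) (psi := psi)
  as [u [v [Path [Init Sol]]]].
- intros T HT. destruct (G_close T HT) as [L [PL BL]]. exists (L * 3). split; [lra|].
  intros t phi1 phi2 Ht W1 W2. specialize (BL t t phi1 phi2 Ht Ht W1 W2).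
  rewrite Rminus_diag, Rabs_R0 in BL. lra.
- intros u v Puv. apply (continuous_on_iff (V := H)). intros t Ht eps He.
  destruct (G_close (t + 1)) as [L [PL BL]]; [lra|].
  assert (Puv' : path (fun s => - h <= s <= t + 1) u v)
    by (apply (path_subset (fun t => - h <= t)); [intros; lra|exact Puv]).
  set (e := eps / (5 * (L + 1))).
  assert (Pe : 0 < e) by (apply Rdiv_lt_0_compat; lra).
  destruct (segment_modulus h h_pos (t + 1) u v e ltac:(lra) Puv' Pe) as [d1 [Hd1 Q1]].
  assert (Cr : continuous r t).
  { apply (continuous_scal_r (V := R_NormedModule) 2 (fun t => K * exp (b * t))).
    apply continuous_Cexp. }
  destruct (proj1 (continuous_iff (V := R_NormedModule) r t) Cr e Pe) as [d2 [Hd2 Q2]].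
  exists (Rmin 1 (Rmin d1 d2)). split; [repeat apply Rmin_glb_lt; lra|]. intros s Hs Hst.
  assert (S1 := Rlt_le_trans _ _ _ Hst (Rmin_l _ _)).
  assert (S2 := Rlt_le_trans _ _ _ Hst (Rmin_r _ _)).
  assert (S3 := Rlt_le_trans _ _ _ S2 (Rmin_l _ _)).
  assert (S4 := Rlt_le_trans _ _ _ S2 (Rmin_r _ _)).
  apply Rabs_def2 in S1.
  assert (Hs' : 0 <= s <= t + 1) by lra. assert (Ht' : 0 <= t <= t + 1) by lra.
  specialize (Q1 s t Hs' Ht' S3). specialize (Q2 s S4).
  change (Rabs (r s - r t) < e) in Q2.
  eapply Rle_lt_trans; [apply (BL s t); [exact Hs'|exact Ht'| |]|].
  + exact (in_W_of_path h h_pos _ _ (segment_path (t + 1) u v s Hs' Puv')).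
  + exact (in_W_of_path h h_pos _ _ (segment_path (t + 1) u v t Ht' Puv')).
  + apply Rle_lt_trans with ((L + 1) * (4 * e)).
    * assert (Pd := Wdist_ge_0 h h_pos _ _ _ _ (segment_path (t + 1) u v s Hs' Puv')
        (segment_path (t + 1) u v t Ht' Puv')).
      assert (Pa := Rabs_pos (r s - r t)).
      apply Rmult_le_compat; lra.
    * replace ((L + 1) * (4 * e)) with (4 / 5 * eps) by (unfold e; field; lra). lra.
- exact P.
- exists u, v. split; [exact Path|split; [exact Init|]]. intros T HT.
  assert (Wu : Wnorm h u <= Wnorm h phi + 1) by (rewrite (Wnorm_history u phi psi P Init); lra).
  assert (Puv : path (fun t => - h <= t <= T) u v) by apply (Sol T HT).
  assert (Below := Bound T u v (fun t => G t (segment u t)) HT (Sol T HT) Wu).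
  assert (True_rhs : forall t, 0 <= t <= T -> Wnorm h (segment u t) <= r t ->
    G t (segment u t) = nonlinearity (segment u t)).
  { intros t Ht Ht'. unfold G. rewrite truncate_id; [reflexivity|apply Pr|exact Ht']. }
  specialize (Below True_rhs).
  apply (solution_forcing_ext A h S T u v (fun t => G t (segment u t))); [|exact (Sol T HT)].
  intros t Ht. apply True_rhs; [exact Ht|].
  assert (Kt : K <= K * exp (b * t)).
  { assert (Q := exp_ge_1 b t ltac:(lra) ltac:(lra)).
    rewrite <- (Rmult_1_r K) at 1. apply Rmult_le_compat_l; lra. }
  apply (segment_norm_le T u v (Wnorm h phi + 1) _ t Puv Ht Wu); [lra|].
  intros s Hs. left. eapply Rlt_le_trans; [apply Below; lra|].
  apply Rmult_le_compat_l; [lra|]. apply exp_mono; lra.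
Qed.

(** * Mild solutions *)

Lemma time_domain_limit_point (T : Rbar) t d : Rbar_le 0 T -> time_domain h T t -> 0 < d ->
  exists s, time_domain h T s /\ 0 < Rabs (s - t) < d.
Proof.
intros HT [Ht1 Ht2] Hd.
assert (P1 := Rmax_l 0 t). assert (P2 := Rmax_r 0 t).
destruct (interval_limit_point (- h) (Rmax 0 t) t d) as [s [Hs Q]]; [lra|lra|exact Hd|].
exists s. split; [|exact Q]. split; [apply Hs|].
apply Rbar_le_trans with (Rmax 0 t); [apply Hs|].
unfold Rmax. destruct (Rle_dec 0 t); assumption.
Qed.

Lemma mild_solution_on (T' : Rbar) T phi u : 0 <= T -> Rbar_le T T' ->
  mild_solution h T' S F M phi u ->
  solution_on A h S T u (udot h T' u) (fun t => nonlinearity (segment u t)).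
Proof.
intros HT HT' [Cu [[D1 C1] [_ Mild]]].
assert (Dom : forall t, - h <= t <= T -> time_domain h T' t).
{ intros t Ht. split; [lra|]. apply Rbar_le_trans with T; [apply Ht|exact HT']. }
assert (P : path (fun t => - h <= t <= T) u (udot h T' u)).
{ apply (path_subset (time_domain h T')); [exact Dom|]. split; [exact Cu|split; [exact C1|exact D1]]. }
split; [exact P|split].
- apply (segment_map_cont nonlinearity T u (udot h T' u)); [|exact HT|exact P].
  intros rho Hrho. destruct (nonlinearity_lipschitz rho Hrho) as [L [_ BL]]. now exists L.
- intros t Ht. destruct (Mild t) as [I [HI E]]; [lra| |].
  { apply Rbar_le_trans with T; [apply Ht|exact HT']. }
  exists I. split; [|exact E]. revert HI. apply is_RInt_ext. intros s _.
  now rewrite nonlinearity_segment.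
Qed.

Lemma mild_of_solution phi u v : path (fun t => - h <= t) u v ->
  (forall t, - h <= t <= 0 -> u t = phi t) ->
  (forall T, 0 <= T -> solution_on A h S T u v (fun t => nonlinearity (segment u t))) ->
  mild_solution h p_infty S F M phi u.
Proof.
intros P Init Sol.
assert (P' : path (time_domain h p_infty) u v)
  by (apply (path_subset (fun t => - h <= t)); [intros t [Ht _]; exact Ht|exact P]).
destruct P' as [Cu [Cv D1]].
assert (Ev : forall t, time_domain h p_infty t -> udot h p_infty u t = v t).
{ intros t Dt. apply (derive_on_unique (V := H)); [|now apply D1].
  intros d Hd. apply time_domain_limit_point; [exact I|exact Dt|exact Hd]. }
split; [exact Cu|split; [split|split; [exact Init|]]].
- intros t Dt. change (is_derive_on (time_domain h p_infty) (fun s => emb (u s)) t (udot h p_infty u t)).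
  rewrite Ev by exact Dt. now apply D1.
- apply (continuous_on_ext (V := H) _ v); [|exact Cv]. intros t Dt. symmetry; now apply Ev.
- intros t Ht _. destruct (Sol t Ht) as [_ [_ Du]].
  destruct (Du t ltac:(lra)) as [J [HJ E]]. exists J. split.
  + revert HJ. apply is_RInt_ext. intros s _. now rewrite nonlinearity_segment.
  + rewrite !Ev; [exact E| |]; split; simpl; auto; lra.
Qed.

Lemma mild_dependence rho T : 0 < rho -> 0 <= T -> exists C, forall (T' : Rbar) phi1 phi2 u1 u2,
  Rbar_le T T' -> in_W h phi1 -> in_W h phi2 ->
  Wnorm h phi1 <= rho -> Wnorm h phi2 <= rho ->
  mild_solution h T' S F M phi1 u1 -> mild_solution h T' S F M phi2 u2 ->
  forall t, 0 <= t <= T ->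
  norm (minus (u1 t) (u2 t)) + norm (minus (udot h T' u1 t) (udot h T' u2 t))
  <= C * Wdist h phi1 phi2.
Proof.
intros Hrho HT. destruct (continuous_dependence rho T Hrho HT) as [C [PC HC]].
exists C. intros T' phi1 phi2 u1 u2 HT' W1 W2 N1 N2 S1 S2 t Ht.
assert (I1 := proj1 (proj2 (proj2 S1))). assert (I2 := proj1 (proj2 (proj2 S2))).
assert (P1 := path_of_in_W h phi1 W1). assert (P2 := path_of_in_W h phi2 W2).
assert (E : Wdist h u1 u2 = Wdist h phi1 phi2).
{ apply (Wnorm_history _ _ _ (path_minus _ _ _ _ _ P1 P2)).
  intros s Hs. now rewrite I1, I2. }
rewrite <- E.
apply (HC u1 _ _ u2 _ _ (mild_solution_on T' T phi1 u1 HT HT' S1) (mild_solution_on T' T phi2 u2 HT HT' S2));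
  auto.
- now rewrite (Wnorm_history _ _ _ P1 I1).
- now rewrite (Wnorm_history _ _ _ P2 I2).
Qed.

Lemma mild_unique phi u v : in_W h phi ->
  mild_solution h p_infty S F M phi u -> mild_solution h p_infty S F M phi v ->
  forall t, - h <= t -> v t = u t.
Proof.
intros Wphi Su Sv t Ht.
destruct (Rle_lt_dec t 0) as [L|L].
{ rewrite (proj1 (proj2 (proj2 Su))), (proj1 (proj2 (proj2 Sv))) by lra. reflexivity. }
assert (P := path_of_in_W h phi Wphi).
assert (Pn := Wnorm_ge_0 h h_pos _ _ P).
destruct (mild_dependence (Wnorm h phi + 1) t) as [C HC]; [lra|lra|].
assert (Q := HC p_infty phi phi v u I Wphi Wphi ltac:(lra) ltac:(lra) Sv Su t ltac:(lra)).
assert (Z : Wdist h phi phi = 0).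
{ apply Rle_antisym; [|exact (Wdist_ge_0 h h_pos _ _ _ _ P P)].
  apply (Wdist_le h h_pos _ _ _ _ P P). intros s s' _ _.
  rewrite norm_minus_self, (norm_minus_self (V := H)). lra. }
rewrite Z, Rmult_0_r in Q.
assert (Q' := norm_ge_0 (V := H) (minus (udot h p_infty v t) (udot h p_infty u t))).
apply (eq_of_small _ _ 1). intros eps He. one_path. lra.
Qed.

Lemma mild_energy (T : Rbar) phi u t : mild_solution h T S F M phi u ->
  0 <= t -> Rbar_le t T ->
  energy Pi0 Pi1 (u t) (udot h T u t)
    + k * RInt (fun s => norm (udot h T u s) ^ 2) 0 t
  = energy Pi0 Pi1 (u 0) (udot h T u 0)
    - RInt (fun s => inner (Fstar (u s)) (udot h T u s)) 0 t
    - RInt (fun s => inner (M (segment u s)) (udot h T u s)) 0 t.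
Proof.
intros Su Ht HT.
assert (Sol := mild_solution_on T t phi u Ht HT Su).
set (v := udot h T u) in *.
assert (P : path (fun s => - h <= s <= t) u v) by apply Sol.
assert (En := solution_nonlinear_energy A h k S h_pos k_ge_0 S_wave Pi dPi F Fstar
  (fun s => M (segment u s)) t u v _ Pi_diff F_lip Fstar_locally_lipschitz F_split Ht Sol
  (fun s _ => nonlinearity_segment u s)).
assert (Cv : continuous_on (fun s => 0 <= s <= t) v).
{ apply (continuous_on_subset (V := H) (fun s => - h <= s <= t)); [intros; lra|apply P]. }
assert (Cu : continuous_on (fun s => 0 <= s <= t) u).
{ apply (continuous_on_subset (fun s => - h <= s <= t)); [intros; lra|apply P]. }
assert (CM := segment_map_cont M t u v M_lip Ht P).
assert (CF : continuous_on (fun s => 0 <= s <= t) (fun s => Fstar (u s))).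
{ apply (continuous_on_ext (V := H) _ (fun s => Fstar (u (clamp 0 t s)))).
  - intros s Hs. now rewrite clamp_id.
  - apply (continuous_on_of_continuous (V := H)). intros s.
    apply (locally_lipschitz_cont A Fstar (fun s => u (clamp 0 t s)) s Fstar_locally_lipschitz).
    now apply (continuous_clamp (fun s => 0 <= s <= t)). }
assert (I1 : ex_RInt (fun s => norm (v s) ^ 2) 0 t).
{ apply (ex_RInt_ext (V := R_NormedModule) (fun s => inner (v s) (v s))).
  - intros s _. symmetry. apply norm_sq.
  - apply (ex_RInt_on (V := R_CompleteNormedModule)); [exact Ht|].
    now apply continuous_on_inner. }
assert (I2 : ex_RInt (fun s => inner (Fstar (u s)) (v s)) 0 t).
{ apply (ex_RInt_on (V := R_CompleteNormedModule)); [exact Ht|]. now apply continuous_on_inner. }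
assert (I3 : ex_RInt (fun s => inner (M (segment u s)) (v s)) 0 t).
{ apply (ex_RInt_on (V := R_CompleteNormedModule)); [exact Ht|]. now apply continuous_on_inner. }
apply (RInt_correct (V := R_CompleteNormedModule)) in I1.
apply (RInt_correct (V := R_CompleteNormedModule)) in I2.
apply (RInt_correct (V := R_CompleteNormedModule)) in I3.
assert (Sum := is_RInt_minus (V := R_NormedModule) _ _ _ _ _ _
  (is_RInt_minus (V := R_NormedModule) _ _ _ _ _ _
    (is_RInt_scal (V := R_NormedModule) _ _ _ (- k) _ I1) I2) I3).
assert (E := is_RInt_eq (V := R_NormedModule) _ _ _ _ _ En Sum).
set (J1 := RInt (fun s => norm (v s) ^ 2) 0 t) in *.
set (J2 := RInt (fun s => inner (Fstar (u s)) (v s)) 0 t) in *.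
set (J3 := RInt (fun s => inner (M (segment u s)) (v s)) 0 t) in *.
change (/ 2 * (norm (u t) ^ 2 + norm (v t) ^ 2) + Pi (u t)
  - (/ 2 * (norm (u 0) ^ 2 + norm (v 0) ^ 2) + Pi (u 0)) = - k * J1 - J2 - J3) in E.
rewrite !Pi_split in E. unfold energy. lra.
Qed.

End Equation.

Theorem theorem2p4 (H : Hilbert) (A : DiscreteOperator H) (h k : R)
  (S : R -> Yspace A -> Yspace A)
  (F Fstar : Dhalf A -> H) (Pi Pi0 Pi1 : Dhalf A -> R)
  (dPi : Dhalf A -> Dhalf A -> R)
  (M : (R -> Dhalf A) -> H) (c0 M0 M1 : R)
  (h_pos : 0 < h) (k_pos : 0 < k)
  (S_wave : wave_semigroup A k S)
  (F_lip : forall r : R, 0 < r -> exists L : R, 0 < L /\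
     forall u1 u2 : Dhalf A, norm u1 <= r -> norm u2 <= r ->
     norm (minus (F u1) (F u2)) <= L * norm (minus u1 u2))
  (Pi_C1 : C1_functional Pi dPi)
  (F_split : forall u v : Dhalf A,
     inner (F u) (emb v) = dPi u v + inner (Fstar u) (emb v))
  (Fstar_lip : forall u1 u2 : Dhalf A,
     norm (minus (Fstar u1) (Fstar u2)) ^ 2 <= c0 * norm (minus u1 u2) ^ 2)
  (Pi_split : forall u : Dhalf A, Pi u = Pi0 u + Pi1 u)
  (Pi0_ge_0 : forall u : Dhalf A, 0 <= Pi0 u)
  (Pi0_bounded : forall r : R, exists C : R,
     forall u : Dhalf A, norm u <= r -> Rabs (Pi0 u) <= C)
  (Pi1_bound : forall eta : R, 0 < eta -> exists C : R, 0 < C /\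
     forall u : Dhalf A, Rabs (Pi1 u) <= eta * (norm u ^ 2 + Pi0 u) + C)
  (M_lip : forall rho : R, 0 < rho -> exists C : R,
     forall phi1 phi2 : R -> Dhalf A, in_W h phi1 -> in_W h phi2 ->
     Wnorm h phi1 <= rho -> Wnorm h phi2 <= rho ->
     norm (minus (M phi1) (M phi2)) <= C * Wdist h phi1 phi2)
  (M0_ge_0 : 0 <= M0) (M1_ge_0 : 0 <= M1)
  (M_growth : forall phi : R -> Dhalf A, in_W h phi ->
     norm (M phi) <= M0 + M1 * Wnorm h phi) :
  (forall phi : R -> Dhalf A, in_W h phi ->
     exists u : R -> Dhalf A,
       mild_solution h p_infty S F M phi u /\
       forall v : R -> Dhalf A, mild_solution h p_infty S F M phi v ->
       forall t : R, - h <= t -> v t = u t) /\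
  (forall (T : Rbar) (phi u : R -> Dhalf A), in_W h phi ->
     mild_solution h T S F M phi u ->
     forall t : R, 0 <= t -> Rbar_le t T ->
     energy Pi0 Pi1 (u t) (udot h T u t)
       + k * RInt (fun s => norm (udot h T u s) ^ 2) 0 t
     = energy Pi0 Pi1 (u 0) (udot h T u 0)
       - RInt (fun s => inner (Fstar (u s)) (udot h T u s)) 0 t
       - RInt (fun s => inner (M (segment u s)) (udot h T u s)) 0 t) /\
  (forall rho T : R, 0 < rho -> 0 < T -> exists C : R,
     forall (T' : Rbar) (phi1 phi2 u1 u2 : R -> Dhalf A),
     Rbar_le T T' -> in_W h phi1 -> in_W h phi2 ->
     Wnorm h phi1 <= rho -> Wnorm h phi2 <= rho ->
     mild_solution h T' S F M phi1 u1 -> mild_solution h T' S F M phi2 u2 ->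
     forall t : R, 0 <= t <= T ->
     norm (minus (u1 t) (u2 t)) + norm (minus (udot h T' u1 t) (udot h T' u2 t))
     <= C * Wdist h phi1 phi2).
Proof.
assert (k_ge_0 : 0 <= k) by lra.
destruct Pi_C1 as [Pi_diff _].
split; [|split].
- intros phi Wphi.
  destruct (global_solution h k S F Fstar Pi Pi0 Pi1 dPi M c0 M0 M1) with (phi := phi)
    as [u [v [Path [Init Sol]]]]; try eassumption.
  assert (Su : mild_solution h p_infty S F M phi u)
    by (eapply mild_of_solution; eassumption).
  exists u. split; [exact Su|]. intros w Sw.
  apply (mild_unique h k S F Fstar Pi Pi0 Pi1 dPi M c0 M0 M1) with (phi := phi); assumption.
- intros T phi u _ Su t Ht HT.
  apply (mild_energy h k S F Fstar Pi Pi0 Pi1 dPi M c0) with (phi := phi); assumption.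
- intros rho T Hrho HT.
  apply (mild_dependence h k S F Fstar Pi Pi0 Pi1 dPi M c0 M0 M1); try assumption. lra.
Qed.
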